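(* Let $n\ge2$ and $a_1,\dots,a_{n-1}\in\{0,1\}$, and let $\alpha:\mathbb{F}_2^n\to\mathbb{F}_2^n$ be the linear map $(z_0,\dots,z_{n-1})\mapsto(z'_0,\dots,z'_{n-1})$ with $z'_i=z_{i+1}$ for $i<n-1$ and $z'_{n-1}=z_0+\sum_{i=1}^{n-1}a_iz_i\pmod 2$. Assume $\alpha$ is maximal (the $2^n-1$ nonzero bitstrings form a single orbit). Let $\mathbf{1}=(0,\dots,0,1)$, $\omega=e^{2\pi i/(2^n-1)}$, and for $q\in\{0,\dots,2^n-2\}$ let $|\psi_q\rangle=(2^n-1)^{-1/2}\sum_{j=0}^{2^n-2}\omega^{qj}|\alpha^j\mathbf 1\rangle$. Then for all $q,q'\ne0$ and every operator $O$ supported on a set of $\ell$ qubits, $$\langle\psi_q|O|\psi_{q'}\rangle=2^{-n}\mathrm{Tr}(O)\,\delta_{q,q'}+2^{-n/2}R^O_{qq'}\quad\text{with}\quad |R^O_{qq'}|\le 2^{2+\ell}\|O\|_{\mathrm{op}}.$$ Moreover, for every $q\ne0$ and every set $A$ of $\ell$ qubits, the von Neumann entanglement entropy of $|\psi_q\rangle$ across $A$ satisfies $$S_A(|\psi_q\rangle)\ge \ell\ln 2-2^{4+2\ell-n}.$$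
   Context: $|\mathbf z\rangle$ is the computational basis state of bitstring $\mathbf z$; $\mathrm{Tr}(O)$ is the trace over all $n$ qubits of $O$ extended by the identity; $S_A(|\psi\rangle)=-\mathrm{Tr}\rho_A\ln\rho_A$ with $\rho_A$ the reduced density matrix on $A$. The states $|\psi_q\rangle$ with $q\neq 0$ are eigenstates of the unitary $U|\mathbf z\rangle=|\alpha\mathbf z\rangle$ with eigenvalue $\omega^{-q}$. *)

(* Defs.v *)
From HB Require Import structures.
From mathcomp Require Import all_boot all_order all_algebra.
From mathcomp Require Import complex.
From mathcomp Require Import classical_sets reals exp trigo.


Import Order.TTheory GRing.Theory Num.Theory.
Local Open Scope ring_scope.

Definition bits (n : nat) := {ffun 'I_n -> bool}.

(* z_k as a function of a natural index k (false outside 0..n-1). *)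
Definition nbit {n : nat} (z : bits n) (k : nat) : bool :=
  oapp z false (insub k : option 'I_n).

Definition alpha {n : nat} (a : nat -> bool) (z : bits n) : bits n :=
  [ffun i : 'I_n => if (i.+1 < n)%N then nbit z i.+1
                    else nbit z 0 (+) \big[addb/false]_(1 <= k < n) (a k && nbit z k)].

Definition zero_bits (n : nat) : bits n := [ffun => false].

Definition one_bits (n : nat) : bits n := [ffun i : 'I_n => i.+1 == n].

Definition maximal (n : nat) (a : nat -> bool) : Prop :=
  forall z z' : bits n, z != zero_bits n -> z' != zero_bits n ->
    exists j : nat, iter j (@alpha n a) z = z'.

Local Open Scope complex_scope.

Definition omega (R : realType) (n : nat) : R[i] :=
  (cos (2 * pi / (2 ^ n - 1)%:R)) +i* (sin (2 * pi / (2 ^ n - 1)%:R)).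

Definition state (R : realType) (n : nat) := bits n -> R[i].
(* n-qubit operators: matrix elements <z|O|z'>. *)
Definition operator (R : realType) (n : nat) := bits n -> bits n -> R[i].

Definition psi (R : realType) {n : nat} (a : nat -> bool) (q : nat) : state R n :=
  fun z => ((Num.sqrt ((2 ^ n - 1)%:R : R))^-1)%:C *
    \sum_(j < 2 ^ n - 1) omega R n ^+ (q * j) * (iter j (@alpha n a) (one_bits n) == z)%:R.

Definition braket {R : realType} {n : nat} (phi : state R n) (O : operator R n)
  (chi : state R n) : R[i] :=
  \sum_(z : bits n) \sum_(z' : bits n) (phi z)^* * O z z' * chi z'.

Definition trace {R : realType} {n : nat} (O : operator R n) : R[i] :=
  \sum_(z : bits n) O z z.

Definition vnorm {R : realType} {n : nat} (v : state R n) : R :=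
  Num.sqrt (\sum_(z : bits n) ComplexField.Normc.normc (v z) ^+ 2).

Definition apply_op {R : realType} {n : nat} (O : operator R n) (v : state R n) : state R n :=
  fun z => \sum_(z' : bits n) O z z' * v z'.

Definition opnorm {R : realType} {n : nat} (O : operator R n) : R :=
  sup [set r : R | exists v : state R n, vnorm v = 1 /\ r = vnorm (apply_op O v)].

Definition subA {n : nat} (A : {set 'I_n}) := {i : 'I_n | i \in A}.
Definition localbits {n : nat} (A : {set 'I_n}) := {ffun subA A -> bool}.
Definition restr {n : nat} (A : {set 'I_n}) (z : bits n) : localbits A :=
  [ffun i : subA A => z (val i)].
Definition agree_off {n : nat} (A : {set 'I_n}) (z z' : bits n) : bool :=
  [forall i : 'I_n, (i \notin A) ==> (z i == z' i)].

(* O is supported on the qubits in A: O = O_A (x) Id_{A^c}. *)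
Definition supported_on {R : realType} {n : nat} (A : {set 'I_n}) (O : operator R n) : Prop :=
  exists g : localbits A -> localbits A -> R[i],
    forall z z' : bits n, O z z' = (agree_off A z z')%:R * g (restr A z) (restr A z').

(* reduced density matrix rho_A = Tr_{A^c} |phi><phi|, as a 2^|A| x 2^|A| matrix *)
Definition rho_entry {R : realType} {n : nat} (A : {set 'I_n}) (phi : state R n)
  (x y : localbits A) : R[i] :=
  \sum_(z : bits n | restr A z == x)
    \sum_(z' : bits n | (restr A z' == y) && agree_off A z z') phi z * (phi z')^*.

Definition rhoA {R : realType} {n : nat} (A : {set 'I_n}) (phi : state R n) :
  'M[R[i]]_(#|{: localbits A}|) :=
  \matrix_(i, j) rho_entry A phi (enum_val i) (enum_val j).

(* eigenvalues (with multiplicity) of a square complex matrix: roots of its characteristic polynomial *)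
Definition eigenvalues {R : realType} {m : nat} (M : 'M[R[i]]_m) : seq R[i] :=
  sval (closed_field_poly_normal (char_poly M)).

(* von Neumann entropy S_A = -Tr rho_A ln rho_A = - sum_lambda lambda ln lambda
   (eigenvalues of the Hermitian PSD rho_A are real; 0 ln 0 = 0 since the factor is 0) *)
Definition entropyA {R : realType} {n : nat} (A : {set 'I_n}) (phi : state R n) : R :=
  - \sum_(l <- eigenvalues (rhoA A phi)) (complex.Re l * ln (complex.Re l)).

(* Main.v *)
(* Maximality of alpha means that the register is the field F of 2^n elements,
   with alpha the multiplication by a generator; psi_q is then a nontrivial
   multiplicative character chi.  The matrix element between psi_q and psi_q' of
   a Pauli operator X^x Z^p, with x <> 0, is a normalised mixed sum over y of
   chi(y) chi'(y + 1)^* psi(y), with psi an additive character of F.  Its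
   L-function has degree 2, so a bound on the sums over all extensions of F,
   uniform up to a constant factor, gives the bound 2 * 2^(n/2) over F itself.
   Over extensions of square order Q = B^2 the substitution w^2 + w = c x trades
   psi for a pure multiplicative sum, which a Stepanov-Bombieri argument
   controls: the ingredients of the auxiliary polynomial are B-th powers.
   Parseval over the 4^l Pauli operators on A bounds the Frobenius distance from
   the reduced matrix of |psi_q'><psi_q| to delta_qq' 2^-l; Cauchy-Schwarz turns
   this into the matrix element bound, and concavity of ln into the entropy
   bound. *)
Require Import Defs.
From HB Require Import structures.
From mathcomp Require Import all_boot all_order all_algebra.
From mathcomp Require Import complex.
From mathcomp Require Import all_field zify ring lra.
Import Order.TTheory GRing.Theory Num.Theory.
Local Open Scope ring_scope.
Set Implicit Arguments.
Unset Strict Implicit.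
Unset Printing Implicit Defensive.

(** * Irreducibility and resultants *)

(** The Stepanov estimate over the extension of degree 2k has the form K q^k, where q = 2^n and K
    may itself grow with q, since it depends on exponents up to q - 2. Over F directly it would be
    worthless. What removes K is that all these sums equal -(l1^(2k) + l2^(2k)) for two fixed
    numbers: letting k grow forces |l1|, |l2| <= sqrt q, and even degrees suffice for this. The
    auxiliary polynomial bounds each fibre count only from above. The lower side is free, because
    the fibres together fill almost the whole field. The obstacle is to show that the auxiliary
    polynomial is not zero. This needs T^d - f(Y)/f(x) to be irreducible, hence two roots of f whose
    multiplicities have a gcd prime to d; the common divisor of the exponents and q - 1 is divided
    out for that purpose. Constants: 2 sqrt q / (q - 1) <= 4 / sqrt q bounds a Pauli element, so the
    squared Frobenius distance is at most 2^l * 16 / 2^n. An operator on l qubits has Frobenius norm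
    at most 2^(l/2) times its operator norm, whence 2^(2+l). The entropy bound costs 2^l times the
    squared distance, whence 2^(4+2l-n). *)

Lemma companion_ex (E : fieldType) n (h : {poly E}) :
  h \is monic -> size h = n.+2 -> exists A : 'M[E]_n.+1, char_poly A = h.
Proof.
move=> hm sz; have e : (size h).-1 = n.+1 by rewrite sz.
move: (companionmx h) (companionmxK hm); rewrite e => A hA.
by exists A.
Qed.

Lemma frac_numden (R : idomainType) (c : {fraction R}) :
  exists u v : R, v != 0 /\ c * tofrac v = tofrac u.
Proof.
elim/quotW: c => x; exists (x : R * R).1, (x : R * R).2.
split; first exact: denom_ratioP.
rewrite -[_ * _]/(FracField.mul (\pi_(FracField.type R)%qT x) (tofrac _)).
rewrite !piE; apply/eqmodP => /=.
rewrite FracField.equivfE /FracField.mulf !numden_Ratio;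
  rewrite ?mulr1 ?oner_neq0 ?mulf_neq0 ?denom_ratioP //.
by rewrite mulrC.
Qed.

(* The determinant of the companion matrix is the norm of a root: a factor of
   degree r of X^d - g forces g^r to be a d-th power. *)
Lemma XnsubC_factor_pow (E : fieldType) (d n : nat) (g : E) (h : {poly E}) :
  h %| 'X^d - g%:P -> size h = n.+2 -> exists c, c ^+ d = g ^+ n.+1.
Proof.
move=> hdv sz.
have h0 : h != 0 by rewrite -size_poly_gt0 sz.
pose h' := (lead_coef h)^-1 *: h.
have lc0 : lead_coef h != 0 by rewrite lead_coef_eq0.
have hm : h' \is monic by rewrite monicE lead_coefZ mulVf.
have sz' : size h' = n.+2 by rewrite size_scale ?invr_eq0.
have [A hA] := companion_ex hm sz'.
exists (\det A).
have : horner_mx A ('X^d - g%:P) = 0.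
  have /dvdpP [t ->] : h' %| 'X^d - g%:P by rewrite dvdpZl ?invr_eq0.
  by rewrite rmorphM /= -hA Cayley_Hamilton mulr0.
rewrite rmorphB rmorphXn /= horner_mx_X horner_mx_C => /eqP.
rewrite subr_eq0 => /eqP /(congr1 determinant).
rewrite det_scalar => <-.
elim: (d) => [|k IH]; first by rewrite !expr0 det1.
by rewrite !exprS det_mulmx IH.
Qed.

(** If the resultant vanished, a common factor of degree r with 0 < r < d would divide Y^d - F/e
    over the fraction field, so (F/e)^r would be a d-th power there. Multiplicities at s1 and s2
    then give d | r a and d | r b, hence d | r. *)
Lemma resultant_kummer_neq0 (E : fieldType) (d a b : nat) (e s1 s2 : E)
    (F g1 g2 : {poly E}) (p : {poly {poly E}}) :
  (0 < d)%N -> e != 0 -> F = ('X - s1%:P) ^+ a * g1 -> ~~ root g1 s1 ->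
  F = ('X - s2%:P) ^+ b * g2 -> ~~ root g2 s2 -> coprime (gcdn a b) d ->
  p != 0 -> (size p <= d)%N ->
  resultant p (e%:P%:P * 'X^d - F%:P) != 0.
Proof.
move=> d0 e0 F1 r1 F2 r2 cop p0 sp.
have mup1 (s : E) k g : F = ('X - s%:P) ^+ k * g -> ~~ root g s -> mup s F = k.
  by move=> -> hg; rewrite mupMl // mup_XsubCX eqxx.
have F0 : F != 0.
  have g10 : g1 != 0 by apply: contra r1 => /eqP ->; rewrite root0.
  by rewrite F1 mulf_neq0 // expf_neq0 // polyXsubC_eq0.
set q := (_ - _ : {poly {poly E}}).
rewrite resultant_eq0 -leqNgt; set h := gcdp p q; rewrite leqNgt.
apply/negP => hs.
pose tf : {rmorphism {poly E} -> {fraction {poly E}}} := @tofrac {poly E}.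
have tfi : injective tf by move=> x y /eqP; rewrite /= tofrac_eq => /eqP.
have szm (u : {poly {poly E}}) : size (map_poly tf u) = size u.
  by apply: size_map_inj_poly; rewrite ?rmorph0.
have hq : h %| q by apply: dvdp_gcdr.
have hp : h %| p by apply: dvdp_gcdl.
have hsz : (size h <= d)%N by apply: leq_trans sp; apply: dvdp_leq.
have [n hn] : exists n, size h = n.+2.
  by exists (size h).-2; move: hs; case: (size h) => [|[]].
have e0' : tf e%:P != 0 by rewrite /= tofrac_eq0 polyC_eq0.
have : map_poly tf h %| map_poly tf q.
  move: hq => /Pdiv.Idomain.dvdpP [[c t]] /= c0 ct.
  have c0' : tf c != 0 by rewrite /= tofrac_eq0.
  rewrite -(dvdpZr _ _ c0') -map_polyZ /= ct rmorphM /=.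
  by apply: dvdp_mull.
set g := tf F / tf e%:P.
have -> : map_poly tf q = (tf e%:P) *: ('X^d - g%:P).
  rewrite /q rmorphB rmorphM /= !map_polyC /= map_polyXn scalerBr.
  rewrite -mul_polyC /g; congr (_ - _).
  by rewrite -mul_polyC -polyCM mulrCA mulfV ?mulr1.
rewrite dvdpZr // => /(XnsubC_factor_pow (n := n)).
rewrite szm => /(_ hn) [c hc].
have [u [v [v0 /= cE]]] := frac_numden c.
have E1 : u ^+ d * e%:P ^+ n.+1 = F ^+ n.+1 * v ^+ d.
  apply: tfi; rewrite !rmorphM !rmorphXn /= -cE exprMn hc /g expr_div_n.
  by rewrite mulrAC mulrVK ?unitfE ?expf_neq0.
have u0 : u != 0.
  apply/negP => /eqP u0; have /eqP := E1; rewrite u0 expr0n gtn_eqF // mul0r.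
  by rewrite eq_sym mulf_eq0 !expf_eq0 (negPf F0) (negPf v0) !andbF.
have mupX (s : E) (w : {poly E}) k : w != 0 -> mup s (w ^+ k) = (k * mup s w)%N.
  move=> w0; elim: k => [|k IH]; first by rewrite expr0 mupNroot ?root1.
  by rewrite exprS mupM ?expf_neq0 // IH mulSn.
(* Multiplicities at s are compared in u^d e^(n+1) = F^(n+1) v^d; the constant e contributes
   none. *)
have dv (s : E) : (d %| n.+1 * mup s F)%N.
  have := congr1 (mup s) E1.
  rewrite [LHS]mupMl; last by rewrite rootE horner_exp hornerC expf_neq0.
  rewrite mupM ?expf_neq0 // !mupX // => E2.
  by rewrite -(dvdn_addl _ (dvdn_mulr (mup s v) (dvdnn d))) -E2 dvdn_mulr.
have : (d %| n.+1 * gcdn a b)%N.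
  rewrite muln_gcdr dvdn_gcd.
  by rewrite -{1}(mup1 _ _ _ F1 r1) -(mup1 _ _ _ F2 r2) !dv.
rewrite Gauss_dvdl; last by rewrite coprime_sym.
by move=> /dvdn_leq => /(_ isT); rewrite leqNgt -ltnS -hn ltnS hsz.
Qed.

(** Coefficients of degree below B are the digits of the value in base X^B, so no two of them can
    cancel. *)
Lemma horner_Xn_eq0 (L : fieldType) (B : nat) (p : {poly {poly L}}) :
  (forall j, (size (p`_j)%R <= B)%N) -> p.['X^B] = 0 -> p = 0.
Proof.
elim/poly_ind: p => // p c IH hs; rewrite hornerMXaddC => /eqP.
rewrite addr_eq0 => /eqP E.
have sc : (size c <= B)%N by have := hs 0%N; rewrite coefD coefMX coefC add0r.
have p0 : p.['X^B] = 0.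
  apply/eqP; apply/negP => /negP p0; have := congr1 (size \o polyseq) E => /=.
  rewrite size_polyN size_Mmonic ?monicXn // size_polyXn addnS /= => E'.
  by have := sc; rewrite -E' leqNgt -addn1 addnC leq_add2r size_poly_gt0 p0.
have c0 : c = 0 by apply/eqP; rewrite -oppr_eq0 -E p0 mul0r.
rewrite IH ?mul0r ?c0 ?addr0 // => j.
by have := hs j.+1; rewrite coefD coefMX coefC /= addr0.
Qed.

Lemma size_det_le (R : comNzRingType) N e (M : 'M[{poly R}]_N) :
  (forall i j, size (M i j) <= e.+1)%N -> (size (\det M) <= (N * e).+1)%N.
Proof.
move=> hM; apply: leq_trans (size_sum _ _ _) _; apply/bigmax_leqP => s _.
rewrite mulr_sign; case: ifP => _; rewrite ?size_polyN.
all: apply: leq_trans (size_prod_leq _ _) _.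
all: rewrite leq_subLR cardT size_enum_ord addnS ltnS -mulnS.
all: by rewrite -[X in (_ <= X * _)%N]card_ord -sum_nat_const leq_sum.
Qed.

(** Exchanging the two variables commutes with the determinant and turns the inner degree into the
    outer one. *)
Lemma sizeY_det_le (R : comNzRingType) N e (M : 'M[{poly {poly R}}]_N) :
  (forall i j, sizeY (M i j) <= e.+1)%N -> (sizeY (\det M) <= (N * e).+1)%N.
Proof.
move=> hM; pose sw : {rmorphism {poly {poly R}} -> {poly {poly R}}} := @swapXY R.
rewrite sizeYE -[swapXY _]/(sw _) -det_map_mx; apply: size_det_le => i j.
by rewrite mxE -sizeYE.
Qed.

Lemma sizeY_sub_le (R : comNzRingType) e (u v : {poly {poly R}}) :
  (sizeY u <= e -> sizeY v <= e -> sizeY (u - v) <= e)%N.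
Proof.
rewrite !sizeYE => hu hv; rewrite raddfB /=; apply: leq_trans (size_polyD _ _) _.
by rewrite geq_max size_polyN hu hv.
Qed.

(* With Y standing for x^B, the power f^s is a d-th root of f(Y)/f(x); the
   relation contradicts the nonvanishing of a resultant of small x-degree. *)
Lemma frobenius_independence (L : fieldType) (d s B D a b : nat) (s1 s2 : L)
    (f g1 g2 : {poly L}) (k : nat -> {poly {poly L}}) :
  (0 < d)%N -> B = (d * s).+1 -> (2 * d * D <= B)%N -> (size f <= D)%N ->
  f ^+ B = f \Po 'X^B ->
  f = ('X - s1%:P) ^+ a * g1 -> ~~ root g1 s1 ->
  f = ('X - s2%:P) ^+ b * g2 -> ~~ root g2 s2 -> coprime (gcdn a b) d ->
  (forall i j, (size ((k i)`_j)%R <= D)%N) ->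
  \sum_(i < d) (k i).['X^B] * f ^+ (i * s) = 0 ->
  forall i, (i < d)%N -> k i = 0.
Proof.
move=> d0 Bd BD fD fB f1 r1 f2 r2 cop kD rel.
have f0 : f != 0.
  have g10 : g1 != 0 by apply: contra r1 => /eqP ->; rewrite root0.
  by rewrite f1 mulf_neq0 // expf_neq0 // polyXsubC_eq0.
have D0 : (0 < D)%N by apply: leq_trans fD; rewrite size_poly_gt0.
pose p := \poly_(i < d) k i.
suff p0 : p = 0 by move=> i id; rewrite -[RHS](coef0 _ i) -p0 coef_poly id.
apply/eqP; apply/negP => /negP p0.
(* Three variables, T outermost, then Y, then x: [q] is f(x) T^d - f(Y). It vanishes at Y = x^B, T =
   f^s because f^(d s + 1) = f^B = f(x^B). *)
pose q : {poly {poly {poly L}}} := f%:P%:P * 'X^d - (map_poly polyC f)%:P.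
have sq : size q = d.+1.
  rewrite /q size_polyDl ?size_Cmul ?size_polyXn ?polyC_eq0 //.
  by rewrite size_polyN size_polyC; case: eqP.
have sp : (size p <= d)%N by apply: size_poly.
pose tf : {rmorphism {poly L} -> {fraction {poly L}}} := @tofrac {poly L}.
have tfi : injective tf by move=> x y /eqP; rewrite /= tofrac_eq => /eqP.
(* Over the field L(x) of coefficients, f(x) becomes a nonzero constant while f(Y) keeps its roots
   s1 and s2 with their multiplicities. *)
pose mt : {rmorphism {poly {poly L}} -> {poly {fraction {poly L}}}} := map_poly tf.
have mti : injective mt by apply: map_inj_poly; rewrite ?rmorph0.
pose cc : {rmorphism L -> {fraction {poly L}}} := tf \o polyC.
have facF c e (g : {poly L}) : f = ('X - c%:P) ^+ e * g -> ~~ root g c ->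
    map_poly cc f = ('X - (cc c)%:P) ^+ e * map_poly cc g /\
    ~~ root (map_poly cc g) (cc c).
  by move=> -> hg; rewrite rmorphM rmorphXn /= map_polyXsubC fmorph_root.
have [h1 h1'] := facF _ _ _ f1 r1; have [h2 h2'] := facF _ _ _ f2 r2.
have r0 : resultant p q != 0.
  apply/negP => /eqP /(congr1 mt).
  rewrite rmorph0 map_resultant ?(raddf_eq0 _ mti) ?lead_coef_eq0 ?p0 //;
    last by rewrite -size_poly_eq0 sq.
  apply/eqP.
  have -> : map_poly mt q = (tf f)%:P%:P * 'X^d - (map_poly cc f)%:P.
    rewrite rmorphB rmorphM /= map_polyXn !map_polyC /= map_polyC /=.
    by rewrite /mt map_poly_comp.
  apply: resultant_kummer_neq0 h1 h1' h2 h2' cop _ _ => //.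
  - by rewrite /= tofrac_eq0.
  - by rewrite -size_poly_eq0 size_map_inj_poly ?rmorph0 // size_poly_eq0.
  - by rewrite size_map_inj_poly ?rmorph0.
pose ev : {rmorphism {poly {poly L}} -> {poly L}} := horner_eval 'X^B.
have evp : (map_poly ev p).[f ^+ s] = 0.
  rewrite (@horner_coef_wide _ d); last first.
    by apply: leq_trans (size_poly _ _) _.
  rewrite -[RHS]rel; apply: eq_bigr => i _.
  by rewrite coef_map coef_poly ltn_ord /= /horner_eval -exprM mulnC.
have evq : (map_poly ev q).[f ^+ s] = 0.
  rewrite rmorphB rmorphM /= map_polyXn !map_polyC /= !hornerE.
  rewrite /horner_eval hornerC -exprM mulnC -exprS -Bd fB.
  by rewrite /comp_poly subrr.
(* [resultant_in_ideal] wants positive degree in T; when [p] is constant in T, the digit argument on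
   [k 0] is enough. *)
have [sp1|sp1] := leqP (size p) 1.
  have pE := size1_polyC sp1.
  have k0 : p`_0 = k 0%N by rewrite coef_poly d0.
  have: k 0%N = 0.
    apply: (@horner_Xn_eq0 _ B).
      by move=> j; apply: leq_trans (kD 0%N j) (leq_trans _ BD); rewrite leq_pmull // muln_gt0.
    by move: evp; rewrite pE map_polyC hornerC k0.
  by move: p0; rewrite pE polyC_eq0 k0 => /negP h /eqP.
have sq1 : (1 < size q)%N by rewrite sq.
(* The resultant is a combination of [p] and [q], free of T, so it vanishes at Y = x^B as soon as
   both do at T = f^s. *)
have [[u v] _ /= uv] := resultant_in_ideal sp1 sq1.
have er : (resultant p q).['X^B] = 0.
  have /(congr1 (fun w => (map_poly ev w).[f ^+ s])) := uv.
  by rewrite map_polyC hornerC !rmorphD !rmorphM hornerD !hornerM evp evq !mulr0 addr0.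
case/negP: r0; apply/eqP; apply: horner_Xn_eq0 er => j.
apply: leq_trans (max_size_coefXY _ _) _.
have D1 : D.-1.+1 = D by rewrite prednK.
apply: (leq_trans (@sizeY_det_le _ _ D.-1 _ _)).
  move=> i j'; rewrite Sylvester_mxE D1 /=.
  have sY0 : (sizeY (0 : {poly {poly L}}) <= D)%N by rewrite sizeYE rmorph0 size_poly0.
  case: split => i'; case: (i' <= j')%N; rewrite ?mulr0n ?mulr1n //.
    rewrite /p coef_poly; case: ifP => // _; apply/bigmax_leqP => t _; exact: kD.
  rewrite coefB coefCM coefXn coefC.
  apply: sizeY_sub_le.
    case: eqP => _; rewrite ?mulr0 // mulr1 sizeYE swapXY_polyC.
    by rewrite size_map_polyC.
  case: eqP => _; rewrite // sizeYE swapXY_map_polyC.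
  by rewrite (leq_trans (size_polyC_leq1 _)).
(* The Sylvester matrix has at most 2d rows with entries of x-degree at most D - 1, so the resultant
   has x-degree at most 2d(D - 1) < B. *)
apply: leq_trans BD; rewrite -[X in (_ < _ * X)%N]D1 mulnS sq /=.
have hle : (d + (size p).-1 <= 2 * d)%N by lia.
apply: leq_ltn_trans (leq_mul hle (leqnn _)) _.
by rewrite -[X in (X < _)%N]add0n ltn_add2r muln_gt0.
Qed.

(** * The auxiliary polynomial *)

Lemma poly_family_dep (L : fieldType) (I : finType) n (V : I -> {poly L}) :
  (forall i, size (V i) <= n)%N -> (n < #|I|)%N ->
  exists c : I -> L, (exists i, c i != 0) /\ \sum_i c i *: V i = 0.
Proof.
move=> hV hn; pose M := \matrix_(i < #|I|) (poly_rV (V (enum_val i)) : 'rV[L]_n).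
have : kermx M != 0.
  rewrite kermx_eq0 /row_free; apply/negP => /eqP rk.
  by have := rank_leq_col M; rewrite rk leqNgt hn.
case/rowV0Pn => v /sub_kermxP vM v0; exists (fun i => v 0 (enum_rank i)); split.
  case/rV0Pn: v0 => j vj; exists (enum_val j); by rewrite enum_valK.
transitivity (rVpoly (v *m M)); last by rewrite vM raddf0.
transitivity (\sum_(j < #|I|) v 0 j *: V (enum_val j)).
  rewrite (reindex (fun j : 'I_#|I| => enum_val j)) /=; last first.
    by apply: onW_bij; apply: enum_val_bij.
  by apply: eq_bigr => i _; rewrite enum_valK.
rewrite mulmx_sum_row raddf_sum /=; apply: eq_bigr => i _; rewrite linearZ /= rowK.
by rewrite poly_rV_K.
Qed.

(* All ingredients of the auxiliary polynomial S are B-th powers up to powers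
   of f, and w^(B^2) = w, so at a point of the set S(w)^B is a polynomial
   expression of low degree, which linear algebra makes vanish identically. *)
Lemma stepanov_count (L : finFieldType) (d s B D J a b : nat) (s1 s2 u : L)
    (f g1 g2 : {poly L}) :
  (0 < d)%N -> B = (d * s).+1 -> (2 * d * D <= B)%N -> (size f <= D)%N ->
  (B * D + J + s * d * (size f).-1 < d * J * D)%N ->
  #|L| = (B ^ 2)%N -> [pchar L].-nat B ->
  f ^+ B = f \Po 'X^B ->
  f = ('X - s1%:P) ^+ a * g1 -> ~~ root g1 s1 ->
  f = ('X - s2%:P) ^+ b * g2 -> ~~ root g2 s2 -> coprime (gcdn a b) d ->
  u != 0 ->
  (#|[set w | f.[w] ^+ (s * B.+1) == u]| <= D + B * J + s * d * (size f).-1)%N.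
Proof.
move=> d0 Bd BD fD cnt cardL pB fB f1 r1 f2 r2 cop u0.
set m := (size f).-1 in cnt *.
have f0 : f != 0.
  have g10 : g1 != 0 by apply: contra r1 => /eqP ->; rewrite root0.
  by rewrite f1 mulf_neq0 // expf_neq0 // polyXsubC_eq0.
have sf e : (size (f ^+ e) <= (e * m).+1)%N.
  by rewrite (leq_trans (size_poly_exp_leq _ _)) // mulnC.
have D0 : (0 < D)%N by apply: leq_trans fD; rewrite size_poly_gt0.
have J0 : (0 < J)%N by case: (J) cnt => //; rewrite muln0 mul0n.
pose I : finType := ('I_d * 'I_J * 'I_D)%type.
(* [V (i, j, l)] is the low-degree polynomial which, at a point of the set, agrees with the B-th
   power of x^l x^(B j) f^(i s) times f^(s(d-1)). *)
pose V (t : I) : {poly L} :=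
  u ^+ t.1.1 *: ('X^(B * t.2 + t.1.2) * f ^+ (s * (d.-1 - t.1.1))).
have [c0 [[t0 ct0] cV]] : exists c : I -> L,
    (exists i, c i != 0) /\ \sum_i c i *: V i = 0.
  apply: (@poly_family_dep _ _ (B * D + J + s * d * m)).
    move=> [[i j] l]; rewrite /V /=; apply: leq_trans (size_scale_leq _ _) _.
    apply: leq_trans (size_polyMleq _ _) _; rewrite size_polyXn.
    rewrite addSn /=.
    have h1 : (size (f ^+ (s * (d.-1 - i))) <= (s * d * m).+1)%N.
      apply: leq_trans (sf _) _; rewrite ltnS leq_mul2r leq_mul2l.
      by rewrite (leq_trans (leq_subr _ _)) ?leq_pred ?orbT.
    apply: leq_trans (leq_add (leqnn _) h1) _.
    rewrite addnS -addSn leq_add2r -addnS; apply: leq_add; last exact: ltn_ord.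
    by rewrite leq_mul2l ltnW ?ltn_ord ?orbT.
  by rewrite !card_prod !card_ord.
(* The B-th power map is an involution on a field of B^2 elements, so [cn] is the B-th root of
   [c0]. *)
pose cn (i j l : nat) : L :=
  c0 (insubd (Ordinal d0) i, insubd (Ordinal J0) j, insubd (Ordinal D0) l) ^+ B.
have cnE (i : 'I_d) (j : 'I_J) (l : 'I_D) : cn i j l ^+ B = c0 (i, j, l).
  by rewrite /cn !valKd -exprM mulnn -cardL expf_card.
pose k (i : nat) : {poly {poly L}} := \poly_(j < J) \poly_(l < D) cn i j l.
pose S := \sum_(i < d) (k i).['X^B] * f ^+ (i * s).
have S0 : S != 0.
  apply/negP => /eqP SE.
  have kD i j : (size ((k i)`_j)%R <= D)%N.
    rewrite coef_poly; case: ifP => _; last by rewrite size_poly0.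
    exact: size_poly.
  have k0 := frobenius_independence d0 Bd BD fD fB f1 r1 f2 r2 cop kD SE.
  case: t0 ct0 => [[i j] l] /negP; apply; rewrite -cnE.
  have := k0 i (ltn_ord i).
  move/(congr1 (fun q : {poly {poly L}} => q`_j`_l)).
  rewrite !coef0 coef_poly ltn_ord coef_poly ltn_ord => ->.
  by rewrite expr0n Bd.
have sS : (size S <= D + B * J + s * d * m)%N.
  apply: leq_trans (size_sum _ _ _) _; apply/bigmax_leqP => i _.
  apply: leq_trans (size_polyMleq _ _) _.
  have h1 : (size (f ^+ (i * s)) <= (s * d * m).+1)%N.
    apply: leq_trans (sf _) _; rewrite ltnS leq_mul2r mulnC leq_mul2l.
    by rewrite (ltnW (ltn_ord i)) ?orbT.
  have h2 : (size (k i).['X^B] <= D + B * J)%N.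
    rewrite horner_poly; apply: leq_trans (size_sum _ _ _) _.
    apply/bigmax_leqP => j _; apply: leq_trans (size_polyMleq _ _) _.
    rewrite -exprM size_polyXn addnS /=; apply: leq_add; first exact: size_poly.
    by rewrite leq_mul2l ltnW ?ltn_ord ?orbT.
  have := leq_add h2 h1; rewrite addnS => h.
  by rewrite -subn1 leq_subLR add1n.
(* It remains to see that the points of the set are roots of [S]. The vanishing is proved for
   S(w)^B, yet only the degree of [S] enters the count: this is the gain of a factor B. *)
apply: leq_trans sS; apply: ltnW.
rewrite cardE; apply: max_poly_roots => //; last exact: enum_uniq.
apply/allP => w; rewrite mem_enum inE => /eqP fw; rewrite rootE.
have fw0 : f.[w] ^+ (s * d.-1) != 0.
  have s0 : (0 < s)%N.
    have dD : (0 < d * D)%N by rewrite muln_gt0 d0.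
    case: (posnP s) => // s0; move: BD; rewrite Bd s0 muln0 -mulnA.
    by rewrite leqNgt (leq_trans _ (leq_mul (leqnn 2) dD)).
  rewrite expf_neq0 //; apply: contra u0 => /eqP E.
  by rewrite -fw E expr0n muln_eq0 gtn_eqF.
have wQ : w ^+ (B * B) = w by rewrite mulnn -cardL expf_card.
have addB (x y : L) : (x + y) ^+ B = x ^+ B + y ^+ B by apply: exprDn_pchar.
have sumB (T : finType) (F : T -> L) : (\sum_t F t) ^+ B = \sum_t F t ^+ B.
  by apply: (big_morph (fun x : L => x ^+ B) addB); rewrite expr0n Bd.
(* The extra factor is nonzero at w and keeps exponents nonnegative: i s B + s(d-1) = i s(B+1) +
   s(d-1-i), where f(w)^(s(B+1)) = u. *)
suff : S.[w] ^+ B * f.[w] ^+ (s * d.-1) == 0.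
  by rewrite mulf_eq0 (negPf fw0) orbF expf_eq0 => /andP[].
apply/eqP; have := congr1 (horner^~ w) cV; rewrite horner0 => <-.
rewrite /S !horner_sum sumB mulr_suml.
transitivity (\sum_(i < d) \sum_(j < J) \sum_(l < D) (c0 (i, j, l) *: V (i, j, l)).[w]).
  apply: eq_bigr => i _; rewrite hornerM horner_poly horner_sum mulr_suml sumB.
  rewrite mulr_suml; apply: eq_bigr => j _.
  rewrite hornerM horner_poly mulr_suml mulr_suml sumB mulr_suml; apply: eq_bigr => l _.
  rewrite !(hornerZ, hornerM, hornerXn, horner_exp) /=.
  rewrite !exprMn cnE -!mulrA; congr (_ * _).
  rewrite -!exprM -fw -[in RHS]exprM.
  have -> : w ^+ (B * j * B) = w ^+ j by rewrite mulnAC exprM wQ.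
  rewrite exprD [(l * B)%N]mulnC.
  have -> : f.[w] ^+ (i * s * B) * f.[w] ^+ (s * d.-1) =
            f.[w] ^+ (s * B.+1 * i) * f.[w] ^+ (s * (d.-1 - i)).
    by rewrite -!exprD; congr (_ ^+ _); have := ltn_ord i; nia.
  ring.
by rewrite pair_big pair_big /=; apply: eq_bigr => [[[i j] l] _].
Qed.

(** With J = s + t and t = 4m + 10, the quantity d(D + B J + s d m) is at most B^2 + (1 + d t + d m)
    B, using d D <= B, d s < B and deg f = m. *)
Definition stepanov_const (d m : nat) : nat := 1 + d * (5 * m + 10).

Lemma stepanov_bound (L : finFieldType) (d s B a b : nat) (s1 s2 u : L)
    (f g1 g2 : {poly L}) (m := (size f).-1) :
  (0 < d)%N -> B = (d * s).+1 -> (4 * d * m.+1 + (4 * m + 10) <= B)%N ->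
  #|L| = (B ^ 2)%N -> [pchar L].-nat B ->
  f ^+ B = f \Po 'X^B ->
  f = ('X - s1%:P) ^+ a * g1 -> ~~ root g1 s1 ->
  f = ('X - s2%:P) ^+ b * g2 -> ~~ root g2 s2 -> coprime (gcdn a b) d ->
  u != 0 ->
  (d * #|[set w | f.[w] ^+ (s * B.+1) == u]| <= B ^ 2 + stepanov_const d m * B)%N.
Proof.
move=> d0 Bd BB cardL pB fB f1 r1 f2 r2 cop u0.
have f0 : f != 0.
  have g10 : g1 != 0 by apply: contra r1 => /eqP ->; rewrite root0.
  by rewrite f1 mulf_neq0 // expf_neq0 // polyXsubC_eq0.
have sm : size f = m.+1 by rewrite /m prednK // size_poly_gt0.
(* D is as large as independence allows. J exceeds s, which is about B/d, by a slack t: then d J D -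
   B D = (d t - 1) D must beat J + s d m <= (m + 2) B. Since B <= 4 d D, any t a little above 4(m +
   2) works. *)
pose t := (4 * m + 10)%N; pose D := (B %/ (2 * d))%N; pose J := (s + t)%N.
have hD : (2 * d * D <= B)%N by rewrite mulnC leq_divM.
have mD : (m < D)%N.
  rewrite /D leq_divRL ?muln_gt0 //.
  by rewrite mulnC -mulnA; lia.
have E0 : (d * J = d * s + d * t)%N by rewrite mulnDr.
have E1 : (B <= 4 * (d * D))%N by lia.
have E2 : (4 * ((m + 2) * B + 1) <= (4 * m + 9) * B)%N.
  have -> : ((4 * m + 9) * B = 4 * ((m + 2) * B) + B)%N by ring.
  by rewrite mulnDr leq_add2l; lia.
have E3 : ((4 * m + 9) * B <= (4 * m + 9) * (4 * (d * D)))%N.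
  by rewrite leq_mul2l E1 orbT.
have E4 : (J + s * d * m <= (m + 2) * B)%N.
  have : (s * d * m <= m * B)%N by rewrite mulnC leq_mul2l Bd mulnC leqnSn orbT.
  have : (s <= d * s)%N by rewrite leq_pmull.
  by rewrite /J; lia.
have E5 : ((m + 2) * B < (d * t - 1) * D)%N.
  have h : (d * (4 * m + 9) <= d * t - 1)%N.
    have -> : (d * t = d * (4 * m + 9) + d)%N by rewrite /t; ring.
    by rewrite -addnBA // leq_addr.
  apply: leq_trans (leq_mul h (leqnn D)).
  have := leq_trans E2 E3.
  have -> : ((4 * m + 9) * (4 * (d * D)) = 4 * (d * (4 * m + 9) * D))%N by ring.
  by rewrite leq_pmul2l // addn1.
have cnt : (B * D + J + s * d * m < d * J * D)%N.
  have -> : (d * J = B + (d * t - 1))%N.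
    have : (0 < d * t)%N by rewrite muln_gt0 d0 /t; lia.
    by rewrite E0; lia.
  by rewrite mulnDl -addnA ltn_add2l (leq_ltn_trans E4 E5).
have smD : (size f <= D)%N by rewrite sm.
have := @stepanov_count L d s B D J a b s1 s2 u f g1 g2 d0 Bd hD smD cnt cardL pB fB f1 r1 f2 r2 cop u0.
set Z := #|_|; rewrite -/m => hZ.
have h1 : (d * Z <= d * (D + B * J + s * d * m))%N by rewrite leq_mul2l hZ orbT.
apply: leq_trans h1 _; rewrite /stepanov_const.
have -> : ((1 + d * (5 * m + 10)) * B = B + d * t * B + d * m * B)%N by rewrite /t; ring.
by rewrite !mulnDr; lia.
Qed.

(** * Multiplicative characters and pure character sums *)

Record mulchar (C : numClosedFieldType) (F : finFieldType) (chi : F -> C) : Prop :=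
  MulChar { mulchar0 : chi 0 = 0; mulchar1 : chi 1 = 1;
            mulcharM : forall x y, chi (x * y) = chi x * chi y }.

Lemma mulcharX (C : numClosedFieldType) (F : finFieldType) (chi : F -> C) x n :
  mulchar chi -> chi (x ^+ n) = chi x ^+ n.
Proof.
move=> hc; elim: n => [|n IH]; first by rewrite !expr0 (mulchar1 hc).
by rewrite !exprS (mulcharM hc) IH.
Qed.

Lemma expf_card_pred (F : finFieldType) (x : F) : x != 0 -> x ^+ (#|F|.-1) = 1.
Proof.
move=> x0; apply: (mulfI x0); rewrite -exprS prednK ?mulr1 ?expf_card //.
by apply/card_gt0P; exists 0.
Qed.

Lemma card_pred_gt0 (F : finFieldType) : (0 < #|F|.-1)%N.
Proof. by rewrite -subn1 subn_gt0 finNzRing_gt1. Qed.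

Lemma card_predK (F : finFieldType) : (#|F|.-1.+1 = #|F|)%N.
Proof. by rewrite prednK // (ltnW (finNzRing_gt1 F)). Qed.

Lemma mulchar_norm (C : numClosedFieldType) (F : finFieldType) (chi : F -> C) x :
  mulchar chi -> x != 0 -> `|chi x| = 1.
Proof.
move=> hc x0; have q1 := card_pred_gt0 F.
have : `|chi x| ^+ (#|F|.-1) = 1.
  by rewrite -normrX -mulcharX // expf_card_pred // (mulchar1 hc) normr1.
by move/eqP; rewrite pexpr_eq1 ?normr_ge0 // => /eqP.
Qed.

(** The polynomial X (X^h - 1) has degree h + 1 < |F|, too few roots to cover the field. *)
Lemma mulchar_pow_trivial (F : finFieldType) h :
  (0 < h < #|F|.-1)%N -> exists2 v : F, v != 0 & v ^+ h != 1.
Proof.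
move=> /andP[h0 hq].
have /subsetPn [v _] : ~~ ([set: F] \subset [set v | (v == 0) || (v ^+ h == 1)]).
  apply/negP => /subset_leq_card; rewrite cardsT leqNgt => /negP; apply.
  pose P : {poly F} := 'X * ('X^h - 1).
  have mP : P \is monic by rewrite rpredM ?monicX ?monicXnsubC.
  have sP : size P = h.+2.
    by rewrite size_monicM ?monicX ?monic_neq0 ?monicXnsubC // size_polyX size_XnsubC.
  apply: (@leq_trans h.+2); last by rewrite -(card_predK F) ltnS.
  rewrite -sP cardE; apply: max_poly_roots; rewrite ?monic_neq0 ?enum_uniq //.
  apply/allP => v; rewrite mem_enum inE => hv.
  by rewrite /P rootM rootX /root !hornerE subr_eq0.
by rewrite inE negb_or => /andP[]; exists v.
Qed.

(** On nonzero elements N takes values in the d-th roots of unity of F, and each value has a fibre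
    of size at most M/d. Since [chi] sums to zero over these roots, M/d may be subtracted from every
    fibre; the deficits are nonnegative, and their total is small because the fibres miss only the
    roots of f. *)
Lemma stepanov_charsum (C : numClosedFieldType) (F L : finFieldType)
    (iota : {rmorphism F -> L}) (chi : F -> C) (N : L -> F)
    (d h s B a b : nat) (s1 s2 : L)
    (f g1 g2 : {poly L}) (m := (size f).-1) :
  mulchar chi -> (forall x, chi x = 1 -> x = 1) ->
  (1 < d)%N -> (#|F|.-1 = d * h)%N ->
  B = (d * s).+1 -> (4 * d * m.+1 + (4 * m + 10) <= B)%N ->
  #|L| = (B ^ 2)%N -> [pchar L].-nat B ->
  f ^+ B = f \Po 'X^B ->
  f = ('X - s1%:P) ^+ a * g1 -> ~~ root g1 s1 ->
  f = ('X - s2%:P) ^+ b * g2 -> ~~ root g2 s2 -> coprime (gcdn a b) d ->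
  (forall y, iota (N y) = y ^+ (s * B.+1)) ->
  `|\sum_w chi (N f.[w])| <= (stepanov_const d m * B + m)%:R.
Proof.
move=> hc cinj d1 qdh Bd BB cardL pB fB f1 r1 f2 r2 cop hN.
have d0 : (0 < d)%N by apply: ltnW.
have f0 : f != 0.
  have g10 : g1 != 0 by apply: contra r1 => /eqP ->; rewrite root0.
  by rewrite f1 mulf_neq0 // expf_neq0 // polyXsubC_eq0.
have B1 : (10 <= B)%N by lia.
have s0 : (0 < s)%N by case: (s) Bd B1 => // ->; rewrite muln0.
pose U := [set v : F | v ^+ d == 1].
have U0 v : v \in U -> v != 0.
  rewrite inE => /eqP vd; apply/negP => /eqP v0; move/eqP: vd.
  by rewrite v0 expr0n gtn_eqF // eq_sym oner_eq0.
have cU : (#|U| <= d)%N.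
  rewrite cardE -ltnS -[d.+1](size_XnsubC (1 : F) d0).
  apply: max_poly_roots; rewrite ?enum_uniq ?monic_neq0 ?monicXnsubC //.
  by apply/allP => v; rewrite mem_enum inE /root !hornerE subr_eq0.
have NU y : y != 0 -> N y \in U.
  move=> y0; rewrite inE -(inj_eq (fmorph_inj iota)) rmorphXn rmorph1 /= hN -exprM.
  have -> : (s * B.+1 * d = #|L|.-1)%N by rewrite cardL Bd; nia.
  by rewrite expf_card_pred.
have N0 : N 0 = 0.
  by apply: (fmorph_inj iota); rewrite hN rmorph0 expr0n muln_eq0 gtn_eqF.
pose n (v : F) := #|[set w | N f.[w] == v]|.
have nE v : n v = #|[set w | f.[w] ^+ (s * B.+1) == iota v]|.
  by apply: eq_card => w; rewrite !inE -hN (inj_eq (fmorph_inj iota)).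
pose M := (B ^ 2 + stepanov_const d m * B)%N.
have nM v : v \in U -> (d * n v <= M)%N.
  move=> vU; rewrite nE; apply: stepanov_bound f1 r1 f2 r2 cop _ => //.
  by rewrite fmorph_eq0 U0.
have sn : (B ^ 2 <= \sum_(v in U) n v + m)%N.
  rewrite -cardL.
  have <- : #|[set w : L | N f.[w] \in U]| = (\sum_(v in U) n v)%N.
    rewrite -sum1_card (partition_big (fun w => N f.[w]) (mem U)) /=; last first.
      by move=> w; rewrite inE.
    apply: eq_bigr => v vU; rewrite /n -sum1_card; apply: eq_bigl => w.
    by move: vU; rewrite !inE; case: (N f.[w] =P v) => [->|_]; rewrite ?andbF // andbT => ->.
  have hz : (#|[set w : L | root f w]| <= m)%N.
    rewrite -ltnS /m prednK ?size_poly_gt0 // cardE.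
    apply: max_poly_roots; rewrite ?enum_uniq //.
    by apply/allP => w; rewrite mem_enum inE.
  rewrite -cardsT; apply: (@leq_trans (#|[set w : L | N f.[w] \in U]| + #|[set w : L | root f w]|)%N); last by rewrite leq_add2l.
  apply: leq_trans (leq_card_setU _ _); apply: subset_leq_card.
  apply/subsetP => w _; rewrite in_setU !inE orbC.
  by rewrite /root; case: eqP => //= /eqP fw; have := NU _ fw; rewrite inE.
have sumE : \sum_w chi (N f.[w]) = \sum_(v in U) chi v * (n v)%:R.
  rewrite (bigID (fun w => N f.[w] \in U)) /= addrC big1 ?add0r; last first.
    move=> w hw; case: (eqVneq f.[w] 0) => [->|/NU fw]; last by rewrite fw in hw.
    by rewrite N0 (mulchar0 hc).
  rewrite (partition_big (fun w => N f.[w]) (mem U)) //=.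
  apply: eq_bigr => v vU; rewrite /n.
  rewrite -sum1_card natr_sum mulr_sumr.
  apply: eq_big => [w|w /andP[_ /eqP ->]]; last by rewrite mulr1.
  by move: vU; rewrite !inE; case: (N f.[w] =P v) => [->|_]; rewrite ?andbF // andbT => ->.
have sU : \sum_(v in U) chi v = 0.
  (* v^h is a d-th root of unity other than 1, and faithfulness of [chi] makes its value there
     differ from 1. *)
  have [v v0 vh] : exists2 v : F, v != 0 & v ^+ h != 1.
    apply: mulchar_pow_trivial; have := card_pred_gt0 F; rewrite qdh.
    by rewrite muln_gt0 d0 /= => h0; rewrite h0 -[X in (X < _)%N]mul1n ltn_pmul2r.
  pose v1 := v ^+ h.
  have v1d : v1 ^+ d = 1 by rewrite -exprM mulnC -qdh expf_card_pred.
  have v10 : v1 != 0 by rewrite expf_neq0.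
  have : chi v1 * (\sum_(v in U) chi v) = \sum_(v in U) chi v.
    rewrite mulr_sumr [RHS](reindex_inj (mulfI v10)) /=.
    apply: eq_big => [x|x _]; last by rewrite (mulcharM hc).
    by rewrite !inE exprMn v1d mul1r.
  move/eqP; rewrite -subr_eq0 -{2}[\sum_(_ in _) _]mul1r -mulrBl mulf_eq0 subr_eq0.
  by case/orP => [/eqP /cinj /eqP|/eqP //]; rewrite (negPf vh).
have E : d%:R * (\sum_w chi (N f.[w])) = - \sum_(v in U) chi v * (M - d * n v)%:R.
  transitivity (\sum_(v in U) (chi v * (d * n v)%:R) - M%:R * \sum_(v in U) chi v).
    rewrite sU mulr0 subr0 sumE mulr_sumr; apply: eq_bigr => v _.
    by rewrite natrM mulrCA.
  rewrite mulr_sumr -sumrB -sumrN; apply: eq_bigr => v vU.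
  by rewrite natrB ?nM //; ring.
have d0' : 0 < (d%:R : C) by rewrite ltr0n.
rewrite -(ler_pM2l d0') -{1}[d%:R]normr_nat -normrM E normrN.
apply: le_trans (ler_norm_sum _ _ _) _.
apply: (@le_trans _ _ (\sum_(v in U) (M - d * n v)%:R)).
  by apply: ler_sum => v vU; rewrite normrM mulchar_norm ?U0 // mul1r normr_nat.
rewrite -natr_sum -natrM ler_nat.
have e1 : (\sum_(v in U) (M - d * n v) + d * \sum_(v in U) n v = #|U| * M)%N.
  rewrite big_distrr -big_split /= -sum_nat_const; apply: eq_bigr => v vU.
  by rewrite subnK ?nM.
have e2 : (#|U| * M <= d * M)%N by rewrite leq_mul2r cU orbT.
have e3 : (d * B ^ 2 <= d * (\sum_(v in U) n v + m))%N by rewrite leq_mul2l sn orbT.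
move: e1 e2 e3; rewrite /M; set S1 := (\sum_(v in U) _)%N; set S2 := (\sum_(v in U) _)%N.
rewrite !mulnDr; lia.
Qed.

(** * Monic polynomials over a finite field and Newton's identities *)

Section Monics.
Variable F : finFieldType.
Implicit Types g h P : {poly F}.

Definition monics m : seq {poly F} := [seq 'X^m + rVpoly c | c <- enum 'rV[F]_m].

Lemma mem_monics m g : (g \in monics m) = (g \is monic) && (size g == m.+1).
Proof.
apply/mapP/andP => [[c _ ->]|[/monicP mg /eqP sg]].
  have sc : (size (rVpoly c) < size ('X^m : {poly F}))%N.
    by rewrite size_polyXn ltnS size_poly.
  by rewrite monicE lead_coefDl // lead_coefXn size_polyDl // size_polyXn !eqxx.
exists (poly_rV (g - 'X^m)); rewrite ?mem_enum // poly_rV_K.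
  by rewrite addrC subrK.
apply/leq_sizeP => j mj; rewrite coefB coefXn.
have [->|jm] := eqVneq j m; last first.
  by rewrite nth_default ?sg ?subr0 // ltn_neqAle eq_sym jm.
by rewrite -[m]/(m.+1.-1) -sg -/(lead_coef g) mg subrr.
Qed.

Lemma monics_uniq m : uniq (monics m).
Proof.
rewrite map_inj_uniq ?enum_uniq // => c d /addrI /(congr1 (@poly_rV _ m)).
by rewrite !rVpolyK.
Qed.

Lemma monicsM m k g h : g \in monics m -> h \in monics k -> g * h \in monics (m + k).
Proof.
rewrite !mem_monics => /andP[mg /eqP sg] /andP[mh /eqP sh].
by rewrite rpredM //= size_monicM ?monic_neq0 // sg sh addSn addnS.
Qed.

Lemma monics1 : 1 \in monics 0.
Proof. by rewrite mem_monics monic1 size_poly1. Qed.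

Lemma monicsX e P r : P \in monics e -> P ^+ r \in monics (r * e).
Proof.
move=> hP; elim: r => [|r IH]; first by rewrite expr0 mul0n monics1.
by rewrite exprS mulSn monicsM.
Qed.

Lemma sum_monics_dvd (C : nmodType) (Phi : {poly F} -> C) m k h :
  h \in monics k -> (k <= m)%N ->
  \sum_(g <- monics m | h %| g) Phi g = \sum_(g <- monics (m - k)) Phi (h * g).
Proof.
move=> hk km; have [mh sh] : h \is monic /\ size h = k.+1.
  by move: hk; rewrite mem_monics => /andP[? /eqP].
rewrite -big_filter -(big_map (fun g => h * g) xpredT Phi).
apply: perm_big; apply: uniq_perm.
- by rewrite filter_uniq ?monics_uniq.
- by rewrite map_inj_uniq ?monics_uniq //; apply: mulfI; rewrite monic_neq0.
move=> g; rewrite mem_filter; apply/andP/mapP => [[/dvdpP [q ->]]|[q hq ->]].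
  rewrite mem_monics monicMr // => /andP[mq].
  rewrite size_monicM ?monic_neq0 // sh addnS /= => /eqP sq.
  exists q; last by rewrite mulrC.
  by rewrite mem_monics mq /=; lia.
by split; [apply: dvdp_mulr|rewrite -(subnKC km) monicsM].
Qed.

Lemma monics_dvd_gt m k g h :
  g \in monics m -> h \in monics k -> (m < k)%N -> (h %| g) = false.
Proof.
rewrite !mem_monics => /andP[mg /eqP sg] /andP[mh /eqP sh] mk.
apply/negP => /dvdp_leq; rewrite monic_neq0 // sg sh => /(_ isT); lia.
Qed.

Definition irr_monics e : seq {poly F} := [seq P <- monics e | irreducibleb P].

Lemma irr_monicsP e P :
  reflect [/\ P \in monics e & irreducible_poly P] (P \in irr_monics e).
Proof.
rewrite mem_filter andbC; apply: (iffP andP) => [] [hP].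
  by move/irreducibleP.
by move=> /irreducibleP.
Qed.

Lemma irr_monics_deg e P : P \in irr_monics e -> (0 < e)%N.
Proof.
case/irr_monicsP; rewrite mem_monics => /andP[_ /eqP sP] [].
by rewrite sP; lia.
Qed.

Lemma irr_monics_coprime e e' P P' :
  P \in irr_monics e -> P' \in irr_monics e' -> P != P' -> coprimep P P'.
Proof.
move=> /irr_monicsP[mP iP] /irr_monicsP[mP' iP'] neq.
rewrite irreducible_poly_coprime //; apply/negP => dv.
have /iP' : size P != 1 by case: iP => h _; rewrite neq_ltn h orbT.
move=> /(_ dv); rewrite eqp_monic ?(negPf neq) //.
  by move: mP; rewrite mem_monics => /andP[].
by move: mP'; rewrite mem_monics => /andP[].
Qed.

Lemma irr_monics_factor m g : (0 < m)%N -> g \in monics m ->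
  exists e P h, [/\ P \in irr_monics e, (e <= m)%N, h \in monics (m - e) & g = P * h].
Proof.
elim/ltn_ind: m g => m IH g m0 gm.
have [ig|/irreducibleP nig] := boolP (irreducibleb g).
  exists m, g, 1; rewrite subnn monics1 mulr1; split=> //.
  by apply/irr_monicsP; split=> //; apply/irreducibleP.
have [mg sg] : g \is monic /\ size g = m.+1.
  by move: gm; rewrite mem_monics => /andP[? /eqP].
have [k [h [k0 km hk hdv]]] : exists k h, [/\ (0 < k)%N, (k < m)%N, h \in monics k & h %| g].
  have [/hasP [k kin /hasP [h hk hdv]]|/hasPn nh] :=
      boolP (has (fun k => has (fun h => h %| g) (monics k)) (iota 1 m.-1)).
    by exists k, h; move: kin; rewrite mem_iota => ?; split=> //; lia.
  case: nig; split; first by rewrite sg; lia.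
  move=> q sq qg; have q0 : q != 0.
    by apply/negP => /eqP q0; move: qg; rewrite q0 dvd0p -size_poly_eq0 sg.
  have lq : lead_coef q != 0 by rewrite lead_coef_eq0.
  pose q' := (lead_coef q)^-1 *: q.
  have mq' : q' \is monic by rewrite monicE lead_coefZ mulVf.
  have sq' : size q' = size q by rewrite size_scale ?invr_eq0.
  have q'q : q' %= q by rewrite eqp_scale ?invr_eq0.
  have q'g : q' %| g by rewrite (eqp_dvdl _ q'q).
  have le : (size q <= m.+1)%N by rewrite -sg dvdp_leq ?monic_neq0.
  have [sm|sm] := eqVneq (size q) m.+1.
    by rewrite -dvdp_size_eqp // sm sg.
  have sq0 : (0 < size q)%N by rewrite size_poly_gt0.
  have /hasPn/(_ q') : ~~ has (fun h => h %| g) (monics (size q).-1).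
    by apply: nh; rewrite mem_iota; lia.
  by rewrite mem_monics mq' sq' prednK // eqxx q'g => /(_ isT).
have [e [P [h' [iP ek hh' hE]]]] := IH k km h k0 hk.
have Pg : P %| g by apply: dvdp_trans hdv; rewrite hE dvdp_mulr.
have /dvdpP [q gE] := Pg.
have [mP sP] : P \is monic /\ size P = e.+1.
  by case/irr_monicsP: iP; rewrite mem_monics => /andP[? /eqP].
have em : (e <= m)%N by lia.
exists e, P, q; split=> //; last by rewrite mulrC.
move: gm; rewrite gE !mem_monics monicMr // => /andP[mq].
by rewrite mq size_monicM ?monic_neq0 // sP addnS /=; lia.
Qed.

End Monics.

(** This is deg g = sum over P of deg P times v_P(g), the valuation being the number of r >= 1 with
    P^r | g; the cutoff M loses nothing since m <= M. Removing one irreducible factor P0 lowers v_P0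
    by one and leaves the other valuations alone. *)
Lemma irr_monics_sum_deg (F : finFieldType) M m (g : {poly F}) :
  g \in monics F m -> (m <= M)%N ->
  (\sum_(1 <= e < M.+1) \sum_(P <- irr_monics F e)
     e * \sum_(1 <= r < M.+1) (P ^+ r %| g)%R = m)%N.
Proof.
elim/ltn_ind: m g => m IH g gm mM.
have vgt e P k h r : P \in irr_monics F e -> h \in monics F k -> (k < r)%N ->
    (P ^+ r %| h)%R = false.
  move=> iP hk kr; have e0 := irr_monics_deg iP.
  have /irr_monicsP[mP _] := iP.
  apply: monics_dvd_gt hk (monicsX r mP) _.
  by apply: leq_trans kr _; rewrite leq_pmulr.
have [m0|m0] := posnP m.
  rewrite m0 big_nat big1 // => e _; rewrite big_seq big1 // => P iP.
  rewrite big_nat big1 ?muln0 // => r /andP[r0 _].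
  by rewrite (vgt _ _ _ _ _ iP gm) // m0.
have [e0 [P0 [h [iP0 em hm gE]]]] := irr_monics_factor m0 gm.
have e00 := irr_monics_deg iP0.
have P00 : P0 != 0 by case/irr_monicsP: iP0 => _ /irredp_neq0.
have v_step e P : P \in irr_monics F e ->
   (\sum_(1 <= r < M.+1) (P ^+ r %| g)%R =
    \sum_(1 <= r < M.+1) (P ^+ r %| h)%R + (P == P0))%N.
  move=> iP; rewrite gE; have [->|neq] := eqVneq P P0; last first.
    rewrite addn0; apply: eq_bigr => r _; rewrite Gauss_dvdpr //.
    by rewrite coprimep_expl // (irr_monics_coprime iP iP0).
  have -> : (\sum_(1 <= r < M.+1) (P0 ^+ r %| P0 * h)%R =
             \sum_(0 <= r < M) (P0 ^+ r %| h)%R)%N.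
    rewrite big_add1 /=; apply: eq_bigr => r _.
    by rewrite exprS dvdp_mul2l.
  have M0 : (0 < M)%N by lia.
  (* After the shift r runs over 0, ..., M - 1: the term r = 0 is the extra 1, and the missing term
     r = M is zero because deg h < M. *)
  rewrite -(prednK M0) big_nat_recl // big_nat_recr //= prednK // big_add1 /=.
  rewrite expr0 dvd1p addnC (vgt _ _ _ _ _ iP0 hm); last by lia.
  by rewrite addn0.
transitivity (\sum_(1 <= e < M.+1) (\sum_(P <- irr_monics F e)
     e * \sum_(1 <= r < M.+1) (P ^+ r %| h)%R + e * (e == e0)))%N.
  apply: eq_bigr => e _; rewrite -big_distrr /=.
  rewrite -[in RHS]big_distrr /= -mulnDr; congr (_ * _)%N.
  rewrite (eq_big_seq (fun P => \sum_(1 <= r < M.+1) (P ^+ r %| h)%R + (P == P0))%N);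
    last by move=> P; apply: v_step.
  rewrite big_split /=; congr (_ + _)%N.
  have [->|ne] := eqVneq e e0.
    rewrite (bigD1_seq P0) ?filter_uniq ?monics_uniq //= eqxx big1 // => P.
    by move/negPf => ->.
  rewrite big_seq big1 // => P iP; case: eqP => // PP.
  case/eqP: ne; move: iP iP0; rewrite PP => /irr_monicsP[+ _] /irr_monicsP[+ _].
  by rewrite !mem_monics => /andP[_ /eqP ->] /andP[_ /eqP []].
rewrite big_split /= (IH (m - e0)%N _ h) //; [|lia|lia].
have hin : e0 \in index_iota 1 M.+1 by rewrite mem_index_iota; lia.
rewrite (bigD1_seq e0 hin (iota_uniq _ _)) /=.
rewrite eqxx muln1 big1 ?addn0 ?subnK // => e /negPf ->.
by rewrite muln0.
Qed.

Section Newton.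
Variables (F : finFieldType) (C : comNzRingType) (Lam : {poly F} -> C).
Hypothesis Lam1 : Lam 1 = 1.
Hypothesis LamM : forall g h, g \is monic -> h \is monic ->
  Lam (g * h) = Lam g * Lam h.

Definition Lsum m : C := \sum_(g <- monics F m) Lam g.

(** For k <= M this is the coefficient of T^k in T d/dT log of the Euler product over P of (1 -
    Lam(P) T^(deg P))^(-1); M only makes the sums finite. *)
Definition psum M k : C := \sum_(1 <= e < M.+1) \sum_(P <- irr_monics F e)
  \sum_(1 <= r < M.+1 | (r * e == k)%N) e%:R * Lam P ^+ r.

Lemma LamX g r : g \is monic -> Lam (g ^+ r) = Lam g ^+ r.
Proof.
move=> mg; elim: r => [|r IH]; first by rewrite !expr0.
by rewrite !exprS LamM ?IH // rpredX.
Qed.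

Lemma monics_monic m g : g \in monics F m -> g \is monic.
Proof. by rewrite mem_monics => /andP[]. Qed.

(* The logarithmic derivative of the Euler product of sum_m (Lsum m) T^m,
   read off coefficientwise. *)
Lemma newton_Lsum M m : (m <= M)%N ->
  m%:R * Lsum m = \sum_(1 <= k < m.+1) psum M k * Lsum (m - k).
Proof.
move=> mM; rewrite /Lsum mulr_sumr.
(* The factor m is deg g, expanded over the prime powers P^r dividing g. Once the sum over g is
   innermost, writing g = P^r h splits off Lam(P)^r. *)
rewrite (eq_big_seq (fun g => \sum_(1 <= e < M.+1) \sum_(P <- irr_monics F e)
  \sum_(1 <= r < M.+1) (e%:R * (P ^+ r %| g)%R%:R * Lam g))); last first.
  move=> g gm; rewrite -{1}(irr_monics_sum_deg gm mM) natr_sum mulr_suml.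
  apply: eq_bigr => e _; rewrite natr_sum mulr_suml; apply: eq_bigr => P _.
  by rewrite natrM natr_sum mulr_sumr mulr_suml.
rewrite exchange_big /=; under [RHS]eq_bigr do rewrite /psum mulr_suml.
rewrite [RHS]exchange_big /=; apply: eq_big_nat => e /andP[e0 eM].
rewrite exchange_big /=; under [RHS]eq_bigr do rewrite mulr_suml.
rewrite [RHS]exchange_big /=; apply: eq_big_seq => P iP.
rewrite exchange_big /=; under [RHS]eq_bigr do rewrite mulr_suml big_mkcond /=.
rewrite [RHS]exchange_big /=; apply: eq_big_nat => r /andP[r0 rM].
have /irr_monicsP[mP _] := iP; have mPr := monicsX r mP.
transitivity (\sum_(g <- monics F m | P ^+ r %| g) e%:R * Lam g).
  rewrite [RHS]big_mkcond /=; apply: eq_bigr => g _.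
  by case: (_ %| _); rewrite ?mulr1 // mulr0 mul0r.
rewrite -mulr_sumr.
have [rem|rem] := leqP (r * e)%N m; last first.
  rewrite big_seq_cond big1 ?mulr0; last first.
    by move=> g /andP[gm]; rewrite (monics_dvd_gt gm mPr).
  by rewrite big_nat big1 // => k /andP[k0 km]; case: eqP => // rek; lia.
rewrite (sum_monics_dvd _ mPr) //.
have hin : (r * e)%N \in index_iota 1 m.+1.
  by rewrite mem_index_iota muln_gt0 r0 e0 ltnS.
rewrite (bigD1_seq _ hin (iota_uniq _ _)) /= eqxx.
rewrite [X in _ = _ + X]big1 ?addr0; last first.
  by move=> k; rewrite eq_sym => /negPf ->.
rewrite -mulrA; congr (_ * _); rewrite mulr_sumr; apply: eq_big_seq => g hg.
by rewrite LamM ?LamX ?(monics_monic hg) ?(monics_monic mPr) ?(monics_monic mP).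
Qed.

End Newton.

(** * Extensions of finite fields *)

Lemma card_finField_pnat (F : finFieldType) : [pchar F].-nat #|F|.
Proof.
have [p pp pF] := finPcharP F.
have -> : #|F| = #|pPrimeCharType pF| by [].
by rewrite card_pprimeChar pnatX (eq_pnat _ (pcharf_eq pF)) pnat_id.
Qed.

Lemma expf_card_iter (F : finFieldType) (L : nzRingType) (z : L) e j :
  z ^+ (#|F| ^ e) = z -> z ^+ (#|F| ^ (e * j)) = z.
Proof.
move=> ze; elim: j => [|j IH]; first by rewrite muln0 expn0 expr1.
by rewrite mulnS expnD exprM ze.
Qed.

(** In a splitting field of X^Q - X with Q = |F|^k the roots are distinct, since the derivative is
    -1, and they form a subfield containing F; as they generate the splitting field, they are all of
    it. *)
Lemma finField_ext (F : finFieldType) k : (0 < k)%N ->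
  exists (L : finFieldType) (iota : {rmorphism F -> L}), #|L| = (#|F| ^ k)%N.
Proof.
move=> k0; set Q := (#|F| ^ k)%N.
have q1 := finNzRing_gt1 F.
have Q1 : (1 < Q)%N by rewrite -(exp1n k) ltn_exp2r.
have sQ (R : nzRingType) : size ('X^Q - 'X : {poly R}) = Q.+1.
  by rewrite size_polyDl size_polyXn // size_polyN size_polyX.
have p0 : ('X^Q - 'X : {poly F}) != 0 by rewrite -size_poly_eq0 sQ.
have [/= L0] := FinSplittingFieldFor p0.
rewrite rmorphB rmorphXn /= map_polyX => -[zs Dz defL].
pose L : finFieldType := FinFieldExtType L0.
exists L, (in_alg L0 : {rmorphism F -> L0}).
have QL : (Q%:R : L0) = 0.
  have [p pp pF] := finPcharP F.
  have := card_finField_pnat F; rewrite (eq_pnat _ (pcharf_eq pF)) => /p_natP [j hj].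
  have pL : p \in [pchar L0] by rewrite pchar_lalg.
  rewrite /Q hj -expnM natrX pcharf0 // expr0n.
  suff : (j * k != 0)%N by move=> /negPf ->.
  by rewrite muln_eq0 negb_or -!lt0n k0 andbT; case: (j) hj q1 => // ->.
have Uz : uniq zs.
  rewrite -separable_prod_XsubC -(eqp_separable Dz) unlock.
  rewrite derivB derivXn derivX -mulr_natr -polyC_natr QL polyC0 mulr0 sub0r.
  by rewrite -[X in coprimep _ X]scaleN1r coprimepZr ?oppr_eq0 ?oner_eq0 // coprimep1.
have zQ x : (x \in zs) = (x ^+ Q == x).
  by rewrite -root_prod_XsubC -(eqp_root Dz) /root !hornerE subr_eq0.
have all_zs (x : L0) : x \in zs.
  (* [a] is the |F|-power Frobenius, so the fixed field of its k-th power is exactly the set of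
     roots. *)
  have /finField_galois_generator [/= a _ Da] : (1 <= {:L0})%VS by apply: sub1v.
  have aE i (y : L0) : (a ^+ i)%g y = y ^+ (#|F| ^ i).
    elim: i => [|i IH]; first by rewrite gal_id.
    by rewrite expgSr galM ?memvf // IH Da ?memvf // dimv1 expn1 expnSr exprM.
  pose E := fixedSpace (a ^+ k)%g.
  have inE z : (z \in E) = (z \in zs).
    by rewrite zQ -aE; apply/fixedSpaceP/eqP.
  rewrite -inE; suff -> : (E = {:L0})%VS by rewrite memvf.
  apply/eqP; rewrite eqEsubv subvf -defL -[E]subfield_closed agenvS //.
  by rewrite subv_add sub1v; apply/span_subvP => z; rewrite inE.
apply: succn_inj; rewrite -/Q -(sQ L0) (eqp_size Dz) size_prod_XsubC; congr _.+1.
have Uz1 : @uniq L zs := Uz.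
rewrite -(card_uniqP Uz1); apply: eq_card => x; apply/esym; exact: (all_zs x).
Qed.

(** The proof is an argument so that the function can carry a canonical ring morphism structure for
    every admissible q. *)
Definition frobq (R : comNzRingType) q of [pchar R].-nat q := fun x : R => x ^+ q.

Section FrobeniusPower.
Variables (R : comNzRingType) (q : nat) (hq : [pchar R].-nat q).

Lemma pnat_char_gt0 : (0 < q)%N.
Proof. by case/andP: hq. Qed.

Lemma frobq_zmod : zmod_morphism (frobq hq).
Proof.
move=> x y; rewrite /frobq exprDn_pchar //; congr (_ + _).
apply/eqP; rewrite -addr_eq0 -exprDn_pchar // addNr expr0n.
by rewrite gtn_eqF ?pnat_char_gt0.
Qed.

Lemma frobq_monoid : monoid_morphism (frobq hq).
Proof. by split=> [|x y]; rewrite /frobq ?expr1n ?exprMn. Qed.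

HB.instance Definition _ := GRing.isZmodMorphism.Build R R (frobq hq) frobq_zmod.
HB.instance Definition _ := GRing.isMonoidMorphism.Build R R (frobq hq) frobq_monoid.

Lemma exp_poly_frobq (p : {poly R}) : p ^+ q = map_poly (frobq hq) p \Po 'X^q.
Proof.
have hqp : [pchar {poly R}].-nat q by rewrite (eq_pnat _ (pchar_poly R)).
elim/poly_ind: p => [|p c IH].
  by rewrite expr0n gtn_eqF ?pnat_char_gt0 // map_poly0 comp_poly0.
rewrite exprDn_pchar // exprMn IH rmorphD rmorphM /= map_polyX map_polyC.
by rewrite comp_polyD comp_polyM comp_polyX comp_polyC -polyC_exp.
Qed.

End FrobeniusPower.

Section Extension.
Variables (F L : finFieldType) (iota : {rmorphism F -> L}) (k : nat).
Hypotheses (k0 : (0 < k)%N) (cardL : #|L| = (#|F| ^ k)%N).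
Local Notation q := #|F|.

Lemma ext_pnat j : [pchar L].-nat (q ^ j)%N.
Proof.
have -> : [pchar L].-nat (q ^ j)%N = [pchar F].-nat (q ^ j)%N.
  apply: eq_pnat => p; rewrite !inE; case: prime => //=.
  by rewrite -(rmorph_nat iota) fmorph_eq0.
by rewrite pnatX card_finField_pnat.
Qed.

Lemma iota_expq j x : iota x ^+ (q ^ j)%N = iota x.
Proof. by rewrite -rmorphXn /= -[j]mul1n (@expf_card_iter F) // expn1 expf_card. Qed.

(** The q elements of the image already exhaust the possible roots of X^q - X. *)
Lemma iota_image (y : L) : y ^+ q = y -> exists x, iota x = y.
Proof.
move=> hy; have [/codomP [x ->]|ny] := boolP (y \in codom iota); first by exists x.
have q1 := finNzRing_gt1 F.
have sP : size ('X^q - 'X : {poly L}) = q.+1.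
  by rewrite size_polyDl size_polyXn // size_polyN size_polyX.
have : (size (y :: codom iota) < size ('X^q - 'X : {poly L})%R)%N.
  apply: max_poly_roots; first by rewrite -size_poly_eq0 sP.
    apply/allP => z; rewrite inE => /orP[/eqP ->|/codomP [x ->]].
      by rewrite /root !hornerE hy subrr.
    by rewrite /root !hornerE -[q]expn1 iota_expq subrr.
  by rewrite cons_uniq ny (map_inj_uniq (fmorph_inj iota)) enum_uniq.
by rewrite sP /= size_codom ltnn.
Qed.

Lemma map_iota_exp j (p : {poly F}) :
  map_poly iota p ^+ (q ^ j)%N = map_poly iota p \Po 'X^(q ^ j).
Proof.
rewrite (exp_poly_frobq (ext_pnat j)); congr (_ \Po _).
by rewrite -map_poly_comp; apply: eq_map_poly => x; apply: iota_expq.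
Qed.

Lemma root_iota_expq j (p : {poly F}) x :
  root (map_poly iota p) x -> root (map_poly iota p) (x ^+ (q ^ j)%N).
Proof.
move=> /eqP hx; have := congr1 (horner^~ x) (map_iota_exp j p).
rewrite horner_exp hx horner_comp hornerXn expr0n gtn_eqF ?expn_gt0; last first.
  by rewrite ltnW ?finNzRing_gt1.
by move=> e; rewrite /root -e.
Qed.



(** The characteristic polynomial of x over F, not the minimal one: conjugates are repeated when x
    lies in a proper subfield. *)
Definition conj_poly (x : L) : {poly L} := \prod_(i < k) ('X - (x ^+ (q ^ i)%N)%:P).

Lemma conj_poly_frob x : map_poly (frobq (ext_pnat 1)) (conj_poly x) = conj_poly x.
Proof.
transitivity (\prod_(i < k) ('X - (x ^+ (q ^ i.+1)%N)%:P)).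
  rewrite map_prod_XsubC; apply: eq_bigr => i _.
  by rewrite /= /frobq -exprM expn1 -expnSr.
rewrite /conj_poly; case: k k0 cardL => // k' _ cL.
rewrite big_ord_recr big_ord_recl mulrC /= -cL expf_card expn0 expr1.
by congr (_ * _); apply: eq_bigr => i _.
Qed.

Definition iota_inv (y : L) : F := odflt 0 [pick z | iota z == y].

Lemma iota_invK (y : L) : y ^+ q = y -> iota (iota_inv y) = y.
Proof.
move=> /iota_image [x hx]; rewrite /iota_inv; case: pickP => [z /eqP //|].
by move/(_ x); rewrite hx eqxx.
Qed.

Lemma iotaK : cancel iota iota_inv.
Proof.
move=> x; rewrite /iota_inv; case: pickP => [z /eqP /fmorph_inj //|].
by move/(_ x); rewrite eqxx.
Qed.

Definition char_pol (x : L) : {poly F} := map_poly iota_inv (conj_poly x).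

Lemma map_char_pol x : map_poly iota (char_pol x) = conj_poly x.
Proof.
apply/polyP => i; rewrite coef_map coef_map_id0; last first.
  by rewrite -(rmorph0 iota) iotaK.
apply: iota_invK; have := congr1 (fun p : {poly L} => p`_i) (conj_poly_frob x).
by rewrite coef_map /= /frobq expn1.
Qed.

Lemma char_pol_monics x : char_pol x \in monics F k.
Proof.
rewrite mem_monics -(map_monic iota) map_char_pol monic_prod_XsubC /=.
by rewrite -(size_map_poly iota) map_char_pol size_prod_XsubC /index_enum -enumT size_enum_ord.
Qed.

Lemma root_char_pol x : root (map_poly iota (char_pol x)) x.
Proof.
rewrite map_char_pol /conj_poly; case: k k0 => // k' _.
by rewrite big_ord_recl rootM expn0 expr1 root_XsubC eqxx.
Qed.

Lemma irr_root_ex m g x : g \in monics F m -> root (map_poly iota g) x ->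
  exists e P, [/\ (0 < e <= m)%N, P \in irr_monics F e & root (map_poly iota P) x].
Proof.
elim/ltn_ind: m g => m IH g gm rg.
have [m0|m0] := posnP m.
  move: gm rg; rewrite m0 mem_monics => /andP[mg /eqP sg].
  have /size1_polyC gE : (size g <= 1)%N by rewrite sg.
  move: mg; rewrite gE monicE lead_coefC => /eqP ->.
  by rewrite map_polyC /= rmorph1 rootC oner_eq0.
have [e [P [h [iP em hm gE]]]] := irr_monics_factor m0 gm.
have e0 := irr_monics_deg iP.
move: rg; rewrite gE rmorphM rootM => /orP[rP|rh].
  by exists e, P; rewrite e0 em.
have lt : (m - e < m)%N by lia.
have [e' [P' [/andP[h1 h2] iP' rP']]] := IH _ lt h hm rh.
by exists e', P'; split=> //; lia.
Qed.

Lemma irr_root_uniq e e' P P' x : P \in irr_monics F e -> P' \in irr_monics F e' ->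
  root (map_poly iota P) x -> root (map_poly iota P') x -> P = P'.
Proof.
move=> iP iP' rP rP'; apply/eqP; apply/negPn/negP => /(irr_monics_coprime iP iP').
rewrite -(coprimep_map iota) => /coprimep_root /(_ rP).
by move/rootP: rP' => ->; rewrite eqxx.
Qed.

Lemma irr_deg_uniq e e' P : P \in irr_monics F e -> P \in irr_monics F e' -> e = e'.
Proof.
move=> /irr_monicsP[+ _] /irr_monicsP[+ _].
by rewrite !mem_monics => /andP[_ /eqP ->] /andP[_ /eqP []].
Qed.

(** Every irreducible factor of [char_pol] over F vanishes at some conjugate of x, where P vanishes
    too. Distinct monic irreducibles share no root, so every factor is P. *)
Lemma char_pol_power e P x : P \in irr_monics F e -> root (map_poly iota P) x ->
  exists r, char_pol x = P ^+ r /\ (r * e = k)%N.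
Proof.
move=> iP rP.
suff H : forall m g, g \in monics F m -> map_poly iota g %| conj_poly x ->
    exists r, g = P ^+ r /\ (r * e = m)%N.
  by apply: H (char_pol_monics x) _; rewrite map_char_pol.
elim/ltn_ind => m IH g gm dvg.
have [m0|m0] := posnP m.
  exists 0%N; rewrite expr0 m0; split=> //.
  move: gm; rewrite m0 mem_monics => /andP[mg /eqP sg].
  have /size1_polyC gE : (size g <= 1)%N by rewrite sg.
  by move: mg; rewrite gE monicE lead_coefC => /eqP ->.
have [e' [P' [h [iP' em hm gE]]]] := irr_monics_factor m0 gm.
have PP : P = P'.
  have dvP : map_poly iota P' %| conj_poly x.
    by apply: dvdp_trans dvg; rewrite gE rmorphM dvdp_mulr.
  have [msk] := dvdp_prod_XsubC dvP.
  case: (mask _ _) => [|i s] hP.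
    move: (eqp_size hP); rewrite big_nil size_poly1 size_map_poly.
    by case/irr_monicsP: iP' => _ [+ _] => /[swap] ->.
  apply: (irr_root_uniq (x := x ^+ (q ^ i)%N) iP iP'); first exact: root_iota_expq.
  by rewrite (eqp_root hP) big_cons rootM root_XsubC eqxx.
have ee := irr_deg_uniq iP; rewrite PP in ee; have {}ee := ee _ iP'.
have e0 := irr_monics_deg iP.
have lt : (m - e' < m)%N by lia.
have dvh : map_poly iota h %| conj_poly x.
  by apply: dvdp_trans dvg; rewrite gE rmorphM dvdp_mull.
have [r [hE rE]] := IH _ lt h hm dvh.
exists r.+1; split; first by rewrite gE hE exprS PP.
by rewrite mulSn rE ee; lia.
Qed.

(** Adjoining a root z of P gives a field of q^e elements, so z^(q^k) = z; an irreducible polynomial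
    divides any polynomial with which it shares a root. *)
Lemma irr_dvd_Xq e P : P \in irr_monics F e -> (e %| k)%N -> P %| 'X^(q ^ k) - 'X.
Proof.
move=> iP ek; have /irr_monicsP[mP irP] := iP.
have sP : size P = e.+1 by move: mP; rewrite mem_monics => /andP[_ /eqP].
have [L1 dimL [z rz _]] := irredp_FAdjoin irP.
apply/negPn/negP; rewrite -irreducible_poly_coprime //.
rewrite -(coprimep_map (in_alg L1)) => /coprimep_root /(_ rz) /negP; apply.
rewrite rmorphB rmorphXn /= map_polyX !hornerE subr_eq0.
have /dvdnP [j ->] := ek; rewrite mulnC (@expf_card_iter F L1) //.
have -> : e = \dim {:L1} by rewrite dimL sP.
by apply/eqP; rewrite -(Fermat's_little_theorem (fullv : {subfield L1})) memvf.
Qed.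

Lemma card_irr_roots e P : P \in irr_monics F e -> (e %| k)%N ->
  #|[set x : L | root (map_poly iota P) x]| = e.
Proof.
move=> iP ek; have /irr_monicsP[mP irP] := iP.
have sP : size P = e.+1 by move: mP; rewrite mem_monics => /andP[_ /eqP].
have : map_poly iota P %| \prod_(x : L) ('X - x%:P).
  rewrite -finField_genPoly cardL.
  have := irr_dvd_Xq iP ek; rewrite -(dvdp_map iota).
  by rewrite rmorphB rmorphXn /= map_polyX.
case/dvdp_prod_XsubC => msk hP.
have us : uniq (mask msk (index_enum L)) by rewrite mask_uniq // index_enum_uniq.
have := eqp_size hP; rewrite size_map_poly sP size_prod_XsubC => -[->].
rewrite -(card_uniqP us); apply: eq_card => x.
by rewrite inE (eqp_root hP) root_prod_XsubC.
Qed.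

(** The elements x are grouped by minimal polynomial P. Its degree e divides k, it has exactly e
    roots in L, and each of them has [char_pol] equal to P^(k/e). This is how Euler product data
    become character sums over the extension. *)
Lemma sum_char_pol (C : numClosedFieldType) (Lam : {poly F} -> C) M :
  Lam 1 = 1 ->
  (forall g h, g \is monic -> h \is monic -> Lam (g * h) = Lam g * Lam h) ->
  (k <= M)%N ->
  \sum_(x : L) Lam (char_pol x) = psum Lam M k.
Proof.
move=> Lam1 LamM kM; rewrite /psum.
transitivity (\sum_(x : L) \sum_(1 <= e < M.+1) \sum_(P <- irr_monics F e)
   (if root (map_poly iota P) x then Lam (char_pol x) else 0)).
  apply: eq_bigr => x _.
  have [e [P [/andP[e0 ek] iP rP]]] := irr_root_ex (char_pol_monics x) (root_char_pol x).
  have hin : e \in index_iota 1 M.+1 by rewrite mem_index_iota; lia.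
  rewrite (bigD1_seq _ hin (iota_uniq _ _)) /= [X in _ = _ + X]big1 ?addr0; last first.
    move=> e' ne; rewrite big_seq big1 // => P' iP'; case: ifP => // rP'.
    have PP := irr_root_uniq iP iP' rP rP'; rewrite -PP in iP'.
    by rewrite (irr_deg_uniq iP iP') eqxx in ne.
  rewrite (bigD1_seq P) ?filter_uniq ?monics_uniq //= rP.
  rewrite [X in _ = _ + X]big_seq_cond [X in _ = _ + X]big1 ?addr0 // => P' /andP[iP' ne].
  case: ifP => // rP'.
  by rewrite (irr_root_uniq iP iP' rP rP') eqxx in ne.
rewrite exchange_big /=; apply: eq_big_nat => e /andP[e0 eM].
rewrite exchange_big /=; apply: eq_big_seq => P iP.
have mP : P \is monic by case/irr_monicsP: iP => /monics_monic.
rewrite -big_mkcond /=; have [ek|nek] := boolP (e %| k)%N; last first.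
  rewrite big1 => [|x rP]; last first.
    by have [r [_ rk]] := char_pol_power iP rP; rewrite -rk dvdn_mull in nek.
  rewrite big1 // => r /eqP rk; by rewrite -rk dvdn_mull in nek.
have /dvdnP [r rk] := ek.
have hin : r \in index_iota 1 M.+1 by rewrite mem_index_iota; nia.
rewrite [RHS]big_mkcond /= [RHS](bigD1_seq _ hin (iota_uniq _ _)) /=.
have -> : (r * e == k)%N by rewrite rk.
rewrite [X in _ = _ + X]big1 ?addr0; last first.
  move=> r' /negP ne; case: eqP => // rk'; case: ne.
  by rewrite -(eqn_pmul2r e0) rk' rk.
rewrite -[X in X%:R * _](card_irr_roots iP ek) -sum1_card natr_sum mulr_suml.
apply: eq_big => x; first by rewrite inE.
move=> rP; have [r' [-> rk']] := char_pol_power iP rP.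
rewrite mul1r LamX //; congr (_ ^+ _); apply/eqP.
by rewrite -(eqn_pmul2r e0) rk' rk.
Qed.

End Extension.

(** * The weight of a mixed character sum *)

(* For a monic g this is the coefficient next to the leading one (0 for g = 1). *)
Definition subcoef (F : fieldType) (g : {poly F}) : F := ('X * g)`_(size g).-1.

Lemma subcoefE (F : fieldType) m (g : {poly F}) :
  g \is monic -> size g = m.+1 -> subcoef g = ('X * (g - 'X^m))`_m.
Proof.
move=> mg sg; rewrite /subcoef sg /= mulrBr coefB -exprS coefXn.
by rewrite ltn_eqF // subr0.
Qed.

Lemma subcoefM (F : fieldType) (g h : {poly F}) :
  g \is monic -> h \is monic -> subcoef (g * h) = subcoef g + subcoef h.
Proof.
move=> mg mh.
have [m sg] : exists m, size g = m.+1.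
  by exists (size g).-1; rewrite prednK // size_poly_gt0 monic_neq0.
have [k sh] : exists k, size h = k.+1.
  by exists (size h).-1; rewrite prednK // size_poly_gt0 monic_neq0.
have sgh : size (g * h) = (m + k).+1.
  by rewrite size_monicM ?monic_neq0 // sg sh addSn addnS.
have small (p : {poly F}) j : p \is monic -> size p = j.+1 -> (size (p - 'X^j)%R <= j)%N.
  move=> mp sp; apply/leq_sizeP => i; rewrite leq_eqVlt => /orP[/eqP <-|ji].
    by rewrite coefB coefXn eqxx -[j]/(j.+1.-1) -sp -/(lead_coef p) (monicP mp) subrr.
  by rewrite coefB coefXn nth_default ?sp // gtn_eqF // subr0.
rewrite (subcoefE (rpredM mg mh) sgh) (subcoefE mg sg) (subcoefE mh sh).
set u := g - 'X^m; set v := h - 'X^k.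
have -> : g * h - 'X^(m + k) = 'X^m * v + 'X^k * u + u * v.
  by rewrite /u /v exprD; ring.
have -> : 'X * ('X^m * v + 'X^k * u + u * v) =
          'X^m * ('X * v) + 'X^k * ('X * u) + 'X * (u * v) by ring.
rewrite !coefD !coefXnM ltnNge leq_addr /= ltnNge leq_addl /= addKn addnK.
rewrite [X in _ + X]nth_default ?addr0 1?addrC //.
have [uv0|uv0] := eqVneq (u * v) 0; first by rewrite uv0 mulr0 size_poly0.
rewrite mulrC size_mulX //.
have := size_polyMleq u v.
have := small _ _ mg sg; have := small _ _ mh sh; rewrite -/u -/v.
have : (0 < size (u * v)%R)%N by rewrite size_poly_gt0.
by lia.
Qed.

(** In characteristic two every additive character takes only the values 1 and -1. *)
Record addsign (C : numClosedFieldType) (F : finFieldType) (psi : F -> C) : Prop :=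
  AddSign { addsign_sq : forall x, psi x = 1 \/ psi x = -1;
            addsignD : forall x y, psi (x + y) = psi x * psi y }.

Lemma addsign0 (C : numClosedFieldType) (F : finFieldType) (psi : F -> C) :
  addsign psi -> psi 0 = 1.
Proof.
move=> [h1 hD]; have := hD 0 0; rewrite addr0.
by case: (h1 0) => -> //; rewrite mulrNN mulr1.
Qed.

Section Weight.
Variables (C : numClosedFieldType) (F : finFieldType) (chi psi : F -> C) (a b : nat).
Hypotheses (hc : mulchar chi) (cinj : forall x, chi x = 1 -> x = 1)
  (hp : addsign psi) (na : ~~ (#|F|.-1 %| a)%N).

(** Completely multiplicative on monic polynomials, and on X + x equal to the summand chi(x)^a
    chi(x+1)^b psi(x). Hence the mixed sum is the linear coefficient of the L-function sum_m (Lsum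
    m) T^m. *)
Definition mixed_weight (g : {poly F}) : C :=
  chi g.[0] ^+ a * chi g.[1] ^+ b * psi (subcoef g).

Lemma mixed_weight1 : mixed_weight 1 = 1.
Proof.
rewrite /mixed_weight /subcoef !hornerC (mulchar1 hc) !expr1n size_poly1 !mulr1.
by rewrite coefX addsign0 ?mulr1.
Qed.

Lemma mixed_weightM g h : g \is monic -> h \is monic ->
  mixed_weight (g * h) = mixed_weight g * mixed_weight h.
Proof.
move=> mg mh; rewrite /mixed_weight !hornerM !(mulcharM hc) !exprMn.
by rewrite subcoefM // (addsignD hp); ring.
Qed.

Lemma mulchar_pow_nontriv : exists2 t : F, t != 0 & chi t ^+ a != 1.
Proof.
have q1 := card_pred_gt0 F.
have [|v v0 va] := @mulchar_pow_trivial F (a %% #|F|.-1).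
  by rewrite ltn_mod q1 andbT lt0n; move: na; rewrite /dvdn.
exists v => //; apply: contra va; rewrite -mulcharX // => /eqP /cinj.
rewrite {1}(divn_eq a #|F|.-1) exprD mulnC exprM expf_card_pred // expr1n mul1r.
by move=> ->.
Qed.

(** Adding a multiple of 1 - X to g rescales g(0) by t and keeps g(1). For m > 2 it does not reach
    the subleading coefficient either, so this permutation of the monics multiplies the sum by
    chi(t)^a, which is not 1 for a suitable t. *)
Lemma Lsum_eq0 m : (2 < m)%N -> Lsum mixed_weight m = 0.
Proof.
move=> m3; have [t t0 ta] := mulchar_pow_nontriv.
pose T (u : F) (g : {poly F}) := g + ((u - 1) * g.[0]) *: (1 - 'X).
have T0 u g : (T u g).[0] = u * g.[0].
  by rewrite /T !hornerE; ring.
have T1 u g : (T u g).[1] = g.[1].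
  by rewrite /T !hornerE; ring.
have s1X : (size (1 - 'X : {poly F})%R <= 2)%N.
  by rewrite (leq_trans (size_polyD _ _)) // size_polyN size_polyX size_poly1.
have sT c : (size (c *: (1 - 'X) : {poly F})%R < m)%N.
  by apply: leq_ltn_trans (size_scale_leq _ _) _; apply: leq_ltn_trans s1X _.
have Tm u g : g \in monics F m -> T u g \in monics F m.
  rewrite !mem_monics => /andP[mg /eqP sg].
  have lt : (size (((u - 1) * g.[0]) *: (1 - 'X) : {poly F})%R < size g)%N.
    by rewrite sg; apply: ltn_trans (sT _) _.
  by rewrite /T monicE lead_coefDl // -monicE mg size_polyDl // sg eqxx.
have TK u g : u != 0 -> T u^-1 (T u g) = g.
  move=> u0; rewrite {1}/T T0 /T -addrA -scalerDl.
  suff -> : (u - 1) * g.[0] + (u^-1 - 1) * (u * g.[0]) = 0 by rewrite scale0r addr0.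
  by field.
have WT u g : g \in monics F m -> mixed_weight (T u g) = chi u ^+ a * mixed_weight g.
  move=> gm; have := Tm u g gm.
  move: (gm); rewrite !mem_monics => /andP[_ /eqP sg] /andP[_ /eqP sTg].
  rewrite /mixed_weight T0 T1 (mulcharM hc) exprMn /subcoef sg sTg /=.
  rewrite /T mulrDr coefD -scalerAr.
  rewrite [X in _ + X]nth_default ?addr0; first by rewrite -!mulrA.
  apply: leq_trans (size_scale_leq _ _) _; apply: leq_trans (size_polyMleq _ _) _.
  by apply: leq_trans m3; rewrite size_polyX add2n ltnS.
have : chi t ^+ a * Lsum mixed_weight m = Lsum mixed_weight m.
  rewrite /Lsum mulr_sumr -(eq_big_seq _ (fun g hg => WT t g hg)).
  rewrite -(big_map (T t) xpredT mixed_weight); apply: perm_big.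
  have tK : injective (T t) by move=> g h e; rewrite -(TK t g t0) e TK.
  apply: uniq_perm; [by rewrite map_inj_uniq // monics_uniq|exact: monics_uniq|move=> g].
  apply/mapP/idP => [[h hm ->]|hg]; first exact: Tm.
  exists (T t^-1 g); first exact: Tm.
  by rewrite -{1}(TK t^-1 g) ?invr_eq0 // invrK.
move/eqP; rewrite -subr_eq0 -{2}[Lsum _ _]mul1r -mulrBl mulf_eq0 subr_eq0.
by rewrite (negPf ta) => /eqP.
Qed.

Lemma Lsum0 : Lsum mixed_weight 0 = 1.
Proof.
rewrite /Lsum (bigD1_seq 1) ?monics_uniq ?monics1 //= mixed_weight1.
rewrite big_seq_cond big1 ?addr0 // => g /andP[].
rewrite mem_monics => /andP[mg /eqP sg] /negP[].
have /size1_polyC gE : (size g <= 1)%N by rewrite sg.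
by move: mg; rewrite gE monicE lead_coefC => /eqP ->.
Qed.

(** The L-function is 1 + c1 T + c2 T^2 = (1 - l1 T)(1 - l2 T), and Newton's recurrence determines
    the power sums from c1 and c2. *)
Lemma psum_eigen : exists l1 l2 : C, Lsum mixed_weight 1 = - (l1 + l2) /\
  forall M k, (0 < k <= M)%N -> psum mixed_weight M k = - (l1 ^+ k + l2 ^+ k).
Proof.
pose c1 := Lsum mixed_weight 1; pose c2 := Lsum mixed_weight 2.
pose D := sqrtC (c1 ^+ 2 - 4 * c2).
have DE : D ^+ 2 = c1 ^+ 2 - 4 * c2 by rewrite sqrtCK.
have [l1 [l2 [hs hm]]] : exists l1 l2, c1 = - (l1 + l2) /\ c2 = l1 * l2.
  exists ((- c1 + D) / 2), ((- c1 - D) / 2); split; first by field.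
  have -> : (- c1 + D) / 2 * ((- c1 - D) / 2) = (c1 ^+ 2 - D ^+ 2) / 4 by field.
  by rewrite DE; field.
exists l1, l2; split=> // M.
have new m (mM : (m <= M)%N) := newton_Lsum mixed_weight1 mixed_weightM mM.
elim/ltn_ind => -[//|[|[|k]]] IH /= kM.
- have := new 1%N kM; rewrite big_nat1 subnn Lsum0 mulr1 mul1r => <-.
  by rewrite -/c1 hs !expr1.
- have := new 2%N kM; rewrite big_nat_recr //= big_nat1 subnn Lsum0 mulr1.
  rewrite (IH 1%N) //; last by lia.
  rewrite subSS subn0 -/c1 -/c2 hs hm !expr1 => E.
  apply: (addrI (- (l1 + l2) * (- (l1 + l2)))); rewrite -E; ring.
have := new k.+3 kM; rewrite Lsum_eq0 // mulr0 big_nat_recr //= subnn Lsum0 mulr1.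
rewrite big_nat_recr //= big_nat_recr //= big_nat big1 ?add0r; last first.
  by move=> i /andP[i0 ik]; rewrite Lsum_eq0 ?mulr0 //; lia.
rewrite (IH k.+1) ?(IH k.+2) //; [|lia|lia].
have -> : (k.+3 - k.+1 = 2)%N by lia.
have -> : (k.+3 - k.+2 = 1)%N by lia.
rewrite -/c1 -/c2 hs hm => /esym /eqP; rewrite addr_eq0 => /eqP E.
apply: oppr_inj; rewrite -E.
rewrite !exprS; ring.
Qed.

End Weight.

(** * Characteristic two *)

Lemma pchar2_addrr (R : nzRingType) (x : R) : 2 \in [pchar R] -> x + x = 0.
Proof. by move=> h; rewrite -mulr2n mulrn_pchar. Qed.

Lemma pchar2_oppr (R : nzRingType) (x : R) : 2 \in [pchar R] -> - x = x.
Proof. by move=> h; apply/eqP; rewrite -subr_eq0 -opprD pchar2_addrr ?oppr0. Qed.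

Lemma addsign_sum0 (C : numClosedFieldType) (F : finFieldType) (psi : F -> C) y :
  addsign psi -> psi y = -1 -> \sum_x psi x = 0.
Proof.
move=> hp hy; set S := \sum_x _.
have : S = - S.
  by rewrite {1}/S (reindex_inj (addrI y)) /S -sumrN /=; apply: eq_bigr => x _;
     rewrite (addsignD hp) hy mulN1r.
by move/eqP; rewrite -addr_eq0 -mulr2n mulrn_eq0 => /eqP.
Qed.

(** On a field of 2^m elements this is the absolute trace to F_2, with values kept inside the
    field. *)
Definition atr (R : pzSemiRingType) m (x : R) : R := \sum_(i < m) x ^+ (2 ^ i)%N.

Definition sgn01 (C : numClosedFieldType) (R : nzRingType) (v : R) : C :=
  if v == 0 then 1 else -1.

Section AbsoluteTrace.
Variables (C : numClosedFieldType) (L : finFieldType) (m : nat).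
Hypotheses (m0 : (0 < m)%N) (cL : #|L| = (2 ^ m)%N).

Lemma card2_pchar : 2 \in [pchar L].
Proof. exact: card_finPcharP cL _. Qed.

Let c2 := card2_pchar.

Lemma exp2D j (x y : L) : (x + y) ^+ (2 ^ j)%N = x ^+ (2 ^ j)%N + y ^+ (2 ^ j)%N.
Proof. by apply: exprDn_pchar; rewrite pnatX (eq_pnat _ (pcharf_eq c2)). Qed.

Lemma atrD (x y : L) : atr m (x + y) = atr m x + atr m y.
Proof. by rewrite /atr -big_split; apply: eq_bigr => i _; apply: exp2D. Qed.

Lemma atr0 : atr m (0 : L) = 0.
Proof. by rewrite /atr big1 // => i _; rewrite expr0n expn_eq0. Qed.

Lemma atr_sq (x : L) : atr m (x ^+ 2) = atr m x.
Proof.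
rewrite /atr; under eq_bigr do rewrite -exprM -expnS.
case: m m0 cL => // m' _ cL'; rewrite big_ord_recr big_ord_recl /= addrC.
by rewrite -cL' expf_card expn0 expr1.
Qed.

Lemma atr_idem (x : L) : atr m x ^+ 2 = atr m x.
Proof.
rewrite -[RHS]atr_sq /atr (big_morph (fun z : L => z ^+ 2) (exp2D 1) (expr0n _ _)).
by apply: eq_bigr => i _; rewrite -!exprM mulnC.
Qed.

Lemma atr01 (x : L) : atr m x = 0 \/ atr m x = 1.
Proof.
have /eqP := atr_idem x; rewrite expr2 -subr_eq0 -{3}[atr m x]mulr1 -mulrBr mulf_eq0.
by rewrite subr_eq0 => /orP[] /eqP ->; [left|right].
Qed.

Lemma card_atr0 : (#|[set x : L | atr m x == 0%R]| <= 2 ^ m.-1)%N.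
Proof.
pose P : {poly L} := \sum_(i < m) 'X^(2 ^ i).
have sP : size P = (2 ^ m.-1).+1.
  rewrite /P -(prednK m0) big_ord_recr /= addrC size_polyDl size_polyXn // ltnS.
  apply: leq_trans (size_sum _ _ _) _; apply/bigmax_leqP => i _.
  by rewrite size_polyXn ltn_exp2l.
rewrite -ltnS -sP cardE; apply: max_poly_roots; rewrite ?enum_uniq //.
  by rewrite -size_poly_eq0 sP.
apply/allP => x; rewrite mem_enum inE /root /P horner_sum => /eqP h; apply/eqP.
by rewrite -[RHS]h; apply: eq_bigr => i _; rewrite hornerXn.
Qed.

Lemma atr_nontriv : exists x : L, atr m x = 1.
Proof.
have [/existsP [x /eqP h]|/existsPn h] := boolP [exists x : L, atr m x == 1]; first by exists x.
have := card_atr0; rewrite leqNgt => /negP []; apply: (@leq_trans #|L|).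
  by rewrite cL ltn_exp2l // ltn_predL.
rewrite -cardsT; apply: subset_leq_card; apply/subsetP => x _; rewrite inE.
by case: (atr01 x) => hx; [rewrite hx|have := h x; rewrite hx eqxx].
Qed.

Lemma sgn01_atr_addsign c : addsign (fun x : L => sgn01 C (atr m (c * x))).
Proof.
split=> [x|x y]; rewrite /sgn01; first by case: ifP; [left|right].
rewrite mulrDr atrD; case: (atr01 (c * x)) => ->; case: (atr01 (c * y)) => ->.
- by rewrite addr0 eqxx mulr1.
- by rewrite add0r eqxx mul1r.
- by rewrite addr0 oner_eq0 eqxx mulr1.
- by rewrite pchar2_addrr // eqxx oner_eq0 mulrNN mulr1.
Qed.

(** The correlations S(c) of [psi] with the trace signs add up to 2^m psi(0), so some S(c) is
    nonzero. The product of [psi] with that sign is then a character with nonzero sum, hence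
    trivial. *)
Lemma addsign_repr (psi : L -> C) : addsign psi ->
  exists c, forall x, psi x = sgn01 C (atr m (c * x)).
Proof.
move=> hp; pose S c := \sum_x psi x * sgn01 C (atr m (c * x)).
have [/existsP [c Sc]|/existsPn hS] := boolP [exists c, S c != 0]; last first.
  have : \sum_c S c = 0 by apply: big1 => c _; apply/eqP/negPn/hS.
  rewrite exchange_big /= (bigD1 0) //= [X in _ + X]big1 ?addr0 => [|x x0].
    rewrite (eq_bigr (fun=> 1)) => [|c _]; last first.
      by rewrite mulr0 atr0 /sgn01 eqxx mulr1 (addsign0 hp).
    by rewrite sumr_const => /eqP; rewrite pnatr_eq0 cL expn_eq0.
  have [y hy] := atr_nontriv.
  have hx : sgn01 C (atr m (x * (y / x))) = -1.
    by rewrite mulrCA mulfV // mulr1 hy /sgn01 oner_eq0.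
  have h := addsign_sum0 (sgn01_atr_addsign x) hx.
  rewrite -mulr_sumr -[RHS](mulr0 (psi x)); congr (_ * _); rewrite -[RHS]h.
  by apply: eq_bigr => c _; rewrite mulrC.
exists c => x; have hq := sgn01_atr_addsign c.
have hr : addsign (fun x => psi x * sgn01 C (atr m (c * x))).
  split=> [z|z w]; last by rewrite (addsignD hp) (addsignD hq); ring.
  by case: (addsign_sq hp z) => ->; case: (addsign_sq hq z) => ->;
    rewrite ?mulr1 ?mul1r ?mulrNN ?mulr1; [left|right|right|left].
case: (addsign_sq hr x) => E; last by rewrite /S (addsign_sum0 hr E) eqxx in Sc.
case: (addsign_sq hq x) E => ->; first by rewrite mulr1.
by rewrite mulrN1 => /eqP; rewrite eqr_oppLR => /eqP.
Qed.

(** The trace of w^2 + w is zero, so a fibre over an element of trace 1 is empty. The others have at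
    most two elements and there are at most 2^(m-1) of them; the total 2^m forces equality
    everywhere. *)
Lemma card_artin_schreier (y : L) :
  #|[set w : L | w ^+ 2 + w == y]|%:R = 1 + sgn01 C (atr m y) :> C.
Proof.
pose n (y : L) := #|[set w : L | w ^+ 2 + w == y]|.
have n2 z : (n z <= 2)%N.
  pose P : {poly L} := 'X^2 + ('X - z%:P).
  have sP : size P = 3 by rewrite /P size_polyDl size_polyXn // size_XsubC.
  suff : (n z < size P)%N by rewrite sP.
  rewrite /n cardE; apply: max_poly_roots; rewrite ?enum_uniq //.
    by rewrite -size_poly_eq0 sP.
  apply/allP => w; rewrite mem_enum inE /root /P !hornerE => /eqP <-.
  by apply/eqP; apply: subrr.
have nz z : atr m z != 0 -> n z = 0%N.
  move=> hz; apply/eqP; rewrite cards_eq0; apply/eqP/setP => w; rewrite !inE.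
  apply: contraNF hz => /eqP <-.
  by rewrite atrD atr_sq pchar2_addrr.
have sn : (\sum_z n z = 2 ^ m)%N.
  transitivity (\sum_z \sum_(w : L | (w ^+ 2 + w == z)%R) 1)%N.
    by apply: eq_bigr => z _; rewrite /n -sum1_card; apply: eq_bigl => w; rewrite inE.
  rewrite -[RHS]cL -[RHS]sum1_card.
  by rewrite [RHS](partition_big (fun w : L => w ^+ 2 + w) xpredT).
have nn z : atr m z == 0 -> n z = 2.
  move=> hz; have := n2 z; rewrite leq_eqVlt => /orP[/eqP //|lt].
  exfalso; have : (\sum_z n z < \sum_(z : L | atr m z == 0%R) 2)%N.
    rewrite (bigID (fun z => atr m z == 0)) /= addnC big1 ?add0n; last by move=> z' /nz.
    rewrite (bigD1 z) //= [X in (_ < X)%N](bigD1 z) //= -addSn.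
    by apply: leq_add => //; apply: leq_sum => z' _; apply: n2.
  rewrite sn sum_nat_const => h.
  have := leq_mul card_atr0 (leqnn 2); rewrite cardsE -expnSr prednK // => h'.
  by have := leq_trans h h'; rewrite ltnn.
rewrite -/(n y) /sgn01; case: ifP => [/nn ->|/negbT /nz ->]; first by rewrite mulr2n.
by rewrite subrr.
Qed.

End AbsoluteTrace.

Lemma atr_mul (R : comNzRingType) n k (x : R) :
  atr (n * k) x = \sum_(j < k) atr n (x ^+ (2 ^ (n * j))%N).
Proof.
elim: k => [|k IH]; first by rewrite muln0 /atr !big_ord0.
rewrite big_ord_recr /= -IH mulnS addnC /atr big_split_ord /=; congr (_ + _).
by apply: eq_bigr => i _; rewrite -exprM -expnD.
Qed.

(** * Norms, traces and character sums over extensions *)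

Section Norms.
Variables (C : numClosedFieldType) (F L : finFieldType) (iota : {rmorphism F -> L}).
Variables (n k : nat).
Hypotheses (n0 : (0 < n)%N) (cF : #|F| = (2 ^ n)%N) (k0 : (0 < k)%N)
  (cL : #|L| = (#|F| ^ k)%N).
Local Notation q := #|F|.

(** The norm from L to F; the sign (-1)^k disappears in characteristic two. *)
Definition ext_norm (x : L) : F := (char_pol iota k x).[0].

Lemma cardL_2nk : #|L| = (2 ^ (n * k))%N.
Proof. by rewrite cL cF expnM. Qed.

Lemma ext_pchar2 : 2 \in [pchar L].
Proof. exact: card2_pchar cardL_2nk. Qed.

Lemma exp_qD j (x y : L) : (x + y) ^+ (q ^ j)%N = x ^+ (q ^ j)%N + y ^+ (q ^ j)%N.
Proof. by rewrite cF -expnM; apply: (exp2D cardL_2nk). Qed.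

Lemma iota_norm x : iota (ext_norm x) = x ^+ (\sum_(i < k) q ^ i)%N.
Proof.
rewrite /ext_norm -horner_map (map_char_pol iota k0 cL) rmorph0 /= /conj_poly horner_prod.
rewrite expr_sum; apply: eq_bigr => i _.
by rewrite !hornerE pchar2_oppr // ext_pchar2.
Qed.

Lemma char_pol1 x : (char_pol iota k x).[1] = ext_norm (x + 1).
Proof.
apply: (fmorph_inj iota); rewrite iota_norm -horner_map (map_char_pol iota k0 cL) rmorph1 /=.
rewrite /conj_poly horner_prod expr_sum; apply: eq_bigr => i _.
by rewrite !hornerE pchar2_oppr ?ext_pchar2 // exp_qD expr1n addrC.
Qed.

Lemma ext_normM x y : ext_norm (x * y) = ext_norm x * ext_norm y.
Proof. by apply: (fmorph_inj iota); rewrite rmorphM /= !iota_norm exprMn. Qed.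

Lemma ext_normX x j : ext_norm (x ^+ j) = ext_norm x ^+ j.
Proof.
by apply: (fmorph_inj iota); rewrite rmorphXn /= !iota_norm -!exprM mulnC.
Qed.

Lemma ext_norm_neq0 x : x != 0 -> ext_norm x != 0.
Proof.
by move=> x0; rewrite -(fmorph_eq0 iota) iota_norm expf_neq0.
Qed.

Lemma iota_subcoef x : iota (subcoef (char_pol iota k x)) = \sum_(i < k) x ^+ (q ^ i)%N.
Proof.
have /andP[mg /eqP sg] : (char_pol iota k x \is monic) && (size (char_pol iota k x) == k.+1).
  by rewrite -mem_monics char_pol_monics.
rewrite /subcoef sg /= coefXM gtn_eqF // -coef_map (map_char_pol iota k0 cL) /conj_poly.
pose ps := [seq x ^+ (q ^ (i : 'I_k))%N | i <- index_enum 'I_k].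
have sps : size ps = k by rewrite size_map /index_enum -enumT size_enum_ord.
rewrite -(big_map (fun i : 'I_k => x ^+ (q ^ i)%N) xpredT (fun p => 'X - p%:P)) -/ps.
rewrite -{1}sps coefPn_prod_XsubC ?sps -?lt0n // pchar2_oppr ?ext_pchar2 //.
by rewrite /ps big_map.
Qed.

Lemma iota_atr c x :
  iota (atr n (c * subcoef (char_pol iota k x))) = atr (n * k) (iota c * x).
Proof.
rewrite rmorph_sum atr_mul /= /atr.
under eq_bigr do rewrite rmorphXn rmorphM /= iota_subcoef mulr_sumr.
transitivity (\sum_(i < n) \sum_(j < k) (iota c * x ^+ (q ^ j)%N) ^+ (2 ^ i)%N).
  apply: eq_bigr => i _.
  apply: (big_morph (fun z : L => z ^+ (2 ^ i)%N) (exp2D cardL_2nk i)).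
  by rewrite expr0n expn_eq0.
rewrite exchange_big /=; apply: eq_bigr => j _; apply: eq_bigr => i _.
congr (_ ^+ _); rewrite exprMn expnM -cF; congr (_ * _).
by rewrite (iota_expq iota).
Qed.

Lemma sgn_iota c x : sgn01 C (atr n (c * subcoef (char_pol iota k x))) =
  sgn01 C (atr (n * k) (iota c * x)).
Proof. by rewrite /sgn01 -iota_atr fmorph_eq0. Qed.

Section Sums.
Variables (chi : F -> C) (a b : nat).
Hypotheses (hc : mulchar chi) (cinj : forall x, chi x = 1 -> x = 1)
  (na : ~~ (#|F|.-1 %| a)%N).

Lemma sum_mixed (psi : F -> C) c M : addsign psi -> (k <= M)%N ->
  (forall x, psi x = sgn01 C (atr n (c * x))) ->
  psum (mixed_weight chi psi a b) M k =
  \sum_(x : L) chi (ext_norm x) ^+ a * chi (ext_norm (x + 1)) ^+ b *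
     sgn01 C (atr (n * k) (iota c * x)).
Proof.
move=> hp kM psiE.
rewrite -(sum_char_pol iota k0 cL (mixed_weight1 a b hc hp) (mixed_weightM a b hc hp) kM).
by apply: eq_bigr => x _; rewrite /mixed_weight char_pol1 psiE sgn_iota.
Qed.

(* Each x with sign +1 is hit twice by w |-> (w^2 + w)/c, the others never. *)
Lemma sum_artin_schreier (c : L) : c != 0 ->
  \sum_(x : L) chi (ext_norm x) ^+ a * chi (ext_norm (x + 1)) ^+ b *
     sgn01 C (atr (n * k) (c * x)) =
  chi (ext_norm c^-1) ^+ (a + b) *
   (\sum_(w : L) chi (ext_norm (w ^+ 2 + w)) ^+ a * chi (ext_norm (w ^+ 2 + w + c)) ^+ b)
  - \sum_(x : L) chi (ext_norm x) ^+ a * chi (ext_norm (x + 1)) ^+ b.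
Proof.
move=> c0; have m0 : (0 < n * k)%N by rewrite muln_gt0 n0.
apply/eqP; rewrite eq_sym subr_eq -big_split /=; apply/eqP.
pose Phi (x : L) := chi (ext_norm x) ^+ a * chi (ext_norm (x + 1)) ^+ b.
transitivity (\sum_w Phi (c^-1 * (w ^+ 2 + w))).
  rewrite mulr_sumr; apply: eq_bigr => w _; rewrite /Phi.
  have -> : c^-1 * (w ^+ 2 + w) + 1 = c^-1 * (w ^+ 2 + w + c) by field.
  by rewrite !ext_normM !(mulcharM hc) !exprMn exprD; ring.
rewrite (partition_big (fun w : L => c^-1 * (w ^+ 2 + w)) xpredT) //=.
apply: eq_bigr => x _; rewrite -/(Phi x).
transitivity (\sum_(w | c^-1 * (w ^+ 2 + w) == x) Phi x).
  by apply: eq_bigr => w /eqP ->.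
rewrite sumr_const -[RHS](_ : Phi x * (1 + sgn01 C (atr (n * k) (c * x))) = _); last by ring.
rewrite -(card_artin_schreier C m0 cardL_2nk) -[LHS]mulr_natr; congr (_ * _%:R).
apply: eq_card => w; rewrite [LHS]unfold_in inE.
by apply/eqP/eqP => [<-|->]; rewrite mulrA ?mulfV ?mulVf // mul1r.
Qed.

(** Moving h = gcd(a, b, q - 1) from the exponents into the norm leaves f = f1^(a/h) f2^(b/h), whose
    roots s1 and s2 have multiplicities with gcd prime to d = (q - 1)/h, as [stepanov_charsum]
    requires. That q - 1 does not divide a gives d > 1. *)
Lemma pure_sum_bound (k' B : nat) (f1 f2 : {poly F}) (s1 s2 : L) (r1 r2 : {poly L})
    (h := gcdn (gcdn a b) #|F|.-1) (d := (#|F|.-1 %/ h)%N)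
    (m := (size (f1 ^+ (a %/ h)%N * f2 ^+ (b %/ h)%N)).-1) :
  B = (#|F| ^ k')%N -> #|L| = (B ^ 2)%N ->
  (4 * d * m.+1 + (4 * m + 10) <= B)%N ->
  map_poly iota f1 = ('X - s1%:P) * r1 -> ~~ root r1 s1 -> ~~ root (map_poly iota f2) s1 ->
  map_poly iota f2 = ('X - s2%:P) * r2 -> ~~ root r2 s2 -> ~~ root (map_poly iota f1) s2 ->
  `|\sum_(w : L) chi (ext_norm (map_poly iota f1).[w]) ^+ a *
                 chi (ext_norm (map_poly iota f2).[w]) ^+ b|
   <= (stepanov_const d m * B + m)%:R.
Proof.
move=> Bk cLB Bm f1E r1s f2s f2E r2s f1s.
have q0 := card_pred_gt0 F.
have h0 : (0 < h)%N by rewrite gcdn_gt0 q0 orbT.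
have hq : (h %| #|F|.-1)%N by apply: dvdn_gcdr.
have ha : (h %| a)%N by apply: dvdn_trans (dvdn_gcdl _ _) (dvdn_gcdl _ _).
have hb : (h %| b)%N by apply: dvdn_trans (dvdn_gcdl _ _) (dvdn_gcdr _ _).
have dh : (#|F|.-1 = d * h)%N by rewrite divnK.
have d1 : (1 < d)%N.
  rewrite ltn_neqAle; apply/andP; split; last by move: q0; rewrite dh muln_gt0 => /andP[].
  by apply: contra na => /eqP dE; rewrite dh -dE mul1n.
set a1 := (a %/ h)%N in m Bm *; set b1 := (b %/ h)%N in m Bm *.
have aE : a = (a1 * h)%N by rewrite divnK.
have bE : b = (b1 * h)%N by rewrite divnK.
have cop : coprime (gcdn a1 b1) d.
  rewrite /coprime -(eqn_pmul2r h0) mul1n muln_gcdl muln_gcdl -aE -bE -dh.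
  by [].
have [s Bd] : exists s, B = (d * s).+1.
  have dq : (d %| #|F|.-1)%N by rewrite dh dvdn_mulr.
  have /dvdnP [s hs] : (d %| B.-1)%N.
    by rewrite Bk predn_exp dvdn_mulr.
  exists s; rewrite mulnC -hs prednK // Bk expn_gt0 ltnW // finNzRing_gt1 //.
set f0 := f1 ^+ a1 * f2 ^+ b1 in m Bm *.
pose f := map_poly iota f0.
have fE : f = map_poly iota f1 ^+ a1 * map_poly iota f2 ^+ b1.
  by rewrite /f rmorphM !rmorphXn.
have mE : m = (size f).-1 by rewrite /f size_map_poly.
have fF1 : f = ('X - s1%:P) ^+ a1 * (r1 ^+ a1 * map_poly iota f2 ^+ b1).
  by rewrite fE f1E exprMn mulrA.
have fF2 : f = ('X - s2%:P) ^+ b1 * (r2 ^+ b1 * map_poly iota f1 ^+ a1).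
  by rewrite fE f2E exprMn; ring.
have rX (p : {poly L}) x j : ~~ root p x -> ~~ root (p ^+ j) x.
  by rewrite /root horner_exp => hx; rewrite expf_neq0.
have fR1 : ~~ root (r1 ^+ a1 * map_poly iota f2 ^+ b1) s1.
  by rewrite rootM negb_or !rX.
have fR2 : ~~ root (r2 ^+ b1 * map_poly iota f1 ^+ a1) s2.
  by rewrite rootM negb_or !rX.
have fB : f ^+ B = f \Po 'X^B by rewrite Bk (map_iota_exp iota).
have pB : [pchar L].-nat B by rewrite Bk (ext_pnat iota).
(* Its exponent h (1 + q + ... + q^(k-1)) equals s (B + 1), since d times either of them is |L| -
   1. *)
pose N (y : L) := ext_norm y ^+ h.
have hN y : iota (N y) = y ^+ (s * B.+1).
  rewrite rmorphXn /= iota_norm -exprM; congr (_ ^+ _); apply/eqP.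
  have d0 : (0 < d)%N by apply: ltnW.
  rewrite -(eqn_pmul2l d0); apply/eqP.
  have e1 : (#|F|.-1 * \sum_(i < k) #|F| ^ i = (#|F| ^ k).-1)%N.
    by rewrite predn_exp.
  have e2 : ((#|F| ^ k).-1 = d * s * B.+1)%N.
    rewrite -cL cLB Bd.
    by have -> : ((d * s).+1 ^ 2 = (d * s * (d * s).+2).+1)%N by ring.
  by rewrite mulnCA -dh mulnC e1 e2 mulnA.
have := @stepanov_charsum C F L iota chi N d h s B a1 b1 s1 s2 f _ _ hc cinj d1 dh Bd.
rewrite -mE => /(_ _ _ Bm cLB pB fB fF1 fR1 fF2 fR2 cop hN) le.
apply: le_trans le; rewrite le_eqVlt; apply/orP; left.
apply/eqP; congr `|_|; apply: eq_bigr => w _.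
rewrite /N mulcharX // fE hornerM !horner_exp ext_normM !ext_normX (mulcharM hc).
by rewrite !(mulcharX _ _ hc) exprMn -!exprM -aE -bE.
Qed.

End Sums.
End Norms.

(** Only degrees 2k occur, so that the extension has B^2 elements with B = q^k. K depends on a, b, q
    and the degrees of the fixed polynomials in play, never on k; N makes B pass the Stepanov
    threshold. *)
Lemma psum_bound (C : numClosedFieldType) (F : finFieldType) n (chi psi : F -> C) a b :
  (0 < n)%N -> #|F| = (2 ^ n)%N ->
  mulchar chi -> (forall x, chi x = 1 -> x = 1) -> addsign psi ->
  ~~ (#|F|.-1 %| a)%N ->
  exists K N : nat, forall k M, (N <= k)%N -> (2 * k <= M)%N ->
   `|psum (mixed_weight chi psi a b) M (2 * k)| <= (K * #|F| ^ k)%:R.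
Proof.
move=> n0 cF hc cinj hp na; have [c psiE] := addsign_repr n0 cF hp.
pose h := gcdn (gcdn a b) #|F|.-1; pose d := (#|F|.-1 %/ h)%N.
pose deg (f1 f2 : {poly F}) := (size (f1 ^+ (a %/ h)%N * f2 ^+ (b %/ h)%N)).-1.
pose thr m := (4 * d * m.+1 + (4 * m + 10))%N.
pose f1W : {poly F} := 'X^2 + 'X; pose f2W : {poly F} := 'X^2 + 'X + c%:P.
pose mJ := deg 'X ('X + 1); pose mW := deg f1W f2W.
pose cst m := (stepanov_const d m + m)%N.
exists (cst mW + cst mJ)%N, (thr mJ + thr mW)%N => k M kN kM.
have k0 : (0 < k)%N by apply: leq_trans kN; rewrite addn_gt0 /thr addn_gt0 addnS orbT.
have k20 : (0 < 2 * k)%N by rewrite muln_gt0.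
have [L [iota cL]] := finField_ext F k20.
have cL2 := cardL_2nk cF cL.
have c2 := ext_pchar2 cF cL.
set B := (#|F| ^ k)%N.
have cLB : #|L| = (B ^ 2)%N by rewrite cL mulnC expnM.
have kB : (k < B)%N by apply: ltn_expl; apply: finNzRing_gt1.
have bnd m (x : C) : `|x| <= (stepanov_const d m * B + m)%:R -> `|x| <= (cst m * B)%:R.
  move/le_trans; apply; rewrite ler_nat /cst mulnDl leq_add2l leq_pmulr //.
  by apply: leq_ltn_trans kB.
rewrite (@sum_mixed C F L iota n (2 * k) cF k20 cL chi a b hc psi c M hp kM psiE).
pose J := \sum_(x : L) chi (ext_norm iota (2 * k) x) ^+ a *
                       chi (ext_norm iota (2 * k) (x + 1)) ^+ b.
have hJ : `|J| <= (cst mJ * B)%:R.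
  apply: bnd.
  have := @pure_sum_bound C F L iota n (2 * k) cF k20 cL chi a b hc cinj na k B
    'X ('X + 1) 0 1 1 1 erefl cLB.
  rewrite -/h -/d -/(deg 'X ('X + 1)) -/mJ rmorphD rmorph1 /= map_polyX.
  have -> : \sum_w chi (ext_norm iota (2 * k) ('X : {poly L}).[w]) ^+ a *
        chi (ext_norm iota (2 * k) ('X + 1 : {poly L}).[w]) ^+ b = J.
    by apply: eq_bigr => w _; rewrite !hornerE.
  apply; rewrite ?subr0 ?mulr1 ?root1 ?rootX ?oner_eq0 //.
  - by apply: leq_trans (ltnW kB); apply: leq_trans kN; rewrite leq_addr.
  - by rewrite /root !hornerE oner_eq0.
  - by rewrite pchar2_oppr // (rmorph_pchar polyC).
(* For c = 0 the additive character is trivial and the sum is already pure. *)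
have [c0|c0] := eqVneq c 0.
  have -> : \sum_x chi (ext_norm iota (2 * k) x) ^+ a *
     chi (ext_norm iota (2 * k) (x + 1)) ^+ b * sgn01 C (atr (n * (2 * k)) (iota c * x)) = J.
    apply: eq_bigr => x _; rewrite c0 rmorph0 mul0r atr0 // /sgn01 eqxx mulr1 //.
  by apply: le_trans hJ _; rewrite ler_nat leq_mul2r leq_addl orbT.
have ic0 : iota c != 0 by rewrite fmorph_eq0.
rewrite (@sum_artin_schreier C F L iota n (2 * k) n0 cF k20 cL chi a b hc _ ic0) -/J.
set W := \sum_(w : L) _.
have nc : `|chi (ext_norm iota (2 * k) (iota c)^-1) ^+ (a + b)| = 1.
  have e0 : ext_norm iota (2 * k) (iota c)^-1 != 0.
    by apply: (ext_norm_neq0 iota cF k20 cL); rewrite invr_eq0.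
  by rewrite normrX (mulchar_norm hc e0) expr1n.
apply: le_trans (ler_normB _ _) _; rewrite normrM nc mul1r mulnDl natrD.
apply: lerD => //; apply: bnd.
(* An element of F has trace zero from an extension of even degree, so w^2 + w + c has the distinct
   roots s and s + 1 in L. *)
have [s hs] : exists s : L, s ^+ 2 + s = iota c.
  have at0 : atr (n * (2 * k)) (iota c) = 0.
    rewrite atr_mul (eq_bigr (fun=> atr n (iota c))) => [|j _].
      by rewrite sumr_const card_ord mulrnA mulr2n pchar2_addrr // mul0rn.
    by rewrite expnM -cF iota_expq.
  have m0 : (0 < n * (2 * k))%N by rewrite muln_gt0 n0.
  have := card_artin_schreier C m0 cL2 (iota c).
  rewrite at0 /sgn01 eqxx -(natrD _ 1 1) => /eqP; rewrite eqr_nat => /eqP h2.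
  have /card_gt0P [s] : (0 < #|[set w : L | (w ^+ 2 + w == iota c)%R]|)%N by rewrite h2.
  by rewrite inE => /eqP hs; exists s.
have mf1 : map_poly iota f1W = 'X^2 + 'X.
  by rewrite rmorphD rmorphXn /= map_polyX.
have mf2 : map_poly iota f2W = 'X^2 + 'X + (iota c)%:P.
  by rewrite !rmorphD rmorphXn /= map_polyX map_polyC.
have := @pure_sum_bound C F L iota n (2 * k) cF k20 cL chi a b hc cinj na k B
    f1W f2W 0 s ('X + 1) ('X - (s + 1)%:P) erefl cLB.
rewrite -/h -/d -/(deg f1W f2W) -/mW mf1 mf2.
have -> : \sum_(w : L) chi (ext_norm iota (2 * k) ('X^2 + 'X).[w]) ^+ a *
     chi (ext_norm iota (2 * k) ('X^2 + 'X + (iota c)%:P).[w]) ^+ b = W.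
  by apply: eq_bigr => w _; rewrite !hornerE.
apply.
- by apply: leq_trans (ltnW kB); apply: leq_trans kN; rewrite leq_addl.
- by rewrite subr0 mulrDr mulr1.
- by rewrite /root !hornerE oner_eq0.
- by rewrite /root !hornerE expr0n !add0r.
- have c2p : 2 \in [pchar {poly L}] by rewrite (rmorph_pchar polyC).
  rewrite !pchar2_oppr // polyCD -hs polyCD polyC_exp.
  have h2 : s%:P * 'X + s%:P * 'X = 0 :> {poly L} by rewrite pchar2_addrr.
  apply/eqP; rewrite -subr_eq0; apply/eqP; rewrite -[RHS]oppr0 -h2; ring.
- by rewrite root_XsubC -subr_eq0 opprD addrA subrr sub0r oppr_eq0 oner_eq0.
- by rewrite /root !hornerE hs.
Qed.

(** * The bound for mixed character sums *)

From mathcomp Require Import classical_sets reals exp trigo.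
Local Open Scope complex_scope.
Import ComplexField.Normc.

Lemma norm_normc (R : rcfType) (z : R[i]) : `|z| = (normc z)%:C.
Proof. by rewrite normc_def; case: z. Qed.

Lemma normc_ge0 (R : rcfType) (z : R[i]) : 0 <= normc z.
Proof. by case: z => x y; rewrite /normc sqrtr_ge0. Qed.

Lemma normcX (R : rcfType) (z : R[i]) k : normc (z ^+ k) = normc z ^+ k.
Proof. by elim: k => [|k IH]; rewrite ?normc1 // !exprS normcM IH. Qed.

(** By Bernoulli's inequality the powers of a number above 1 are unbounded. *)
Lemma le1_of_bounded_powers (R : realType) (x K : R) N : 0 <= x ->
  (forall k, (N <= k)%N -> x ^+ k <= K) -> x <= 1.
Proof.
move=> x0 h; rewrite leNgt; apply/negP => x1.
have bern k : 1 + k%:R * (x - 1) <= x ^+ k.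
  elim: k => [|k IH]; first by rewrite mul0r addr0 expr0.
  rewrite exprS -natr1; have hk : 0 <= (k%:R : R) by rewrite ler0n.
  have h1 := ler_wpM2l x0 IH; have h2 := mulr_ge0 hk (sqr_ge0 (x - 1)).
  apply: le_trans h1; rewrite -subr_ge0; apply: le_trans h2 _.
  by rewrite le_eqVlt; apply/orP; left; apply/eqP; ring.
have e0 : 0 < x - 1 by rewrite subr_gt0.
have K0 : 0 <= K by apply: le_trans (h N (leqnn N)); rewrite exprn_ge0.
pose m := (N + Num.bound (K / (x - 1)))%N.
have := h m (leq_addr _ _); apply/negP; rewrite -ltNge.
apply: lt_le_trans (bern m).
have hb : K / (x - 1) < m%:R.
  apply: lt_le_trans (archi_boundP _) _; first by rewrite divr_ge0 // ltW.
  by rewrite ler_nat leq_addl.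
by move: hb; rewrite ltr_pdivrMr //; lra.
Qed.

(* The power sums control the product l1 l2, hence both roots. *)
Lemma eigen_bound (R : realType) (l1 l2 : R[i]) (q K N : nat) : (0 < q)%N ->
  (forall k, (N <= k)%N -> `|l1 ^+ (2 * k) + l2 ^+ (2 * k)| <= (K * q ^ k)%:R) ->
  normc l1 ^+ 2 <= q%:R /\ normc l2 ^+ 2 <= q%:R.
Proof.
move=> q0 H; pose u := l1 ^+ 2; pose v := l2 ^+ 2.
have qR : 0 < (q%:R : R) by rewrite ltr0n.
have Hn k : (N <= k)%N -> normc (u ^+ k + v ^+ k) <= K%:R * q%:R ^+ k.
  move=> /H; rewrite norm_normc natrM natrX -!exprM.
  rewrite -(rmorph_nat (real_complex R) K) -(rmorph_nat (real_complex R) q).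
  by rewrite -rmorphXn -rmorphM lecR.
rewrite -!normcX -/u -/v; clearbody u v.
pose x := normc u / q%:R; pose y := normc v / q%:R.
have x0 : 0 <= x by rewrite divr_ge0 ?normc_ge0 ?ler0n.
have y0 : 0 <= y by rewrite divr_ge0 ?normc_ge0 ?ler0n.
have xq : normc u = x * q%:R by rewrite divfK // gt_eqF.
have yq : normc v = y * q%:R by rewrite divfK // gt_eqF.
(* The sums u^k + v^k could be small by cancellation, but 2 u^k v^k = (u^k + v^k)^2 - (u^(2k) +
   v^(2k)) bounds the product. *)
have xy : x * y <= 1.
  apply: (@le1_of_bounded_powers _ _ ((K%:R ^+ 2 + K%:R) / 2) N); first exact: mulr_ge0.
  move=> k kN; have k2 : (N <= 2 * k)%N by rewrite mul2n -addnn (leq_trans kN) // leq_addr.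
  have E : (u ^+ k * v ^+ k) * 2%:R =
      (u ^+ k + v ^+ k) ^+ 2 + - (u ^+ (2 * k) + v ^+ (2 * k)).
    by rewrite mulnC !exprM; ring.
  have := le_normcD ((u ^+ k + v ^+ k) ^+ 2) (- (u ^+ (2 * k) + v ^+ (2 * k))).
  rewrite -E mulr_natr normcMn normcN normcX normcM !normcX xq yq !exprMn => le1.
  have hk := Hn k kN; have h2k := Hn _ k2.
  have sq : normc (u ^+ k + v ^+ k) ^+ 2 <= (K%:R * q%:R ^+ k) ^+ 2.
    by rewrite ler_sqr // ?nnegrE ?normc_ge0 // mulr_ge0 ?exprn_ge0 ?ler0n.
  have qk : 0 < (q%:R : R) ^+ k * q%:R ^+ k by rewrite mulr_gt0 ?exprn_gt0.
  rewrite -(ler_pM2r qk).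
  have e2 : (q%:R : R) ^+ (2 * k) = q%:R ^+ k * q%:R ^+ k by rewrite mulnC exprM expr2.
  rewrite e2 in h2k; move: le1 sq h2k; rewrite mulr2n expr2; set X := x ^+ k; set Y := y ^+ k.
  set Q := q%:R ^+ k; set s := normc _; set t := normc _; nra.
(* If p > 1 then r <= 1, so p^k <= K + r^k stays bounded, a contradiction. *)
have side (p r : R) (w z : R[i]) : 0 <= p -> 0 <= r -> normc w = p * q%:R -> normc z = r * q%:R ->
    p * r <= 1 -> (forall k, (N <= k)%N -> normc (w ^+ k + z ^+ k) <= K%:R * q%:R ^+ k) ->
    p <= 1.
  move=> p0 r0 wE zE pr hw; rewrite leNgt; apply/negP => p1.
  have r1 : r <= 1 by nra.
  suff : p <= 1 by rewrite leNgt p1.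
  apply: (@le1_of_bounded_powers _ _ (K%:R + 1) N) => // k kN.
  have := le_normcD (w ^+ k + z ^+ k) (- z ^+ k).
  rewrite addrK normcN !normcX wE zE !exprMn => le1.
  have qk : 0 < (q%:R : R) ^+ k by rewrite exprn_gt0.
  have rk : r ^+ k <= 1 by rewrite exprn_ile1.
  rewrite -(ler_pM2r qk); have := hw k kN; nra.
have hx := side x y u v x0 y0 xq yq xy Hn.
have hy : y <= 1.
  apply: (side y x v u y0 x0 yq xq); first by rewrite mulrC.
  by move=> k kN; rewrite addrC; apply: Hn.
by rewrite xq yq; split; rewrite ler_piMl // ltW.
Qed.

Lemma Lsum_mixed1 (C : numClosedFieldType) (F : finFieldType) (chi psi : F -> C) a b :
  Lsum (mixed_weight chi psi a b) 1 =
  \sum_(x : F) chi x ^+ a * chi (x + 1) ^+ b * psi x.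
Proof.
transitivity (\sum_(g <- [seq 'X + x%:P | x <- index_enum F]) mixed_weight chi psi a b g).
  apply: perm_big; apply: uniq_perm; first exact: monics_uniq.
    rewrite (@map_inj_uniq F {poly F}) ?index_enum_uniq //.
    by move=> x y /addrI /polyC_inj.
  move=> g; rewrite mem_monics; apply/andP/mapP => [[mg /eqP sg]|[x _ ->]]; last first.
    by rewrite -[x]opprK polyCN monicXsubC size_XsubC.
  exists g`_0; first exact: mem_index_enum.
  apply/polyP => -[|[|i]]; rewrite coefD coefX coefC ?add0r ?addr0 //.
    by have := monicP mg; rewrite lead_coefE sg.
  by rewrite nth_default // sg.
rewrite big_map; apply: eq_bigr => x _.
rewrite /mixed_weight /subcoef !hornerE addrC.
have -> : size ('X + x%:P) = 2 by rewrite -[x]opprK polyCN size_XsubC.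
by rewrite coefXM /= coefD coefX coefC add0r.
Qed.

Theorem weil_mixed (R : realType) (F : finFieldType) n (chi psi : F -> R[i]) a b :
  (0 < n)%N -> #|F| = (2 ^ n)%N ->
  mulchar chi -> (forall x, chi x = 1 -> x = 1) -> addsign psi ->
  ~~ (#|F|.-1 %| a)%N ->
  normc (\sum_(x : F) chi x ^+ a * chi (x + 1) ^+ b * psi x) ^+ 2 <= 4 * #|F|%:R.
Proof.
move=> n0 cF hc cinj hp na.
have [l1 [l2 [hL hP]]] := psum_eigen b hc cinj hp na.
have [K [N hK]] := psum_bound b n0 cF hc cinj hp na.
have q0 : (0 < #|F|)%N by rewrite ltnW // finNzRing_gt1.
have [h1 h2] : normc l1 ^+ 2 <= #|F|%:R /\ normc l2 ^+ 2 <= #|F|%:R.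
  apply: (@eigen_bound _ _ _ _ K N.+1 q0) => k kN.
  have := hK k (2 * k)%N (ltnW kN) (leqnn _).
  by rewrite hP ?normrN // leqnn andbT muln_gt0 (leq_ltn_trans _ kN).
rewrite -Lsum_mixed1 hL normcN.
have t1 : normc (l1 + l2) ^+ 2 <= (normc l1 + normc l2) ^+ 2.
  by rewrite ler_sqr ?nnegrE ?addr_ge0 ?normc_ge0 ?le_normcD.
apply: le_trans t1 _; have := sqr_ge0 (normc l1 - normc l2).
by nra.
Qed.

(** * The field model of the register *)

Definition xorb_bits n (z z' : bits n) : bits n := [ffun i => z i (+) z' i].

Section FieldModel.
Variables (n : nat) (a : nat -> bool).
Hypotheses (n2 : (2 <= n)%N) (maxa : maximal n a).
Local Notation al := (@alpha n a).
Local Notation N1 := (2 ^ n - 1)%N.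

Lemma nbit_ord (z : bits n) (i : 'I_n) : nbit z i = z i.
Proof. by rewrite /nbit valK. Qed.

Lemma nbit_xor (z z' : bits n) k : nbit (xorb_bits z z') k = nbit z k (+) nbit z' k.
Proof. by rewrite /nbit; case: insub => [i|] //=; rewrite ffunE. Qed.

Lemma alpha_xor z z' : al (xorb_bits z z') = xorb_bits (al z) (al z').
Proof.
apply/ffunP => i; rewrite !ffunE; case: ifP => _; first exact: nbit_xor.
have -> : \big[addb/false]_(1 <= k < n) (a k && nbit (xorb_bits z z') k) =
   \big[addb/false]_(1 <= k < n) (a k && nbit z k) (+)
   \big[addb/false]_(1 <= k < n) (a k && nbit z' k).
  by rewrite -big_split; apply: eq_bigr => k _; rewrite nbit_xor; case: (a k).
by rewrite nbit_xor addbACA.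
Qed.

Lemma alpha_zero : al (zero_bits n) = zero_bits n.
Proof.
have z0 k : nbit (zero_bits n) k = false.
  by rewrite /nbit; case: insub => [i|] //=; rewrite ffunE.
apply/ffunP => i; rewrite !ffunE z0 z0 big1 ?if_same // => k _.
by rewrite z0 andbF.
Qed.

(** The shift keeps bits 1 to n - 1, and bit 0 is recovered from the feedback bit, where its
    coefficient is 1. *)
Lemma alpha_inj : injective al.
Proof.
move=> z z' e; have hS k : (0 < k)%N -> nbit z k = nbit z' k.
  case: k => // k _; have [kn|kn] := ltnP k.+1 n; last first.
    by rewrite /nbit insubN // -leqNgt.
  have kn' : (k < n)%N by apply: ltnW.
  have := congr1 (fun f : bits n => f (Ordinal kn')) e.
  by rewrite !ffunE /= kn.
have h0 : nbit z 0 = nbit z' 0.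
  have nn : (n.-1 < n)%N by rewrite ltn_predL ltnW.
  have := congr1 (fun f : bits n => f (Ordinal nn)) e.
  rewrite !ffunE /= prednK ?ltnn ?(ltnW n2) //.
  rewrite (eq_big_nat _ _ (F2 := fun k => a k && nbit z' k)).
    by move/addIb.
  by move=> k /andP[k0 _]; rewrite hS.
apply/ffunP => i; rewrite -!nbit_ord; case: (posnP i) => [->|] //; exact: hS.
Qed.

Lemma one_bits_neq0 : one_bits n != zero_bits n.
Proof.
have nn : (n.-1 < n)%N by rewrite ltn_predL ltnW.
apply/eqP => /(congr1 (fun f : bits n => f (Ordinal nn))).
by rewrite !ffunE /= prednK ?eqxx // ltnW.
Qed.

Lemma iter_alpha_neq0 j z : z != zero_bits n -> iter j al z != zero_bits n.
Proof.
move=> z0; elim: j => // j IH; rewrite iterS; apply: contra IH => /eqP e.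
by apply/eqP; apply: alpha_inj; rewrite e alpha_zero.
Qed.

Lemma order_alpha : fingraph.order al (one_bits n) = N1.
Proof.
rewrite /fingraph.order (eq_card (B := predC1 (zero_bits n))).
  by rewrite cardC1 card_ffun card_bool card_ord subn1.
move=> z; rewrite !inE; apply/idP/idP => [/iter_findex <-|z0].
  exact/iter_alpha_neq0/one_bits_neq0.
by have [j <-] := maxa one_bits_neq0 z0; apply: fconnect_iter.
Qed.

Lemma iter_alpha_period z : iter N1 al z = z.
Proof.
have e1 : iter N1 al (one_bits n) = one_bits n.
  by rewrite -order_alpha iter_order //; apply: alpha_inj.
have [->|z0] := eqVneq z (zero_bits n).
  by elim: (N1) => // j IH; rewrite iterS IH alpha_zero.
have [j <-] := maxa one_bits_neq0 z0.
by rewrite -iterD addnC iterD e1.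
Qed.

Lemma iter_alpha_one_inj i j : (i < N1)%N -> (j < N1)%N ->
  iter i al (one_bits n) = iter j al (one_bits n) -> i = j.
Proof.
move=> iN jN e; apply/eqP.
have := nth_uniq (one_bits n) _ _ (orbit_uniq al (one_bits n)).
move=> /(_ i j); rewrite size_orbit order_alpha => /(_ iN jN) <-.
by rewrite /fingraph.orbit !nth_traject ?order_alpha // e.
Qed.

(* Fourier analysis of the alpha-orbits: the F-valued functional
   sum_j g^-j l(alpha^j z) is an eigenvector of alpha for every g, and these
   functionals sum up to l. *)
Lemma field_model : exists (F : finFieldType) (phi : bits n -> F) (b : F),
  [/\ #|F| = (2 ^ n)%N, forall z z', phi (xorb_bits z z') = phi z + phi z',
      bijective phi, forall z, phi (al z) = b * phi z & phi (one_bits n) = 1].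
Proof.
have n0 : (0 < n)%N by apply: ltnW.
have [F c2 cF] := @pPrimePowerField 2 n isT n0.
have N1E : N1 = #|F|.-1 by rewrite cF subn1.
have N10 : (0 < N1)%N by rewrite N1E card_pred_gt0.
have nn : (n.-1 < n)%N by rewrite ltn_predL.
pose l (z : bits n) : F := (z (Ordinal nn))%:R.
have lD z z' : l (xorb_bits z z') = l z + l z'.
  rewrite /l ffunE; case: (z _); case: (z' _); rewrite ?addr0 ?add0r //=.
  by rewrite pchar2_addrr.
pose ph (g : F) z := \sum_(j < N1) g ^- j * l (iter j al z).
have phD g z z' : ph g (xorb_bits z z') = ph g z + ph g z'.
  rewrite /ph -big_split; apply: eq_bigr => j _ /=; rewrite -mulrDr -lD.
  congr (_ * l _); elim: (j : nat) => // i IH; by rewrite !iterS IH alpha_xor.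
have phA g z : g != 0 -> ph g (al z) = g * ph g z.
  move=> g0; rewrite /ph.
  pose f j := g ^- j * l (iter j al z).
  transitivity (g * \sum_(j < N1) f j.+1).
    rewrite mulr_sumr; apply: eq_bigr => j _; rewrite /f -iterSr exprS.
    by rewrite invfM !mulrA mulfV // mul1r.
  congr (_ * _); have fN : f N1 = f 0%N.
    rewrite /f iter_alpha_period /= expr0 N1E expf_card_pred //.
  rewrite -[LHS](addrK (f 0%N)) addrC.
  have := big_ord_recl N1 (fun j : 'I_N1.+1 => f j) (op := +%R) (idx := 0).
  have := big_ord_recr N1 (fun j : 'I_N1.+1 => f j) (op := +%R) (idx := 0).
  move=> /= -> /= e; rewrite addrA [- _ + _]addrC addrAC; rewrite fN in e.
  by apply/esym; apply: (addIr (f 0%N)); rewrite e; ring.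
(* Orthogonality on the multiplicative group: the powers g^(-j) sum to zero for 0 < j < 2^n - 1, and
   to 2^n - 1 for j = 0, which is 1 in characteristic two. *)
have phsum z : \sum_(g | g != 0) ph g z = l z.
  rewrite /ph exchange_big /=; case: (N1) N10 N1E => // M _ ME.
  rewrite big_ord_recl /= [X in _ + X]big1 ?addr0 => [|j _].
    rewrite (eq_bigr (fun=> l z)) => [|g _]; last by rewrite expr0 invr1 mul1r.
    rewrite sumr_const cardC1 -ME mulrS.
    have -> : l z *+ M = 0; last by rewrite addr0.
    have : (M.+2 = 2 ^ n)%N by rewrite ME -cF prednK // cF expn_gt0.
    case: n n0 => // n' _; rewrite expnS mul2n => hM.
    have -> : M = (M./2).*2 by move: (odd_double_half M); have := congr1 odd hM; rewrite /= negbK odd_double => ->.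
    by rewrite -mul2n mulrnA mulr2n pchar2_addrr // mul0rn.
  rewrite -mulr_suml; set S := \sum_(g | _) _.
  have [v v0 vj] : exists2 v : F, v != 0 & v ^+ j.+1 != 1.
    by apply: mulchar_pow_trivial; rewrite -ME !ltnS leq0n ltn_ord.
  suff -> : S = 0 by rewrite mul0r.
  have : v ^- j.+1 * S = S.
    rewrite mulr_sumr [RHS](reindex_inj (mulfI v0)) /=; apply: eq_big => g.
      by rewrite mulf_eq0 negb_or v0.
    by move=> _; rewrite /bump /= exprMn invfM.
  move/eqP; rewrite -subr_eq0 -{2}[S]mul1r -mulrBl mulf_eq0 subr_eq0 invr_eq1.
  by rewrite (negPf vj) => /eqP.
have l1 : l (one_bits n) = 1 by rewrite /l ffunE /= prednK // eqxx.
have [g [g0 pg]] : exists g, g != 0 /\ ph g (one_bits n) != 0.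
  have [/existsP [g /andP[]]|/existsPn h] :=
      boolP [exists g : F, (g != 0) && (ph g (one_bits n) != 0)]; first by exists g.
  have := phsum (one_bits n); rewrite big1 ?l1 => [/eqP|g g0].
    by rewrite eq_sym oner_eq0.
  by have := h g; rewrite g0 /= negbK => /eqP.
pose phi z := ph g z / ph g (one_bits n).
have phiD z z' : phi (xorb_bits z z') = phi z + phi z' by rewrite /phi phD mulrDl.
have phiA z : phi (al z) = g * phi z by rewrite /phi phA // mulrA.
have phi1 : phi (one_bits n) = 1 by rewrite /phi mulfV.
exists F, phi, g; split=> //.
(* Maximality carries any nonzero z to [one_bits], where [phi] is 1, while alpha only multiplies
   [phi] by g. *)
have phi0 z : phi z = 0 -> z = zero_bits n.
  move=> hz; apply/eqP; apply/negPn/negP => z0.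
  have [j hj] := maxa z0 one_bits_neq0.
  have : phi (iter j al z) = 0 by elim: (j) => // i IH; rewrite iterS phiA IH mulr0.
  by rewrite hj phi1 => /eqP; rewrite oner_eq0.
apply: inj_card_bij; last by rewrite cF card_ffun card_bool card_ord.
move=> z z' e; have : phi (xorb_bits z z') = 0 by rewrite phiD e pchar2_addrr.
move/phi0 => /ffunP h; apply/ffunP => i; have := h i; rewrite !ffunE.
by case: (z i); case: (z' i).
Qed.

End FieldModel.

(** * The states as multiplicative characters, and their Pauli elements *)

Lemma omegaX (R : realType) n j : omega R n ^+ j =
  cos (2 * pi / (2 ^ n - 1)%:R *+ j) +i* sin (2 * pi / (2 ^ n - 1)%:R *+ j).
Proof.
elim: j => [|j IH]; first by rewrite expr0 mulr0n cos0 sin0.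
rewrite exprS IH ![_ *+ j.+1]mulrS cosD sinD /omega; simpc.
by congr (_ +i* _); rewrite addrC.
Qed.

Lemma omega_period (R : realType) n : (0 < 2 ^ n - 1)%N -> omega R n ^+ (2 ^ n - 1) = 1.
Proof.
move=> N0; rewrite omegaX -mulr_natr divfK ?pnatr_eq0 -?lt0n //.
by rewrite mulr_natl cos2pi sin2pi.
Qed.

(** With 2t the argument of omega^j, cos(2t) = 1 would force sin t = 0, although 0 < t < pi. *)
Lemma omega_primitive (R : realType) n j :
  (0 < j < 2 ^ n - 1)%N -> omega R n ^+ j != 1.
Proof.
move=> /andP[j0 jN]; apply/negP => /eqP.
rewrite omegaX => -[hc _].
set t := pi * (j%:R / (2 ^ n - 1)%:R) : R.
have tE : 2 * pi / (2 ^ n - 1)%:R *+ j = t *+ 2.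
  by rewrite /t -[LHS]mulr_natr -[RHS]mulr_natr; ring.
have N0 : (0 : R) < (2 ^ n - 1)%:R by rewrite ltr0n (leq_ltn_trans _ jN).
have st : 0 < sin t.
  apply: sin_gt0_pi; apply/andP; split.
    by apply: mulr_gt0; [apply: pi_gt0|rewrite divr_gt0 // ltr0n].
  by rewrite gtr_pMr ?pi_gt0 // ltr_pdivrMr // mul1r ltr_nat.
move: hc; rewrite tE mulr2n cosD.
have := cos2Dsin2 t; nra.
Qed.

Section Characters.
Variables (R : realType) (n : nat) (a : nat -> bool).
Hypotheses (n2 : (2 <= n)%N) (maxa : maximal n a).
Variables (F : finFieldType) (phi : bits n -> F) (b : F).
Hypotheses (cF : #|F| = (2 ^ n)%N) (phib : bijective phi)
  (phiD : forall z z', phi (xorb_bits z z') = phi z + phi z')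
  (phiA : forall z, phi (@alpha n a z) = b * phi z)
  (phi1 : phi (one_bits n) = 1).
Local Notation N1 := (2 ^ n - 1)%N.

Lemma N1_gt0 : (0 < N1)%N.
Proof. by have := card_pred_gt0 F; rewrite cF subn1. Qed.

Lemma phi_iter j z : phi (iter j (@alpha n a) z) = b ^+ j * phi z.
Proof. by elim: j => [|j IH]; rewrite ?mul1r // iterS phiA IH exprS mulrA. Qed.

Lemma phi_zero : phi (zero_bits n) = 0.
Proof.
have := phiD (zero_bits n) (zero_bits n).
have -> : xorb_bits (zero_bits n) (zero_bits n) = zero_bits n.
  by apply/ffunP => i; rewrite !ffunE.
by move/eqP; rewrite -subr_eq0 opprD addrA subrr sub0r oppr_eq0 => /eqP.
Qed.

Lemma phi_eq0 z : (phi z == 0) = (z == zero_bits n).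
Proof. by rewrite -phi_zero (inj_eq (bij_inj phib)). Qed.

Lemma gen_neq0 : b != 0.
Proof.
apply: contra (one_bits_neq0 n2) => /eqP b0.
have := phiA (one_bits n); rewrite b0 mul0r => /eqP; rewrite phi_eq0.
by rewrite -{1}(alpha_zero n a) (inj_eq (alpha_inj n2)).
Qed.

Lemma gen_log y : y != 0 -> exists2 j, (j < N1)%N & y = b ^+ j.
Proof.
case: phib => psi psiK phiK y0.
have z0 : psi y != zero_bits n by rewrite -phi_eq0 phiK.
have [j hj] := maxa (one_bits_neq0 n2) z0.
exists (j %% N1)%N; first by rewrite ltn_mod N1_gt0.
rewrite -(phiK y) -hj phi_iter phi1 mulr1 {1}(divn_eq j N1) exprD mulnC exprM.
by rewrite subn1 -cF expf_card_pred ?gen_neq0 // expr1n mul1r.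
Qed.

Lemma gen_inj i j : (i < N1)%N -> (j < N1)%N -> b ^+ i = b ^+ j -> i = j.
Proof.
move=> iN jN e; apply: (iter_alpha_one_inj n2 maxa iN jN); apply: (bij_inj phib).
by rewrite !phi_iter e.
Qed.

(** The character b^j -> omega^j, written as a sum over j so that it needs no discrete logarithm and
    is 0 at 0. *)
Definition chi0 (y : F) : R[i] := \sum_(j < N1) omega R n ^+ j * (b ^+ j == y)%:R.

Lemma chi0_gen j : chi0 (b ^+ j) = omega R n ^+ j.
Proof.
have -> : b ^+ j = b ^+ (j %% N1).
  rewrite {1}(divn_eq j N1) exprD mulnC exprM.
  by rewrite subn1 -cF expf_card_pred ?gen_neq0 // expr1n mul1r.
have -> : omega R n ^+ j = omega R n ^+ (j %% N1).
  by rewrite {1}(divn_eq j N1) exprD mulnC exprM omega_period ?N1_gt0 // expr1n mul1r.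
have jN : (j %% N1 < N1)%N by rewrite ltn_mod N1_gt0.
rewrite /chi0 (bigD1 (Ordinal jN)) //= eqxx mulr1 big1 ?addr0 // => i ij.
case: eqP => [e|]; last by rewrite mulr0.
by case/eqP: ij; apply/val_inj/(gen_inj (ltn_ord i) jN).
Qed.

Lemma chi0_0 : chi0 0 = 0.
Proof.
rewrite /chi0 big1 // => j _.
by rewrite (negPf (expf_neq0 _ gen_neq0)) mulr0.
Qed.

Lemma mulchar_chi0 : mulchar chi0.
Proof.
split; first exact: chi0_0.
  by have := chi0_gen 0; rewrite !expr0.
move=> x y; have [->|/gen_log [i _ ->]] := eqVneq x 0.
  by rewrite mul0r chi0_0 mul0r.
have [->|/gen_log [j _ ->]] := eqVneq y 0; first by rewrite mulr0 chi0_0 mulr0.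
by rewrite -exprD !chi0_gen exprD.
Qed.

Lemma chi0_faithful x : chi0 x = 1 -> x = 1.
Proof.
have [->|/gen_log [j jN ->]] := eqVneq x 0.
  by rewrite chi0_0 => /eqP; rewrite eq_sym oner_eq0.
rewrite chi0_gen; case: (posnP j) => [-> //|j0 e].
by have := @omega_primitive R n j; rewrite j0 jN e eqxx => /(_ isT).
Qed.

(** Positivity of q matters at the zero string, where the amplitude is 0 but chi0(0)^0 would be
    1. *)
Lemma psiE q z : (0 < q)%N ->
  psi R a q z = ((Num.sqrt (N1%:R : R))^-1)%:C * chi0 (phi z) ^+ q.
Proof.
move=> q0; rewrite /psi; congr (_ * _).
have phE j : (iter j (@alpha n a) (one_bits n) == z) = (b ^+ j == phi z).
  by rewrite -(inj_eq (bij_inj phib)) phi_iter phi1 mulr1.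
under eq_bigr do rewrite phE.
have [->|/gen_log [j jN ->]] := eqVneq (phi z) 0.
  rewrite chi0_0 expr0n gtn_eqF // big1 // => j _.
  by rewrite (negPf (expf_neq0 _ gen_neq0)) mulr0.
rewrite chi0_gen (bigD1 (Ordinal jN)) //= eqxx mulr1 big1 ?addr0 => [|i ij].
  by rewrite -exprM mulnC.
case: eqP => [e|]; last by rewrite mulr0.
by case/eqP: ij; apply/val_inj/(gen_inj (ltn_ord i) jN).
Qed.

End Characters.

Lemma conj_norm1 (C : numClosedFieldType) (z : C) : `|z| = 1 -> (z^*)%R = z^-1.
Proof. by move=> h; rewrite invC_norm h expr1n invr1 mul1r. Qed.

Lemma conj_realC (R : rcfType) (x : R) : (x%:C^*)%R = x%:C.
Proof. exact: conjc_real. Qed.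

Section Overlap.
Variables (R : realType) (n : nat) (a : nat -> bool).
Hypotheses (n2 : (2 <= n)%N) (maxa : maximal n a).
Local Notation N1 := (2 ^ n - 1)%N.

(** The element between psi_q and psi_q' of the Pauli operator that applies the signs [sg] and then
    flips the bits in [x]. *)
Definition overlap (sg : bits n -> R[i]) (x : bits n) (q q' : nat) : R[i] :=
  \sum_z sg z * (((psi R a q (xorb_bits z x))^*)%R * psi R a q' z).

(** Conjugation turns chi^q into chi^(N1 - q). For x <> 0 the sum is mixed; for x = 0 it is a Gauss
    sum when q <> q', and a sum of signs over nonzero y when q = q'. The identity Pauli gives
    orthonormality. *)
Lemma overlap_bounds q q' (sg : bits n -> R[i]) x :
  (0 < q < N1)%N -> (0 < q' < N1)%N ->
  (forall z, sg z = 1 \/ sg z = -1) ->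
  (forall z z', sg (xorb_bits z z') = sg z * sg z') ->
  (x != zero_bits n \/ (exists z, sg z != 1) ->
    normc (overlap sg x q q') ^+ 2 <= 4 * (2 ^ n)%:R / N1%:R ^+ 2) /\
  (x = zero_bits n -> (forall z, sg z = 1) -> overlap sg x q q' = (q == q')%:R).
Proof.
move=> /andP[q0 qN] /andP[q'0 q'N] sg1 sgD.
have [F [phi [b [cF phiD phib phiA phi1]]]] := field_model n2 maxa.
have n0 : (0 < n)%N by apply: ltnW.
have [phi' phiK phi'K] := phib.
have N1E : N1 = #|F|.-1 by rewrite cF subn1.
have N10 : (0 < N1)%N := N1_gt0 cF.
set chi := @chi0 R n F b.
have hc : mulchar chi := mulchar_chi0 R n2 maxa cF phib phiD phiA phi1.
have hf : forall y, chi y = 1 -> y = 1 := chi0_faithful n2 maxa cF phib phiD phiA phi1.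
have chiN y : y != 0 -> chi y ^+ N1 = 1.
  by move=> y0; rewrite -mulcharX // N1E expf_card_pred // (mulchar1 hc).
have conjchi y r : (0 < r < N1)%N -> ((chi y ^+ r)^*)%R = chi y ^+ (N1 - r).
  move=> /andP[r0 rN]; have [->|y0] := eqVneq y 0.
    by rewrite (mulchar0 hc) !expr0n !gtn_eqF ?subn_gt0 // rmorph0.
  have h1 : `|chi y ^+ r| = 1 by rewrite normrX (mulchar_norm hc y0) expr1n.
  have u : chi y ^+ r != 0 by rewrite -normr_eq0 h1 oner_eq0.
  rewrite conj_norm1 //; apply: (mulfI u); rewrite mulfV // -exprD subnKC ?chiN //.
  exact: ltnW.
pose ps (y : F) := sg (phi' y).
have hps : addsign ps.
  split=> [y|y y']; first exact: sg1.
  by rewrite /ps -sgD; congr sg; apply: (bij_inj phib); rewrite phiD !phi'K.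
pose c : R[i] := (N1%:R)^-1.
have psiE q1 z : (0 < q1)%N -> psi R a q1 z = ((Num.sqrt (N1%:R : R))^-1)%:C * chi (phi z) ^+ q1.
  exact: (psiE R n2 maxa cF phib phiD phiA phi1).
have cE : ((Num.sqrt (N1%:R : R))^-1)%:C * ((Num.sqrt (N1%:R : R))^-1)%:C = c.
  rewrite -rmorphM -invfM -expr2 sqr_sqrtr ?ler0n // fmorphV rmorph_nat //.
have oE : overlap sg x q q' =
    c * \sum_y ps y * (chi (y + phi x) ^+ (N1 - q) * chi y ^+ q').
  rewrite /overlap (reindex_onto phi phi') /=; last by move=> y _; apply: phi'K.
  rewrite mulr_sumr; apply: eq_big => [z|z _]; first by rewrite phiK eqxx.
  rewrite !psiE // (rmorphM Num.conj) /= conj_realC conjchi ?q0 // phiD -cE /ps phiK.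
  by ring.
have Nn r : (0 < r < N1)%N -> ~~ (#|F|.-1 %| r)%N.
  move=> /andP[r0 rN]; rewrite -N1E; apply/negP => /dvdn_leq => /(_ r0).
  by rewrite leqNgt rN.
have normcc : normc c = N1%:R^-1.
  have := norm_normc c; rewrite ger0_norm; last by rewrite invr_ge0 ler0n.
  by rewrite /c -(rmorph_nat (real_complex R)) -fmorphV => /complexI.
have fin (S : R[i]) : normc S ^+ 2 <= 4 * #|F|%:R ->
    normc (c * S) ^+ 2 <= 4 * (2 ^ n)%:R / N1%:R ^+ 2.
  move=> hS; rewrite normcM normcc exprMn exprVn mulrC ler_wpM2r ?invr_ge0 ?sqr_ge0 //.
  by rewrite -cF.
(* The exponent lies strictly between 0 and 2 N1, and equals N1 only when q = q'. *)
have ne_ndvd : q != q' -> ~~ (#|F|.-1 %| N1 - q + q')%N.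
  move=> neq; rewrite -N1E; apply/negP => /dvdnP [k hk].
  case: k hk => [|[|k]] hk; [lia|lia|].
  have : (2 * N1 <= k.+2 * N1)%N by rewrite leq_mul2r orbT.
  by rewrite -hk; lia.
split; last first.
  move=> x0 sgt; rewrite oE x0 (phi_zero phiD).
  have -> : \sum_y ps y * (chi (y + 0) ^+ (N1 - q) * chi y ^+ q') =
            \sum_y chi y ^+ (N1 - q + q').
    by apply: eq_bigr => y _; rewrite /ps sgt mul1r addr0 exprD.
  have [<-|neq] := eqVneq q q'.
    rewrite subnK ?(ltnW qN) // (bigD1 0) //= (mulchar0 hc) expr0n gtn_eqF // add0r.
    rewrite (eq_bigr (fun=> 1)) => [|y y0]; last exact: chiN.
    by rewrite sumr_const cardC1 -N1E /c mulVf // pnatr_eq0 -lt0n.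
  have [t t0 ht] := mulchar_pow_nontriv hc hf (ne_ndvd neq).
  set S := \sum_y _; suff -> : S = 0 by rewrite mulr0.
  have : chi t ^+ (N1 - q + q') * S = S.
    rewrite mulr_sumr [RHS](reindex_inj (mulfI t0)) /=; apply: eq_bigr => y _.
    by rewrite (mulcharM hc) exprMn.
  move/eqP; rewrite -subr_eq0 -{2}[S]mul1r -mulrBl mulf_eq0 subr_eq0.
  by rewrite (negPf ht) => /eqP.
move=> hx; rewrite oE; apply: fin.
have [x0|x0] := eqVneq x (zero_bits n); last first.
  have s0 : phi x != 0 by rewrite (phi_eq0 phib phiD).
  set s := phi x in s0 *.
  (* Substituting y = s t normalises the shift to 1, at the price of a factor of modulus 1 and the
     additive character t -> ps(s t). *)
  rewrite (reindex_inj (mulfI s0)) /=.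
  have -> : \sum_t ps (s * t) * (chi (s * t + s) ^+ (N1 - q) * chi (s * t) ^+ q') =
     (chi s ^+ (N1 - q) * chi s ^+ q') *
     \sum_t chi t ^+ q' * chi (t + 1) ^+ (N1 - q) * ps (s * t).
    rewrite mulr_sumr; apply: eq_bigr => t _.
    have -> : s * t + s = s * (t + 1) by ring.
    by rewrite !(mulcharM hc) !exprMn; ring.
  rewrite normcM exprMn -exprD.
  have -> : normc (chi s ^+ (N1 - q + q')) = 1.
    apply: complexI; rewrite -norm_normc normrX (mulchar_norm hc s0) expr1n //.
  rewrite expr1n mul1r; apply: (weil_mixed _ n0 cF hc hf _ (Nn q' _)); last by rewrite q'0.
  by split=> [t|t t']; [apply: sg1|rewrite mulrDr (addsignD hps)].
case: hx => [|[z hz]]; first by rewrite x0 eqxx.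
rewrite x0 (phi_zero phiD).
have -> : \sum_y ps y * (chi (y + 0) ^+ (N1 - q) * chi y ^+ q') =
          \sum_y chi y ^+ (N1 - q + q') * ps y.
  by apply: eq_bigr => y _; rewrite addr0 exprD; ring.
have [<-|neq] := eqVneq q q'.
  have -> : \sum_y chi y ^+ (N1 - q + q) * ps y = -1.
    rewrite subnK ?(ltnW qN) // (bigD1 0) //= (mulchar0 hc) expr0n gtn_eqF // mul0r add0r.
    rewrite (eq_bigr ps) => [|y y0]; last by rewrite chiN // mul1r.
    have hm : ps (phi z) = -1.
      by rewrite /ps phiK; case: (sg1 z) => // e; rewrite e eqxx in hz.
    have := addsign_sum0 hps hm; rewrite (bigD1 0) //= (addsign0 hps) => /eqP.
    by rewrite addrC addr_eq0 => /eqP.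
  rewrite normcN normc1 expr1n -natrM (ler_nat _ 1).
  by rewrite muln_gt0 /= ltnW // finNzRing_gt1.
(* Exponent 0 gives the factor 1 even where chi vanishes, so the Gauss sum is a case of the mixed
   bound. *)
have := weil_mixed 0 n0 cF hc hf hps (ne_ndvd neq).
by under eq_bigr do rewrite expr0 mulr1.
Qed.

End Overlap.

(** * Reduced matrices and Walsh transforms *)

Section Walsh.
Variables (C : numClosedFieldType) (I : finType).
Implicit Types (p x y v : {ffun I -> bool}).

Definition xorf x y : {ffun I -> bool} := [ffun i => x i (+) y i].

(** The sign (-1)^(p.y), that is, the diagonal of the Pauli operator Z^p. *)
Definition walsh p y : C := \prod_i (if p i && y i then -1 else 1).

Lemma xorfC x y : xorf x y = xorf y x.
Proof. by apply/ffunP => i; rewrite !ffunE addbC. Qed.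

Lemma xorfK x y : xorf x (xorf x y) = y.
Proof. by apply/ffunP => i; rewrite !ffunE addKb. Qed.

Lemma walsh_xor p y y' : walsh p (xorf y y') = walsh p y * walsh p y'.
Proof.
rewrite /walsh -big_split; apply: eq_bigr => i _; rewrite ffunE.
by case: (p i); case: (y i); case: (y' i); rewrite //= ?mulr1 ?mul1r ?mulrNN ?mulr1.
Qed.

Lemma walsh_sign p y : walsh p y = 1 \/ walsh p y = -1.
Proof.
apply: (big_ind (fun z : C => z = 1 \/ z = -1)); first by left.
  by move=> u w [->|->] [->|->]; rewrite ?mulr1 ?mul1r ?mulrNN ?mulr1; auto.
by move=> i _; case: ifP; auto.
Qed.

Lemma sum_walsh y : \sum_p walsh p y = if y == [ffun=> false] then (2 ^ #|I|)%:R else 0.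
Proof.
rewrite /walsh -(bigA_distr_bigA (fun i (c : bool) => if c && y i then -1 else 1 : C)).
have E i : \sum_(c : bool) (if c && y i then -1 else 1 : C) = if y i then 0 else 2.
  by rewrite big_bool /=; case: (y i); rewrite ?addNr.
under eq_bigr do rewrite E.
case: eqP => [->|/eqP ny].
  under eq_bigr do rewrite ffunE /=.
  by rewrite prodr_const natrX.
have [i yi] : exists i, y i.
  apply/existsP; apply: contraNT ny => /existsPn h; apply/eqP/ffunP => i.
  by rewrite ffunE; apply/negbTE/h.
by rewrite (bigD1 i) //= yi mul0r.
Qed.

Lemma walshC p y : walsh p y = walsh y p.
Proof. by apply: eq_bigr => i _; rewrite andbC. Qed.

Lemma walsh_conj p y : ((walsh p y)^*)%R = walsh p y.
Proof. by case: (walsh_sign p y) => ->; rewrite ?rmorphN rmorph1. Qed.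

Lemma parseval (D : {ffun I -> bool} -> C) :
  \sum_p `|\sum_y walsh p y * D y| ^+ 2 = (2 ^ #|I|)%:R * \sum_y `|D y| ^+ 2.
Proof.
transitivity (\sum_y \sum_y' D y * (D y')^*%R * \sum_p walsh p (xorf y y')).
  rewrite (eq_bigr (fun p => \sum_y \sum_y' D y * (D y')^*%R * walsh p (xorf y y'))).
    rewrite exchange_big; apply: eq_bigr => y _; rewrite exchange_big.
    by apply: eq_bigr => y' _; rewrite mulr_sumr.
  move=> p _; rewrite normCK rmorph_sum /= mulr_suml; apply: eq_bigr => y _.
  rewrite mulr_sumr; apply: eq_bigr => y' _.
  by rewrite rmorphM /= walsh_conj walsh_xor; ring.
rewrite mulr_sumr; apply: eq_bigr => y _.
rewrite (bigD1 y) //= sum_walsh.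
have -> : xorf y y == [ffun=> false] by apply/eqP/ffunP => i; rewrite !ffunE addbb.
rewrite big1 => [|y' ne]; first by rewrite addr0 normCK mulrC.
rewrite sum_walsh; case: eqP => [e|]; last by rewrite mulr0.
case/eqP: ne; apply/ffunP => i; move/ffunP/(_ i): e; rewrite !ffunE.
by case: (y i); case: (y' i).
Qed.

End Walsh.

Section Reduced.
Variables (R : realType) (n : nat) (A : {set 'I_n}).
Local Notation X := (localbits A).

Definition ext_bits (v : X) : bits n :=
  [ffun i => if insub i is Some j then v j else false].

(** The reduced matrix on A of |chi><phi|; the bra comes first, as in [braket]. *)
Definition cross_rho (phi chi : state R n) (x y : X) : R[i] :=
  \sum_(z : bits n | restr A z == x)
    \sum_(z' : bits n | (restr A z' == y) && agree_off A z z') chi z * ((phi z')^*)%R.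

Lemma restr_xor_ext z v : restr A (xorb_bits z (ext_bits v)) = xorf (restr A z) v.
Proof. by apply/ffunP => j; rewrite !ffunE valK. Qed.

Lemma ext_bits_eq0 v : (ext_bits v == zero_bits n) = (v == [ffun=> false]).
Proof.
apply/eqP/eqP => [/ffunP h|->]; apply/ffunP => i.
  by have := h (val i); rewrite !ffunE valK.
by rewrite !ffunE; case: insub => // j; rewrite ffunE.
Qed.

Lemma agree_offP z z' : agree_off A z z' =
  (z' == xorb_bits z (ext_bits (xorf (restr A z) (restr A z')))).
Proof.
apply/forallP/eqP => [h|-> i]; last first.
  apply/implyP => iA; rewrite !ffunE insubN ?addbF //.
apply/ffunP => i; rewrite !ffunE; case: insubP => [j iA ji|iA].
  by rewrite !ffunE ji addKb.
by rewrite addbF; have /implyP/(_ iA)/eqP := h i.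
Qed.

Lemma cross_rhoE phi chi x y : cross_rho phi chi x y =
  \sum_(z | restr A z == x) chi z * ((phi (xorb_bits z (ext_bits (xorf x y))))^*)%R.
Proof.
apply: eq_bigr => z /eqP zx; apply: big_pred1 => z'.
apply/andP/eqP => [[/eqP <-]|->].
  by rewrite agree_offP zx => /eqP.
have e : restr A (xorb_bits z (ext_bits (xorf x y))) = y.
  by rewrite restr_xor_ext zx xorfK.
by rewrite e eqxx agree_offP e zx.
Qed.

Lemma card_subA : #|{: subA A}| = #|A|.
Proof. by rewrite card_sig; apply: eq_card. Qed.

Lemma walsh_neq1 (p : X) : p != [ffun=> false] ->
  exists z : bits n, walsh R[i] p (restr A z) != 1.
Proof.
move=> p0; have [i pi] : exists i, p i.
  apply/existsP; apply: contraNT p0 => /existsPn h; apply/eqP/ffunP => i.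
  by rewrite ffunE; apply/negbTE/h.
exists (ext_bits [ffun j => j == i]).
have -> : restr A (ext_bits [ffun j => j == i]) = [ffun j => j == i].
  by apply/ffunP => j; rewrite !ffunE valK ffunE.
rewrite /walsh (bigD1 i) //= ffunE eqxx pi /= big1 ?mulr1 => [|j ji].
  by rewrite -subr_eq0 -opprD oppr_eq0 -mulr2n pnatr_eq0.
by rewrite ffunE (negPf ji) andbF.
Qed.

Variables (a : nat -> bool).
Hypotheses (n2 : (2 <= n)%N) (maxa : maximal n a).
Local Notation N1 := (2 ^ n - 1)%N.

Definition defect q q' (x y : X) : R[i] :=
  cross_rho (psi R a q) (psi R a q') x y - ((x == y) && (q == q'))%:R / (2 ^ #|A|)%:R.

(** Along the shifted diagonal y = x + v, the Walsh transform of the reduced matrix is a Pauli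
    element with flip v and signs p. The subtracted multiple of the identity shows only at v = p =
    0. *)
Lemma sum_walsh_defect q q' (p v : X) :
  \sum_x walsh R[i] p x * defect q q' x (xorf x v) =
  overlap a (fun z => walsh R[i] p (restr A z)) (ext_bits v) q q'
   - ((v == [ffun=> false]) && (p == [ffun=> false]) && (q == q'))%:R.
Proof.
rewrite /defect; under eq_bigr do rewrite mulrBr.
rewrite sumrB; congr (_ - _).
  rewrite /overlap (partition_big (restr A) xpredT) //=; apply: eq_bigr => x _.
  rewrite cross_rhoE mulr_sumr; apply: eq_bigr => z /eqP zx.
  by rewrite zx xorfK; ring.
have e x : (x == xorf x v) = (v == [ffun=> false]).
  apply/eqP/eqP => [h|->]; last by apply/ffunP => i; rewrite !ffunE addbF.
  by apply/ffunP => i; have /ffunP/(_ i) := h; rewrite !ffunE; case: (x i); case: (v i).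
rewrite (eq_bigr (fun x => walsh R[i] x p *
    (((v == [ffun=> false]) && (q == q'))%:R / (2 ^ #|A|)%:R))) => [|x _]; last first.
  by rewrite e walshC.
rewrite -mulr_suml sum_walsh card_subA andbAC.
case: (p == _); last by rewrite mul0r andbF.
by rewrite andbT mulrCA mulfV ?mulr1 // pnatr_eq0 expn_eq0.
Qed.

(** The entries split into 2^l shifted diagonals. On each, Parseval equates 2^l times the sum of
    squares with a sum of 2^l squared Pauli elements, so a diagonal contributes at most 16/2^n. *)
Lemma sum_defect_sq q q' : (0 < q < N1)%N -> (0 < q' < N1)%N ->
  \sum_x \sum_y normc (defect q q' x y) ^+ 2 <= 2 ^+ #|A| * (16 / 2 ^+ n).
Proof.
move=> hq hq'.
have normE (z : R[i]) : `|z| ^+ 2 = (normc z ^+ 2)%:C by rewrite norm_normc -rmorphXn.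
have cX : (2 ^ #|A|)%N = #|{: X}|.
  by rewrite card_ffun card_bool card_subA.
pose S v p : R[i] := \sum_x walsh R[i] p x * defect q q' x (xorf x v).
have hS v p : normc (S v p) ^+ 2 <= 16 / 2 ^+ n.
  rewrite /S sum_walsh_defect.
  have hmul z z' : walsh R[i] p (restr A (xorf z z')) =
      walsh R[i] p (restr A z) * walsh R[i] p (restr A z').
    by rewrite -walsh_xor; congr walsh; apply/ffunP => j; rewrite !ffunE.
  have [h1 h2] := @overlap_bounds R n a n2 maxa q q' (fun z => walsh R[i] p (restr A z))
    (ext_bits v) hq hq' (fun z => walsh_sign _ p _) hmul.
  have pos : 0 <= (16 / 2 ^+ n : R) by rewrite divr_ge0 ?exprn_ge0.
  have [/andP[/eqP v0 /eqP p0]|nvp] := boolP ((v == [ffun=> false]) && (p == [ffun=> false])).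
    have -> : overlap a (fun z => walsh R[i] p (restr A z)) (ext_bits v) q q' = (q == q')%:R.
      apply: h2 => [|z]; first by apply/eqP; rewrite ext_bits_eq0 v0.
      by rewrite p0 /walsh big1 // => i _; rewrite ffunE.
    by rewrite /= subrr normc0 expr0n.
  rewrite /= subr0; apply: le_trans (h1 _) _.
    move: nvp; rewrite negb_and => /orP[v0|p0]; last by right; apply: walsh_neq1.
    by left; rewrite ext_bits_eq0.
  (* Since 2^n <= 2 (2^n - 1), the bound 4 * 2^n / (2^n - 1)^2 is at most 16 / 2^n. *)
  have NE : (N1%:R : R) = 2 ^+ n - 1 by rewrite natrB ?expn_gt0 // natrX.
  have x2 : 2 <= (2 ^+ n : R) by rewrite -natrX (ler_nat _ 2) -[2%N]expn1 leq_exp2l // ltnW.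
  rewrite natrX NE; move: x2; set x := (2 ^+ n : R) => x2.
  have x1 : 0 < x - 1 by lra.
  rewrite ler_pdivrMr ?exprn_gt0 // mulrAC ler_pdivlMr //; nra.
have e v : \sum_x normc (defect q q' x (xorf x v)) ^+ 2 <= 16 / 2 ^+ n.
  have := @parseval R[i] _ (fun x => defect q q' x (xorf x v)).
  rewrite card_subA; under eq_bigr do rewrite normE; rewrite -(rmorph_sum (real_complex R)).
  under [X in _ * X]eq_bigr do rewrite normE; rewrite -(rmorph_sum (real_complex R)).
  rewrite -(rmorph_nat (real_complex R)) -rmorphM => /complexI E.
  have c0 : (0 : R) < (2 ^ #|A|)%:R by rewrite ltr0n expn_gt0.
  rewrite -(ler_pM2l c0) -E; apply: le_trans (ler_sum _ (fun p _ => hS v p)) _.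
  by rewrite sumr_const cX [X in _ <= X]mulr_natl.
apply: (@le_trans _ _ (\sum_v \sum_x normc (defect q q' x (xorf x v)) ^+ 2)).
  rewrite [X in _ <= X]exchange_big /= le_eqVlt; apply/orP; left; apply/eqP; apply: eq_bigr => x _.
  by rewrite (reindex_inj (can_inj (xorfK x))).
apply: le_trans (ler_sum _ (fun v _ => e v)) _.
have -> : (2 ^+ #|A| : R) = #|{: X}|%:R by rewrite -cX natrX.
by rewrite sumr_const [X in _ <= X]mulr_natl.
Qed.

End Reduced.

(** * Operator norms, local operators and the matrix element bound *)

Lemma cauchy_schwarz_sum (R : realFieldType) (I : finType) (u v : I -> R) :
  (\sum_i u i * v i) ^+ 2 <= (\sum_i u i ^+ 2) * (\sum_i v i ^+ 2).
Proof.
(* Lagrange's identity. *)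
have E : \sum_i \sum_j (u i * v j - u j * v i) ^+ 2 =
   ((\sum_i u i ^+ 2) * (\sum_i v i ^+ 2) - (\sum_i u i * v i) ^+ 2) *+ 2.
  have sep (f g : I -> R) : \sum_i \sum_j f i * g j = (\sum_i f i) * (\sum_j g j).
    by rewrite mulr_suml; apply: eq_bigr => i _; rewrite mulr_sumr.
  transitivity (\sum_i \sum_j (u i ^+ 2 * v j ^+ 2) + \sum_i \sum_j (v i ^+ 2 * u j ^+ 2)
     + \sum_i \sum_j (- 2 * (u i * v i)) * (u j * v j)).
    rewrite -!big_split /=; apply: eq_bigr => i _.
    by rewrite -!big_split /=; apply: eq_bigr => j _; ring.
  by rewrite !sep -mulr_sumr; ring.
have : 0 <= \sum_i \sum_j (u i * v j - u j * v i) ^+ 2.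
  by apply: sumr_ge0 => i _; apply: sumr_ge0 => j _; apply: sqr_ge0.
by rewrite E pmulrn_lge0 // subr_ge0.
Qed.

Lemma le_normc_sum (R : rcfType) (I : finType) (P : pred I) (f : I -> R[i]) :
  normc (\sum_(i | P i) f i) <= \sum_(i | P i) normc (f i).
Proof.
elim/big_rec2: _ => [|i y x _ le]; first by rewrite normc0.
by apply: le_trans (le_normcD _ _) _; rewrite lerD2l.
Qed.

Lemma cauchy_schwarz_normc (R : rcfType) (I : finType) (u v : I -> R[i]) :
  normc (\sum_i u i * v i) ^+ 2 <=
  (\sum_i normc (u i) ^+ 2) * (\sum_i normc (v i) ^+ 2).
Proof.
apply: le_trans (cauchy_schwarz_sum (fun i => normc (u i)) (fun i => normc (v i))).
rewrite ler_sqr ?nnegrE ?normc_ge0 ?sumr_ge0 // => [|i _].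
  by apply: le_trans (le_normc_sum _ _) _; apply: ler_sum => i _; rewrite normcM.
by rewrite mulr_ge0 ?normc_ge0.
Qed.

Section OperatorNorm.
Variables (R : realType) (n : nat) (O : operator R n).

(** A supremum dominates its set only if the set is bounded; here the Frobenius norm is a bound. *)
Lemma opnorm_ub (v : state R n) : vnorm v = 1 -> vnorm (apply_op O v) <= opnorm O.
Proof.
move=> v1; apply: ub_le_sup; last by exists v.
exists (Num.sqrt (\sum_z \sum_z' normc (O z z') ^+ 2)) => _ [w [w1 ->]].
have ws : \sum_z normc (w z) ^+ 2 = 1.
  have h0 : 0 <= \sum_z normc (w z) ^+ 2 by apply: sumr_ge0 => z _; apply: sqr_ge0.
  by rewrite -(sqr_sqrtr h0) -/(vnorm w) w1 expr1n.
rewrite /vnorm ler_wsqrtr //; apply: ler_sum => z _; rewrite /apply_op.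
by apply: le_trans (cauchy_schwarz_normc _ _) _; rewrite ws mulr1.
Qed.

Lemma column_norm (z : bits n) : \sum_w normc (O w z) ^+ 2 <= opnorm O ^+ 2.
Proof.
pose e : state R n := fun w => (w == z)%:R.
have e1 : vnorm e = 1.
  rewrite /vnorm (bigD1 z) //= /e eqxx normc1 expr1n big1 ?addr0 ?sqrtr1 // => w wz.
  by rewrite (negPf wz) normc0 expr0n.
have := opnorm_ub e1.
have -> : vnorm (apply_op O e) = Num.sqrt (\sum_w normc (O w z) ^+ 2).
  congr Num.sqrt; apply: eq_bigr => w _; rewrite /apply_op /e (bigD1 z) //= eqxx mulr1.
  by rewrite big1 ?addr0 // => w' /negPf ->; rewrite mulr0.
have h0 : 0 <= \sum_w normc (O w z) ^+ 2 by apply: sumr_ge0 => w _; apply: sqr_ge0.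
move=> le; rewrite -(sqr_sqrtr h0) ler_sqr ?nnegrE ?sqrtr_ge0 //.
exact: le_trans (sqrtr_ge0 _) le.
Qed.

End OperatorNorm.

Section LocalOperator.
Variables (R : realType) (n : nat) (A : {set 'I_n}) (O : operator R n).
Local Notation X := (localbits A).
Variable g : X -> X -> R[i].
Hypothesis OE : forall z z', O z z' = (agree_off A z z')%:R * g (restr A z) (restr A z').

Lemma restr_ext (v : X) : restr A (ext_bits v) = v.
Proof. by apply/ffunP => j; rewrite !ffunE valK. Qed.

Lemma agree_off_sym z z' : agree_off A z z' = agree_off A z' z.
Proof. by apply: eq_forallb => i; rewrite eq_sym. Qed.

(** The column of O at the zero extension of y contains every entry of column y of g. *)
Lemma local_column_norm y : \sum_x normc (g x y) ^+ 2 <= opnorm O ^+ 2.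
Proof.
apply: le_trans (column_norm O (ext_bits y)).
rewrite [leRHS](partition_big (restr A) xpredT) //=; apply: ler_sum => x _.
have rx : restr A (xorb_bits (ext_bits y) (ext_bits (xorf y x))) == x.
  by rewrite restr_xor_ext restr_ext xorfK.
rewrite (bigD1 (xorb_bits (ext_bits y) (ext_bits (xorf y x)))) //=.
rewrite OE agree_off_sym agree_offP (eqP rx) restr_ext eqxx mul1r lerDl.
by apply: sumr_ge0 => w _; apply: sqr_ge0.
Qed.

Lemma local_frobenius : \sum_x \sum_y normc (g x y) ^+ 2 <= 2 ^+ #|A| * opnorm O ^+ 2.
Proof.
rewrite exchange_big /=; apply: le_trans (ler_sum _ (fun y _ => local_column_norm y)) _.
by rewrite sumr_const card_ffun card_bool card_subA -[leLHS]mulr_natl natrX.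
Qed.

Lemma braket_local (phi chi : state R n) :
  braket phi O chi = \sum_x \sum_y g x y * cross_rho phi chi y x.
Proof.
rewrite /braket exchange_big /=.
rewrite [RHS]exchange_big /= (partition_big (restr A) xpredT) //=; apply: eq_bigr => y _.
under [RHS]eq_bigr do rewrite /cross_rho mulr_sumr.
rewrite [RHS]exchange_big /=; apply: eq_bigr => z' /eqP zy.
rewrite (partition_big (restr A) xpredT) //=; apply: eq_bigr => x _.
rewrite mulr_sumr [RHS]big_mkcond [LHS]big_mkcond /=; apply: eq_bigr => z _.
rewrite OE zy agree_off_sym; case: eqP => //= ->; case: ifP => _.
  by rewrite mul1r; ring.
by rewrite mul0r mulr0 mul0r.
Qed.

Lemma card_fiber (x : X) : #|[set z : bits n | restr A z == x]| = (2 ^ (n - #|A|))%N.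
Proof.
have An : (#|A| <= n)%N by rewrite -[X in (_ <= X)%N]card_ord max_card.
have e y : #|[set z : bits n | restr A z == y]| = #|[set z : bits n | restr A z == x]|.
  pose h z := xorb_bits z (ext_bits (xorf x y)).
  have hK : involutive h.
    by move=> z; apply/ffunP => i; rewrite !ffunE -addbA addbb addbF.
  rewrite -(card_imset _ (inv_inj hK)); apply: eq_card => z; rewrite inE.
  apply/imsetP/eqP => [[w + ->]|zx].
    by rewrite inE => /eqP wy; rewrite /h restr_xor_ext wy xorfC (xorfC x) xorfC xorfK.
  exists (h z); last by rewrite hK.
  by rewrite inE /h restr_xor_ext zx xorfK.
have : (\sum_(y : X) #|[set z : bits n | restr A z == y]| = 2 ^ n)%N.
  transitivity #|{: bits n}|; last by rewrite card_ffun card_bool card_ord.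
  rewrite -sum1_card (partition_big (restr A) xpredT) //=; apply: eq_bigr => y _.
  by rewrite -sum1_card; apply: eq_bigl => z; rewrite inE.
rewrite (eq_bigr _ (fun y _ => e y)) sum_nat_const card_ffun card_bool card_subA => h.
apply/eqP; rewrite -(eqn_pmul2l (expn_gt0 2 #|A|)) h -expnD subnKC //.
Qed.

Lemma trace_local : ((2 : R) ^- n)%:C * trace O = (\sum_x g x x) / (2 ^ #|A|)%:R.
Proof.
have An : (#|A| <= n)%N by rewrite -[X in (_ <= X)%N]card_ord max_card.
have -> : trace O = (2 ^ (n - #|A|))%:R * \sum_x g x x.
  rewrite /trace (partition_big (restr A) xpredT) //= mulr_sumr.
  apply: eq_bigr => x _; rewrite (eq_bigr (fun=> g x x)) => [|z /eqP zx].
    by rewrite sumr_const mulr_natl -(card_fiber x); congr (_ *+ _); apply: eq_card => z; rewrite inE.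
  rewrite OE zx (_ : agree_off A z z) ?mul1r //.
  by apply/forallP => i; rewrite eqxx implybT.
have -> : ((2 : R) ^- n)%:C = ((2 ^ n)%:R)^-1 :> R[i].
  by rewrite fmorphV rmorphXn /= rmorph_nat natrX.
rewrite mulrA mulrC; congr (_ * _).
rewrite -{1}(subnKC An) expnD natrM invfM mulfVK //.
by rewrite pnatr_eq0 expn_eq0.
Qed.

End LocalOperator.

Lemma braket_bound (R : realType) (n : nat) (a : nat -> bool) :
  (2 <= n)%N -> maximal n a ->
  forall (q q' : nat), (0 < q < 2 ^ n - 1)%N -> (0 < q' < 2 ^ n - 1)%N ->
     forall (A : {set 'I_n}) (O : operator R n), supported_on A O ->
     exists Rq : R[i],
       braket (psi R a q) O (psi R a q')
         = ((2 : R) ^- n)%:C * trace O * (q == q')%:R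
           + (powR 2 (- (n%:R) / 2))%:C * Rq
       /\ normc Rq <= 2 ^+ (2 + #|A|) * opnorm O.
Proof.
move=> n2 maxa q q' hq hq' A O [g OE].
pose err := \sum_x \sum_y g x y * @defect R n A a q q' y x.
have E : braket (psi R a q) O (psi R a q') =
    ((2 : R) ^- n)%:C * trace O * (q == q')%:R + err.
  rewrite (braket_local OE) (trace_local OE) /err /defect.
  apply/eqP; rewrite -subr_eq; apply/eqP; rewrite -sumrB mulrAC mulr_suml mulr_suml.
  apply: eq_bigr => x _; rewrite -sumrB (bigD1 x) //= [X in _ + X]big1 ?addr0 => [|y yx].
    by rewrite eqxx /=; ring.
  by rewrite (negPf yx) /= mul0r subr0 subrr.
set s : R := powR 2 (- n%:R / 2).
have s0 : 0 < s by apply: powR_gt0.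
have ss : s ^+ 2 = (2 ^+ n)^-1.
  by rewrite -powR_mulrn ?powR_ge0 // -powRrM mulfVK ?pnatr_eq0 // powRN powR_mulrn.
(* The remainder is the error rescaled by 2^(n/2). *)
exists ((s^-1)%:C * err); split.
  by rewrite E; congr (_ + _); rewrite mulrA -rmorphM mulfV ?gt_eqF // mul1r.
have op0 : 0 <= opnorm O.
  have := @opnorm_ub R n O (fun w => (w == zero_bits n)%:R).
  move=> h; apply: le_trans (h _); first exact: sqrtr_ge0.
  rewrite /vnorm (bigD1 (zero_bits n)) //= eqxx normc1 expr1n big1 ?addr0 ?sqrtr1 //.
  by move=> w wz; rewrite (negPf wz) normc0 expr0n.
(* Cauchy-Schwarz over the entries: squared Frobenius norm of the local operator times that of the
   defect. *)
have ne : normc err ^+ 2 <= (2 ^+ #|A| * opnorm O ^+ 2) * (2 ^+ #|A| * (16 / 2 ^+ n)).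
  have -> : err = \sum_(t : localbits A * localbits A) g t.1 t.2 * @defect R n A a q q' t.2 t.1.
    by rewrite /err pair_big.
  apply: le_trans (cauchy_schwarz_normc _ _) _; apply: ler_pM.
  - by apply: sumr_ge0 => t _; apply: sqr_ge0.
  - by apply: sumr_ge0 => t _; apply: sqr_ge0.
  - by have := local_frobenius OE; rewrite pair_big.
  - have := @sum_defect_sq R n A a n2 maxa q q' hq hq'.
    by rewrite exchange_big /= pair_big.
have nn : normc ((s^-1)%:C * err) = s^-1 * normc err.
  rewrite normcM; congr (_ * _); apply: complexI; rewrite -norm_normc ger0_norm //.
  by rewrite ler0c invr_ge0 ltW.
have p2 : 0 <= s * (2 ^+ (2 + #|A|) * opnorm O).
  by apply: mulr_ge0; [apply: ltW|apply: mulr_ge0 => //; apply: exprn_ge0].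
rewrite nn ler_pdivrMl // -ler_sqr ?nnegrE ?normc_ge0 //.
apply: le_trans ne _; rewrite le_eqVlt; apply/orP; left; apply/eqP.
by rewrite exprMn ss exprMn exprD; ring.
Qed.

(** * Entropy *)

Definition adjmx (C : numClosedFieldType) m n (A : 'M[C]_(m, n)) : 'M[C]_(n, m) :=
  map_mx Num.conj A^T.

Lemma char_poly_similar (K : fieldType) m (P A : 'M[K]_m) :
  P \in unitmx -> char_poly (invmx P *m A *m P) = char_poly A.
Proof.
move=> Pu; rewrite /char_poly /char_poly_mx !map_mxM /=.
set Q := map_mx polyC P; set Q' := map_mx polyC (invmx P).
have QQ : Q' *m Q = 1%:M by rewrite -map_mxM mulVmx // map_mx1.
have -> : 'X%:M - Q' *m map_mx polyC A *m Q = Q' *m ('X%:M - map_mx polyC A) *m Q.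
  rewrite mulmxBr mulmxBl; congr (_ - _).
  by rewrite scalar_mxC -mulmxA QQ mulmx1.
by rewrite !det_mulmx mulrAC -det_mulmx QQ det1 mul1r.
Qed.

(** A Gram matrix is Hermitian, hence unitarily diagonalisable, with diagonal entries that are sums
    of squared moduli. By unique factorisation the roots of the characteristic polynomial are these
    entries up to order, so their power sums are traces. *)
Lemma psd_spectrum (C : numClosedFieldType) m k (M : 'M[C]_m) (V : 'M[C]_(m, k))
    (s : seq C) :
  M = V *m adjmx V -> char_poly M = \prod_(z <- s) ('X - z%:P) ->
  [/\ forall z, z \in s -> 0 <= z, \sum_(z <- s) z = \tr M
    & \sum_(z <- s) z ^+ 2 = \tr (M *m M)].
Proof.
move=> MV cs.
have adjM p q r (A : 'M[C]_(p, q)) (B : 'M[C]_(q, r)) : adjmx (A *m B) = adjmx B *m adjmx A.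
  by rewrite /adjmx trmx_mul map_mxM.
have adjK p q (A : 'M[C]_(p, q)) : adjmx (adjmx A) = A.
  by apply/matrixP => i j; rewrite !mxE conjCK.
have Mn : M \is normalmx.
  apply/normalmxP; rewrite -/(adjmx M).
  by have -> : adjmx M = M by rewrite MV adjM adjK.
pose P := spectralmx M; pose d := spectral_diag M.
have Pu : P \in unitmx by apply: spectral_unit.
have ME : M = invmx P *m diag_mx d *m P by apply/orthomx_spectralP.
have DE : diag_mx d = P *m M *m invmx P.
  by rewrite {1}ME !mulmxA mulmxV // mul1mx mulmxK.
have iP : invmx P = adjmx P by apply: invmx_unitary; apply: spectral_unitarymx.
have d0 i : 0 <= d 0 i.
  have -> : d 0 i = (diag_mx d) i i by rewrite mxE eqxx mulr1n.
  rewrite DE iP {1}MV mulmxA -mulmxA -adjM mxE; apply: sumr_ge0 => j _.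
  by rewrite !mxE mul_conjC_ge0.
have pq : perm_eq s [seq d 0 i | i <- enum 'I_m].
  apply: prod_XsubC_eq; rewrite -cs big_map big_enum /= {1}ME char_poly_similar //.
  rewrite char_poly_trig; last first.
    by apply/is_trig_mxP => i j ij; rewrite mxE; case: eqP => // e; rewrite e ltnn in ij.
  by apply: eq_bigr => i _; rewrite mxE eqxx mulr1n.
have tr_sim (B : 'M[C]_m) : \tr (invmx P *m B *m P) = \tr B.
  by rewrite mxtrace_mulC mulmxA mulmxV // mul1mx.
split.
- by move=> z; rewrite (perm_mem pq) => /mapP [i _ ->].
- by rewrite (perm_big _ pq) big_map big_enum /= {1}ME tr_sim mxtrace_diag.
- rewrite (perm_big _ pq) big_map big_enum /=.
  have -> : M *m M = invmx P *m (diag_mx d *m diag_mx d) *m P.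
    by rewrite DE !mulmxA mulVmx // mul1mx !mulmxKV // -mulmxA mulmxKV.
  rewrite tr_sim mulmx_diag mxtrace_diag.
  by apply: eq_bigr => i _; rewrite mxE expr2.
Qed.

(* Concavity: ln r <= ln t + (r - t) / t, summed against the weights r. *)
Lemma sum_xlnx_le (R : realType) (s : seq R) (t : R) : 0 < t ->
  (forall r, r \in s -> 0 <= r) ->
  \sum_(r <- s) r * ln r <=
    ln t * (\sum_(r <- s) r) + (\sum_(r <- s) r ^+ 2) / t - \sum_(r <- s) r.
Proof.
move=> t0; elim: s => [|r s IH] hs; first by rewrite !big_nil mulr0 mul0r subr0 addr0.
rewrite !big_cons.
have {}IH := IH (fun u us => hs u (mem_behead (s := r :: s) us)).
have r0 := hs r (mem_head _ _).
suff h : r * ln r <= ln t * r + r ^+ 2 / t - r.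
  have := lerD h IH; rewrite mulrDr mulrDl; lra.
move: r0; rewrite le_eqVlt => /orP[/eqP <-|r0]; first by rewrite !mul0r expr0n mulr0 mul0r addr0 subr0.
have e : ln r = ln t + ln (1 + (r / t - 1)).
  have -> : 1 + (r / t - 1) = r / t by ring.
  by rewrite -lnM ?posrE ?divr_gt0 // mulrC divfK // gt_eqF.
have le : ln (1 + (r / t - 1)) <= r / t - 1.
  by apply: le_ln1Dx; rewrite ltrBDl subrr divr_gt0.
rewrite e mulrDr [r * ln t]mulrC -addrA lerD2l.
apply: le_trans (ler_wpM2l (ltW r0) le) _; rewrite le_eqVlt; apply/orP; left; apply/eqP.
by ring.
Qed.

Lemma conj_mul_conj (C : numClosedFieldType) (u v : C) :
  v * (u^*)%R = ((u * (v^*)%R)^*)%R.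
Proof. by rewrite rmorphM /= conjCK mulrC. Qed.

Section Entropy.
Variables (R : realType) (n : nat) (a : nat -> bool) (A : {set 'I_n}) (q : nat).
Hypotheses (n2 : (2 <= n)%N) (maxa : maximal n a) (hq : (0 < q < 2 ^ n - 1)%N).
Local Notation X := (localbits A).
Local Notation st := (@psi R n a q).

Lemma rho_entry_cross (phi : state R n) (x y : X) :
  rho_entry A phi x y = cross_rho phi phi x y.
Proof. by []. Qed.

Lemma psi_normalized : \sum_z st z * ((st z)^*)%R = 1.
Proof.
have [_ h] := @overlap_bounds R n a n2 maxa q q (fun=> 1) (zero_bits n) hq hq
  (fun=> or_introl erefl) (fun z z' => esym (mulr1 1)).
transitivity (@overlap R n a (fun=> 1) (zero_bits n) q q); last by rewrite h // eqxx.
apply: eq_bigr => z _.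
have -> : xorb_bits z (zero_bits n) = z by apply/ffunP => i; rewrite !ffunE addbF.
by rewrite mul1r mulrC.
Qed.

Lemma sum_rho_diag : \sum_x rho_entry A st x x = 1.
Proof.
rewrite -psi_normalized (partition_big (restr A) xpredT) //=; apply: eq_bigr => x _.
rewrite rho_entry_cross cross_rhoE; apply: eq_bigr => z _.
congr (_ * ((st _)^*)%R); apply/ffunP => i; rewrite !ffunE.
by case: insub => [j|]; rewrite ?ffunE ?addbb addbF.
Qed.

(** The amplitudes with x on A, as a vector over the complement; strings off A are represented by
    those vanishing on A, and the vector is padded with zeros to all strings. *)
Definition off_part (A0 : {set 'I_n}) (phi : state R n) (x : localbits A0) (w : bits n) : R[i] :=
  phi (xorb_bits w (ext_bits x)) * (restr A0 w == [ffun=> false])%:R.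

Lemma rho_entry_gram (phi : state R n) (x y : X) :
  rho_entry A phi x y = \sum_w off_part phi x w * ((off_part phi y w)^*)%R.
Proof.
rewrite rho_entry_cross cross_rhoE.
pose h z : bits n := xorb_bits z (ext_bits x).
have hK : involutive h.
  by move=> z; apply/ffunP => i; rewrite !ffunE -addbA addbb addbF.
rewrite (reindex_inj (inv_inj hK)) /= big_mkcond /=; apply: eq_bigr => w _.
rewrite /off_part /h restr_xor_ext.
have -> : (xorf (restr A w) x == x) = (restr A w == [ffun=> false]).
  apply/eqP/eqP => [e|->]; last by apply/ffunP => i; rewrite !ffunE.
  apply/ffunP => i; move/ffunP/(_ i): e; rewrite !ffunE.
  by case: (w (val i)); case: (x i).
case: eqP => _; last by rewrite !mulr0 mul0r.
rewrite !mulr1; congr (_ * ((phi _)^*)%R); apply/ffunP => i; rewrite !ffunE.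
by case: insub => [j|]; rewrite ?ffunE ?addbF // -addbA addKb.
Qed.

Lemma rhoA_gram : rhoA A st =
  let V := \matrix_(i < #|{: X}|, j < #|{: bits n}|) off_part st (enum_val i) (enum_val j) in
  V *m adjmx V.
Proof.
apply/matrixP => i j; rewrite !mxE rho_entry_gram.
rewrite (reindex (fun k : 'I_#|{: bits n}| => enum_val k)) /=; last first.
  by apply: onW_bij; apply: enum_val_bij.
by apply: eq_bigr => k _; rewrite !mxE.
Qed.

Lemma sum_enum_val (f : X -> R[i]) : \sum_(i < #|{: X}|) f (enum_val i) = \sum_x f x.
Proof.
rewrite [RHS](reindex (fun k : 'I_#|{: X}| => enum_val k)) //=.
by apply: onW_bij; apply: enum_val_bij.
Qed.

Lemma rho_entry_conj (x y : X) : rho_entry A st y x = ((rho_entry A st x y)^*)%R.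
Proof.
rewrite !rho_entry_gram rmorph_sum; apply: eq_bigr => w _.
exact: conj_mul_conj.
Qed.

(** rho_A is 2^(-l) times the identity plus a Hermitian defect of trace zero, so the cross terms of
    the square have zero trace. *)
Lemma purity_defect :
  \tr (rhoA A st *m rhoA A st) =
  (\sum_x \sum_y normc (@defect R n A a q q x y) ^+ 2 + (2 ^+ #|A|)^-1)%:C.
Proof.
set t : R[i] := ((2 ^ #|A|)%:R)^-1.
have tE : t = ((2 ^+ #|A| : R)^-1)%:C by rewrite /t fmorphV -natrX rmorph_nat.
have tr_conj : (t^*)%R = t by rewrite /t fmorphV rmorph_nat.
have t0 : (2 ^ #|A|)%:R != 0 :> R[i] by rewrite pnatr_eq0 expn_eq0.
pose D x y := @defect R n A a q q x y.
have nE (u : R[i]) : (normc u ^+ 2)%:C = u * (u^*)%R.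
  by rewrite rmorphXn /= -norm_normc normCK.
have rE x y : rho_entry A st x y = D x y + (x == y)%:R * t.
  by rewrite /D /defect eqxx andbT subrK.
have sD : \sum_x D x x = 0.
  have := sum_rho_diag; under eq_bigr do rewrite rE eqxx mul1r.
  rewrite big_split /= sumr_const card_ffun card_bool card_subA.
  have -> : t *+ 2 ^ #|A| = 1 by rewrite -[LHS]mulr_natr mulVf.
  by move/(canRL (addrK _)) => ->; rewrite subrr.
have DC x y : D y x = ((D x y)^*)%R.
  have cJ (u : R[i]) (b : bool) : ((u + b%:R * t)^*)%R = (u^*)%R + b%:R * t.
    by rewrite rmorphD rmorphM rmorph_nat /= tr_conj.
  have := rho_entry_conj x y; rewrite !rE cJ eq_sym.
  by move/addIr.
rewrite /mxtrace.
transitivity (\sum_x \sum_y rho_entry A st x y * rho_entry A st y x).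
  rewrite -sum_enum_val; apply: eq_bigr => i _; rewrite mxE -sum_enum_val.
  by apply: eq_bigr => j _; rewrite !mxE.
transitivity (\sum_x \sum_y (normc (D x y) ^+ 2)%:C + t * t *+ 2 ^ #|A|).
  have -> : t * t *+ 2 ^ #|A| = \sum_(x : X) (t * t + 2 * t * D x x).
    by rewrite big_split /= sumr_const -mulr_sumr sD mulr0 addr0 card_ffun card_bool card_subA.
  rewrite -big_split; apply: eq_bigr => x _ /=.
  rewrite (eq_bigr (fun y => (normc (D x y) ^+ 2)%:C + (if y == x then t * t + 2 * t * D x x else 0))).
    by rewrite big_split /= -big_mkcond big_pred1_eq.
  move=> y _; rewrite nE !rE [y == x]eq_sym; case: eqP => [<-|_].
    by rewrite -DC mul1r; ring.
  by rewrite !mul0r !addr0 -DC.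
rewrite rmorphD rmorph_sum /=; congr (_ + _).
  by apply: eq_bigr => x _; rewrite rmorph_sum.
by rewrite -[LHS]mulr_natr -mulrA mulVf // mulr1 tE.
Qed.

Lemma entropy_bound :
  #|A|%:R * ln 2 - powR 2 ((4 + 2 * #|A|)%:R - n%:R) <= entropyA A st.
Proof.
pose s := eigenvalues (rhoA A st).
have sE : char_poly (rhoA A st) = \prod_(z <- s) ('X - z%:P).
  rewrite /s /eigenvalues; case: closed_field_poly_normal => r /= {1}->.
  by rewrite (monicP (char_poly_monic _)) scale1r.
have [s0 s1 s2] := psd_spectrum rhoA_gram sE.
pose rs := [seq complex.Re z | z <- s].
have zRe z : z \in s -> z = (complex.Re z)%:C.
  by move=> /s0 z0; rewrite RRe_real // ger0_real.
have rs0 r : r \in rs -> 0 <= r.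
  by case/mapP => z zs ->; rewrite -ler0c -zRe // s0.
have rs1 : \sum_(r <- rs) r = 1.
  apply: complexI; rewrite rmorph_sum /= big_map -(eq_big_seq _ zRe) s1 /mxtrace.
  transitivity (\sum_x rho_entry A st x x); last exact: sum_rho_diag.
  by rewrite -sum_enum_val; apply: eq_bigr => i _; rewrite mxE.
set Df := \sum_x \sum_y normc (@defect R n A a q q x y) ^+ 2.
have rs2 : \sum_(r <- rs) r ^+ 2 = Df + (2 ^+ #|A|)^-1.
  apply: complexI; rewrite -purity_defect -s2 rmorph_sum /= big_map.
  by apply: eq_big_seq => z /zRe {2}->; rewrite rmorphXn.
have hD : Df <= 2 ^+ #|A| * (16 / 2 ^+ n) := @sum_defect_sq R n A a n2 maxa q q hq hq.
have p0 : (0 : R) < 2 ^+ #|A| by apply: exprn_gt0.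
have t0 : (0 : R) < (2 ^+ #|A|)^-1 by rewrite invr_gt0.
(* The tangent is taken at the maximally mixed eigenvalue 2^(-l). As the eigenvalues sum to 1 and
   their squares to [Df] + 2^(-l), the right side becomes -l ln 2 + 2^l [Df]. *)
have := sum_xlnx_le t0 rs0; rewrite rs1 rs2 invrK mulr1.
rewrite lnV ?posrE // lnXn // mulrDl mulVf ?gt_eqF // -[ln 2 *+ _]mulr_natl => le.
have -> : entropyA A st = - \sum_(r <- rs) r * ln r.
  by rewrite /entropyA big_map.
have -> : powR 2 ((4 + 2 * #|A|)%:R - n%:R) = 2 ^+ #|A| * (2 ^+ #|A| * (16 / 2 ^+ n)) :> R.
  rewrite powRB; last by rewrite pnatr_eq0 implybT.
  by rewrite !powR_mulrn // mul2n -addnn !exprD; ring.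
have := ler_wpM2l (ltW p0) hD; move: le; lra.
Qed.

End Entropy.

Unset Implicit Arguments.

Theorem theorem2 (R : realType) (n : nat) (a : nat -> bool) :
  (2 <= n)%N -> maximal n a ->
  (forall (q q' : nat), (0 < q < 2 ^ n - 1)%N -> (0 < q' < 2 ^ n - 1)%N ->
     forall (A : {set 'I_n}) (O : operator R n), supported_on A O ->
     exists Rq : R[i],
       braket (psi R a q) O (psi R a q')
         = ((2 : R) ^- n)%:C * trace O * (q == q')%:R
           + (powR 2 (- (n%:R) / 2))%:C * Rq
       /\ ComplexField.Normc.normc Rq <= 2 ^+ (2 + #|A|) * opnorm O)
  /\
  (forall q : nat, (0 < q < 2 ^ n - 1)%N ->
     forall A : {set 'I_n},
       #|A|%:R * ln 2 - powR 2 ((4 + 2 * #|A|)%:R - n%:R) <= entropyA A (psi R a q)).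
Proof.
move=> n2 maxa; split; first exact: (braket_bound n2 maxa).
by move=> q hq A; exact: (@entropy_bound R n a A q n2 maxa hq).
Qed.
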